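(* Let $p$ be an odd prime, $K$ a finite extension of $\mathbb{Q}_p$ with absolute ramification index $e$, and $L/K$ an extension of degree $p$ whose normal closure $\widetilde L$ over $K$ has Galois group $G=\mathrm{Gal}(\widetilde L/K)$ isomorphic to the dihedral group of order $2p$. Assume that $\widetilde L/K$ is totally ramified. Let $t$ be the ramification jump of $\widetilde L/K$, let $\ell=\frac{p+t}{2}$, and let $a$ be the remainder of $\ell$ modulo $p$. Let $H$ be the unique Hopf–Galois structure on $L/K$, $w\in H$ the element described in the context, and $\mathfrak{A}_{L/K}$ the associated order of $\mathcal{O}_L$ in $H$. Then: (1) If $a=0$, then $\mathfrak{A}_{L/K}$ is the maximal $\mathcal{O}_K$-order in $H$ and $\mathcal{O}_L$ is a free $\mathfrak{A}_{L/K}$-module. (2) If $a\neq 0$, then $\mathfrak{A}_{L/K}$ is a free $\mathcal{O}_K$-module with basis $\{\pi_K^{-n_i}w^i\}_{i=0}^{p-1}$, where $\nu_i=\lfloor\frac{a+i\ell}{p}\rfloor$ for $0\le i\le p-1$ and $n_i=\min_{0\le j\le p-1-i}(\nu_{i+j}-\nu_j)$. (3) If $a$ divides $p-1$, then $\mathcal{O}_L$ is $\mathfrak{A}_{L/K}$-free. Moreover, if $t<\frac{2pe}{p-1}-2$, then conversely $\mathfrak{A}_{L/K}$-freeness of $\mathcal{O}_L$ implies that $a$ divides $p-1$. (4) If $t\ge\frac{2pe}{p-1}-2$, then $\mathcal{O}_L$ is $\mathfrak{A}_{L/K}$-free if and only if the length $n$ of the continued fraction expansion $\frac{\ell}{p}=[a_0;a_1,\dots,a_n]$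 satisfies $n\le 4$.
   Context: Write $G=\langle\sigma,\tau\mid\sigma^p=\tau^2=1,\ \tau\sigma=\sigma^{-1}\tau\rangle$ with $\tau$ chosen so that $L$ is the fixed field of $\langle\tau\rangle$, and let $M$ be the fixed field of $\langle\sigma\rangle$ (the unique quadratic subextension of $\widetilde L/K$). Let $z\in M$ satisfy $\tau(z)=-z$, normalized so that $z$ is a uniformizer of $M$ (so $z^2\in K$ has $v_K(z^2)=1$). By Byott's uniqueness theorem $L/K$ has a unique Hopf–Galois structure $H$ (by Greither–Pareigis, $H=\widetilde L[N]^G$ with $N=\langle\lambda(\sigma)\rangle$, $\lambda$ the left translation map into $\mathrm{Perm}(G/\langle\tau\rangle)$); it contains $w=z(\sigma-\sigma^{-1})$, which acts on $L$ by $w\cdot x=z(\sigma(x)-\sigma^{-1}(x))$, and $1,w,\dots,w^{p-1}$ is a $K$-basis of $H$, so $H=K[w]$. The associated order is $\mathfrak{A}_{L/K}=\{h\in H: h\cdot x\in\mathcal{O}_L\text{ for all }x\in\mathcal{O}_L\}$. $\pi_K$ denotes a uniformizer of $K$. The ramification jump $t$ of $\widetilde L/K$ is the integer with $G_t$ of order $p$ and $G_{t+1}$ trivial (lower ramification groups); $t$ is odd, so $\ell$ is an integer. The continued fraction expansion is the standard finite one (with last partial quotient $a_n\ge 2$ when $n\ge1$), and its length is $n$. *)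

(* Defs.v *)
From HB Require Import structures.
From mathcomp Require Import all_boot all_order all_algebra.
From mathcomp Require Import all_fingroup all_solvable all_field.
From mathcomp Require Import boolp.

Set Implicit Arguments.
Unset Strict Implicit.
Unset Printing Implicit Defensive.

Import Order.TTheory GRing.Theory Num.Theory.
Local Open Scope ring_scope.

(* Valuations take values in int; the value at 0 is unspecified, and val_ge    *)
(* accounts for v(0) = +oo.                                                   *)
Definition val_ge (F : fieldType) (v : F -> int) (n : int) (x : F) : bool :=
  (x == 0) || (n <= v x).

Record normalized_valuation (F : fieldType) (v : F -> int) : Prop := {
  valM : forall x y, x != 0 -> y != 0 -> v (x * y) = v x + v y;
  valD : forall x y, x != 0 -> y != 0 -> x + y != 0 ->
    Num.min (v x) (v y) <= v (x + y);
  val_onto : forall n : int, exists2 x, x != 0 & v x = n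
}.

(* Q_p, as the completion of Q for the p-adic valuation. *)
Record padic_field (p : nat) (Q : fieldType) (v : Q -> int) : Prop := {
  padic_val : normalized_valuation v;
  padic_nat : forall n : nat, (0 < n)%N ->
    (n%:R : Q) != 0 /\ v n%:R = (logn p n)%:Z;
  padic_dense : forall (x : Q) (n : int), exists q : rat, val_ge v n (x - ratr q);
  padic_complete : forall u : nat -> Q,
    (forall n : int, exists N, forall i j, (N <= i)%N -> (N <= j)%N ->
       val_ge v n (u i - u j)) ->
    exists l, forall n : int, exists N, forall i, (N <= i)%N ->
      val_ge v n (u i - l)
}.

(* vE lies over vF, with ramification index e. *)
Definition ramification_index (F : fieldType) (E : fieldExtType F)
    (vF : F -> int) (vE : E -> int) (e : nat) : Prop :=
  (0 < e)%N /\ forall x : F, x != 0 -> vE x%:A = e%:Z * vF x.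

Definition uniformizer (F : fieldType) (v : F -> int) (M : {pred F}) (x : F) :=
  [/\ x \in M, x != 0, 0 < v x
    & forall y, y \in M -> y != 0 -> 0 < v y -> v x <= v y].

Definition integers (F : fieldType) (v : F -> int) (M : {pred F}) (x : F) : Prop :=
  (x \in M) && val_ge v 0 x.

Section Ramification.
Variables (K : fieldType) (E : splittingFieldType K) (v : E -> int).

Definition ramification_group (i : nat) : {set gal_of {:E}} :=
  [set g in ('Gal({:E} / 1%AS))%g |
    `[< forall x : E, integers v predT x -> val_ge v i.+1%:Z (g x - x) >]].

Definition ramification_jump (p t : nat) : Prop :=
  #|ramification_group t| = p /\ ramification_group t.+1 = 1%g.

Definition normal_closure (L : {subfield E}) : Prop :=
  forall F : {subfield E}, (L <= F)%VS -> normalField 1%AS F -> F = {:E}%AS.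

End Ramification.

(* The group algebra of {perm X}, for composition of permutations. MathComp   *)
(* composes from left to right, so that s \o u is u * s; likewise for         *)
(* automorphisms.                                                             *)
Definition permalg (K : fieldType) (E : fieldExtType K) (X : finType) :=
  {ffun {perm X} -> E}.

Section PermAlg.
Variables (K : fieldType) (E : fieldExtType K) (X : finType).
Implicit Types f g h : permalg E X.

HB.instance Definition _ := GRing.Lmodule.on (permalg E X).

Definition basis_elt (s : {perm X}) : permalg E X := [ffun u => (u == s)%:R].

Definition permalg_scale (c : E) f : permalg E X := [ffun s => c * f s].

Definition permalg_mul f g : permalg E X :=
  [ffun s => \sum_(u : {perm X}) f u * g (s * u^-1)%g].

Fact permalg_mulA : associative permalg_mul.
Proof.
move=> f g h; apply/ffunP => s; rewrite !ffunE.
under eq_bigr => u _ do rewrite ffunE mulr_sumr.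
under [RHS]eq_bigr => u _ do rewrite ffunE mulr_suml.
rewrite [RHS]exchange_big /=; apply: eq_bigr => u _.
rewrite [RHS](reindex_inj (mulIg u)) /=; apply: eq_bigr => r _.
by rewrite mulrA mulgK invMg mulgA.
Qed.

Fact permalg_mul1 : left_id (basis_elt 1%g) permalg_mul.
Proof.
move=> f; apply/ffunP => s; rewrite !ffunE (bigD1 1%g) //= big1 => [|u /negPf nu].
  by rewrite ffunE eqxx mul1r invg1 mulg1 addr0.
by rewrite ffunE nu mul0r.
Qed.

Fact permalg_mulr1 : right_id (basis_elt 1%g) permalg_mul.
Proof.
move=> f; apply/ffunP => s; rewrite !ffunE (bigD1 s) //= big1 => [|u nu].
  by rewrite ffunE mulgV eqxx mulr1 addr0.
by rewrite ffunE -eq_mulgV1 eq_sym (negPf nu) mulr0.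
Qed.

Fact permalg_mulDl : left_distributive permalg_mul +%R.
Proof.
move=> f g h; apply/ffunP => s; rewrite !ffunE -big_split /=.
by apply: eq_bigr => u _; rewrite ffunE mulrDl.
Qed.

Fact permalg_mulDr : right_distributive permalg_mul +%R.
Proof.
move=> f g h; apply/ffunP => s; rewrite !ffunE -big_split /=.
by apply: eq_bigr => u _; rewrite ffunE mulrDr.
Qed.

Fact permalg_1neq0 : basis_elt 1%g != 0.
Proof.
by apply/eqP => /ffunP/(_ 1%g)/eqP; rewrite !ffunE eqxx oner_eq0.
Qed.

HB.instance Definition _ := GRing.Zmodule_isNzRing.Build (permalg E X)
  permalg_mulA permalg_mul1 permalg_mulr1 permalg_mulDl permalg_mulDr
  permalg_1neq0.

Fact permalg_scaleAl (k : K) f g : k *: (f * g) = (k *: f) * g.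
Proof.
apply/ffunP => s; rewrite !ffunE scaler_sumr.
by apply: eq_bigr => u _; rewrite ffunE scalerAl.
Qed.

HB.instance Definition _ :=
  GRing.Lmodule_isLalgebra.Build K (permalg E X) permalg_scaleAl.

Fact permalg_scaleAr (k : K) f g : k *: (f * g) = f * (k *: g).
Proof.
apply/ffunP => s; rewrite !ffunE scaler_sumr.
by apply: eq_bigr => u _; rewrite ffunE scalerAr.
Qed.

HB.instance Definition _ :=
  GRing.Lalgebra_isAlgebra.Build K (permalg E X) permalg_scaleAr.

End PermAlg.

Section GreitherPareigis.
Variables (K : fieldType) (E : splittingFieldType K).
Local Notation gT := (gal_of {:E}).
Local Notation G := ('Gal({:E} / 1%AS))%g.
Variable G' : {group gT}.

(* A left coset of G' for composition is a right coset G' :* g in MathComp,    *)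
(* and composing on the left with g sends G' :* h to G' :* (h * g).           *)
Definition cosets : {set {set gT}} := rcosets G' G.

Definition left_translation (g : gT) : {perm {set gT}} :=
  restr_perm cosets (actperm 'Rs%act g).

(* The algebra E[N]^G, where G acts on N through conjugation by left          *)
(* translations.                                                              *)
Definition descent (N : {set {perm {set gT}}}) (h : permalg E {set gT}) : Prop :=
  (forall u, u \notin N -> h u = 0) /\
  (forall g, g \in G -> forall u, u \in N -> h (u ^ left_translation g)%g = g (h u)).

(* (sum_u c_u u) . x = sum_u c_u (u^-1(1 G'))(x) for x fixed by G'. *)
Definition hopf_act (h : permalg E {set gT}) (x : E) : E :=
  \sum_(u : {perm {set gT}}) h u * (repr ((u^-1)%g (G' : {set gT})) : gT) x.

End GreitherPareigis.

Section Dihedral.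
Variables (K : fieldType) (E : splittingFieldType K).
Local Notation gT := (gal_of {:E}).
Variables sigma tau : gT.
Local Notation lambda := (left_translation <[tau]>%G).

Definition dihedral_H : permalg E {set gT} -> Prop :=
  descent <[tau]>%G <[lambda sigma]>%g.

(* Because of the inverse in hopf_act, sigma corresponds to lambda(sigma)^-1: *)
(* see dihedral_w_act below.                                                      *)
Definition dihedral_w (z : E) : permalg E {set gT} :=
  permalg_scale z (basis_elt E (lambda sigma)^-1%g - basis_elt E (lambda sigma)).

Definition dihedral_act : permalg E {set gT} -> E -> E := hopf_act <[tau]>%G.

Definition associated_order (O : E -> Prop) (h : permalg E {set gT}) : Prop :=
  dihedral_H h /\ forall x, O x -> O (dihedral_act h x).

End Dihedral.

(* Bases of a module M, whose scalars form a subring S of a ring R. *)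
Definition is_basis (R V : zmodType) (S : R -> Prop) (act : R -> V -> V)
    (M : V -> Prop) (n : nat) (b : 'I_n -> V) : Prop :=
  [/\ forall i, M (b i),
      forall y, M y -> exists2 c : 'I_n -> R,
        forall i, S (c i) & y = \sum_i act (c i) (b i)
    & forall c : 'I_n -> R, (forall i, S (c i)) ->
        \sum_i act (c i) (b i) = 0 -> forall i, c i = 0].

Definition is_free (R V : zmodType) (S : R -> Prop) (act : R -> V -> V)
    (M : V -> Prop) : Prop :=
  exists n (b : 'I_n -> V), is_basis S act M b.

Section Orders.
Variables (K : fieldType) (A : algType K).
Variables (O : K -> Prop) (H : A -> Prop).

Record is_order (B : A -> Prop) : Prop := {
  order_sub : forall x, B x -> H x;
  order_one : B 1;
  order_mul : forall x y, B x -> B y -> B (x * y);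
  order_fg : exists n (b : 'I_n -> A), forall x, B x <->
    exists2 c : 'I_n -> K, forall i, O (c i) & x = \sum_i c i *: b i;
  order_span : forall x, H x -> exists n (c : 'I_n -> K) (b : 'I_n -> A),
    (forall i, B (b i)) /\ x = \sum_i c i *: b i
}.

Definition is_maximal_order (B : A -> Prop) : Prop :=
  is_order B /\
  forall C, is_order C -> (forall x, B x -> C x) -> forall x, C x -> B x.

Definition is_the_maximal_order (B : A -> Prop) : Prop :=
  is_maximal_order B /\
  forall C, is_maximal_order C -> forall x, C x <-> B x.

End Orders.

Section Exponents.
Variables p l a : nat.

Definition nu (i : nat) : nat := ((a + i * l) %/ p)%N.

(* The default value of the minimum is the term j = 0; the natural number     *)
(* subtraction is exact since nu is nondecreasing.                            *)
Definition w_exponent (i : nat) : nat :=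
  (\big[minn/nu i - nu 0]_(j < p - i) (nu (i + j) - nu j))%N.

End Exponents.

(* [a; s_1, ..., s_n] *)
Fixpoint cfrac_val (a : int) (s : seq int) : rat :=
  if s is b :: s' then a%:~R + (cfrac_val b s')^-1 else a%:~R.

Definition cfrac_expansion (x : rat) (a : int) (s : seq int) : Prop :=
  [/\ x = cfrac_val a s, all (fun b : int => 0 < b) s
    & s != [::] -> 2 <= last a s].

Section ActionOfW.
Variables (K : fieldType) (E : splittingFieldType K).
Local Notation gT := (gal_of {:E}).
Local Notation G := ('Gal({:E} / 1%AS))%g.

Lemma galT (g : gT) : g \in G.
Proof. by rewrite gal_kHom ?sub1v // k1HomE ahomWin // gal_is_ahom. Qed.

Lemma left_translationE (G' : {group gT}) (g h : gT) :
  left_translation G' g (G' :* h)%g = (G' :* (h * g))%g.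
Proof.
rewrite /left_translation restr_permE ?actpermE /= ?rcosetE ?rcosetM //.
  apply/astabsP => C /=; rewrite /aperm actpermE /= rcosetE.
  apply/rcosetsP/rcosetsP => -[k _ Ck].
    exists (k * g^-1)%g; first exact: galT.
    by rewrite rcosetM -Ck -rcosetM mulgV rcoset1.
  by exists (k * g)%g; rewrite ?galT // Ck rcosetM.
by apply/rcosetsP; exists h; rewrite ?galT.
Qed.

Lemma left_translationM (G' : {group gT}) (g h : gT) :
  left_translation G' (g * h)%g = (left_translation G' g * left_translation G' h)%g.
Proof.
apply/permP => C; rewrite permM; have [/rcosetsP[k _ ->]|nC] := boolP (C \in cosets G').
  by rewrite !left_translationE mulgA.
by rewrite !(out_perm (restr_perm_on _ _)).
Qed.

Lemma left_translation1 (G' : {group gT}) : left_translation G' 1%g = 1%g.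
Proof.
by apply: (mulgI (left_translation G' 1%g)); rewrite -left_translationM !mulg1.
Qed.

Lemma left_translationV (G' : {group gT}) (g : gT) :
  left_translation G' g^-1%g = (left_translation G' g)^-1%g.
Proof.
apply: (mulgI (left_translation G' g)).
by rewrite mulgV -left_translationM mulgV left_translation1.
Qed.

Variables sigma tau : gT.
Local Notation lambda := (left_translation <[tau]>%G).

Lemma dihedral_w_act (z x : E) : tau x = x ->
  dihedral_act tau (dihedral_w sigma tau z) x = z * (sigma x - (sigma^-1)%g x).
Proof.
move=> tx.
have fixx g : (repr (<[tau]> :* g)%g : gT) x = g x.
  have /rcosetP[t /cycleP[n ->] ->] := mem_repr_rcoset <[tau]>%G g.
  rewrite galM ?memvf //; congr (g _).
  elim: n => [|n IHn]; first by rewrite expg0 gal_id.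
  by rewrite expgS galM ?memvf // tx.
have E2 (u : {perm {set gT}}) (c : E) :
    \sum_s c * (s == u)%:R * (repr ((s^-1)%g (<[tau]>%g : {set gT})) : gT) x
    = c * (repr ((u^-1)%g (<[tau]>%g : {set gT})) : gT) x.
  rewrite (bigD1 u) //= eqxx mulr1 big1 ?addr0 // => s /negPf->.
  by rewrite mulr0 mul0r.
rewrite /dihedral_act /hopf_act.
under eq_bigr => s _ do rewrite !ffunE mulrBr mulrBl.
rewrite sumrB !E2 invgK -left_translationV -[X in lambda _ X]rcoset1.
by rewrite -[X in lambda sigma^-1%g X]rcoset1 !left_translationE !mul1g !fixx mulrBr.
Qed.

Lemma dihedral_w_in (z : E) :
  <<[set sigma; tau]>>%g = G -> (tau * sigma = sigma^-1 * tau)%g ->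
  (tau * tau = 1)%g -> sigma z = z -> tau z = - z ->
  dihedral_H sigma tau (dihedral_w sigma tau z).
Proof.
move=> genG ts tt sz tz; split => [u nu|g].
  rewrite !ffunE.
  case: eqP => [eu|_]; first by rewrite eu groupV cycle_id in nu.
  case: eqP => [eu|_]; first by rewrite eu cycle_id in nu.
  by rewrite subrr mulr0.
pose P := [set g : gT | [forall u, dihedral_w sigma tau z (u ^ lambda g)%g
                           == g (dihedral_w sigma tau z u)]].
have gP : group_set P.
  apply/group_setP; split.
    by rewrite inE; apply/forallP => u; rewrite gal_id left_translation1 conjg1.
  move=> a b; rewrite !inE => /forallP Pa /forallP Pb; apply/forallP => u.
  by rewrite left_translationM conjgM (eqP (Pb _)) (eqP (Pa _)) galM ?memvf.
suff sGP : G \subset Group gP.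
  by move=> /(subsetP sGP); rewrite inE => /forallP Pg u _; apply/eqP.
rewrite -genG gen_subG subUset !sub1set !inE; apply/andP; split; apply/forallP => u.
  have cs : (lambda sigma ^ lambda sigma = lambda sigma)%g by rewrite conjgE mulKg.
  rewrite !ffunE rmorphM rmorphB /= !rmorph_nat sz.
  have csV : ((lambda sigma)^-1 ^ lambda sigma = (lambda sigma)^-1)%g.
    by rewrite conjVg cs.
  have eqJ v w : (v ^ lambda sigma == w ^ lambda sigma)%g = (v == w).
    exact: (inj_eq (conjg_inj _)).
  by rewrite -[X in _ * ((_ == X)%:R - _) == _]csV -[X in _ * (_ - (_ == X)%:R) == _]cs !eqJ.
rewrite !ffunE rmorphM rmorphB /= !rmorph_nat tz mulNr -mulrN opprB.
have cst : (lambda sigma ^ lambda tau = (lambda sigma)^-1)%g.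
  rewrite conjgE -!left_translationV -!left_translationM; congr (lambda _).
  have tV : (tau^-1 = tau)%g by apply: (mulgI tau); rewrite mulgV tt.
  by rewrite tV mulgA ts -mulgA tt mulg1.
have cst' : ((lambda sigma)^-1 ^ lambda tau = lambda sigma)%g.
  by rewrite conjVg cst invgK.
have eqJ v w : (v ^ lambda tau == w ^ lambda tau)%g = (v == w).
  exact: (inj_eq (conjg_inj _)).
by rewrite -[X in _ * ((_ == X)%:R - _) == _]cst -[X in _ * (_ - (_ == X)%:R) == _]cst' !eqJ.
Qed.

End ActionOfW.

(* Main.v *)
(* Normalise the valuation of L to be v_L, and put V = L. Since sigma lies in  *)
(* G_t, w raises valuations by at least l, with equality off p Z; hence if     *)
(* p does not divide l and v_L(x) = a, the w^i x (i < p) have distinct         *)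
(* valuations a + i l modulo p, x is a cyclic vector, and the pi^-nu_i w^i x   *)
(* form a basis of O_L. Writing (rho - 1)^(p-1) as Tr(rho) + p G, where G is   *)
(* close to -1, shows that 2pe - (p-1)t is nonnegative, that it vanishes when  *)
(* p divides t, and that w^p raises valuations enough for terms w^i (w^j x)    *)
(* with i + j >= p never to matter integrally; this gives the basis of A.      *)
(* Freeness means that O_L = A y for some y, since A acts faithfully.          *)
(* If 2pe - (p-1)t is not minimal, the matrix of the pi^-n_i w^i y is          *)
(* triangular modulo the maximal ideal, so n_i = nu_i for all i, which is the  *)
(* divisibility a | p-1. If it is minimal, w is replaced by the operator       *)
(* W = z sum_c chi(c) sigma^c with chi a Teichmueller character. It has the    *)
(* same commutant and satisfies W^p = C W, so that the pi^-n_i W^i are cyclic  *)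
(* shifts modulo o = 1, and freeness becomes the existence of a common start   *)
(* where all shifts are isometric; Euclid's algorithm on l and p decides this. *)
(* If p divides l, then w / pi^(l/p) acts on the piece of valuation n of the   *)
(* associated graded space by n c with c a unit. It has p distinct residual    *)
(* eigenvalues, so A is generated by this operator and is maximal.             *)

From mathcomp Require Import all_boot all_order all_algebra.
From mathcomp Require Import all_fingroup all_solvable all_field.
From mathcomp Require Import zify ring boolp.
Require Import Defs.

Set Implicit Arguments.
Unset Strict Implicit.
Unset Printing Implicit Defensive.

Import Order.TTheory GRing.Theory Num.Theory.
Local Open Scope ring_scope.

(** The whole question is about one operator. For the normalized valuation [vL] of [L], the element
    [w] acts as a linear map [wL] which raises valuations by at least [l], and by exactly [l] off
    the multiples of [p] ([wL_raises]). The source is [sigma_derivation]: to first order [sigma - 1]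
    multiplies an element of valuation n by n times a fixed element of valuation [t]. Once [L] has a
    cyclic vector, every operator commuting with [wL] is a polynomial in it ([commutant]). Hence H
    is K[w], the associated order consists of the polynomials preserving integrality, and freeness
    means that one integral vector generates all of them ([principal_free]).

    If [p] does not divide [l], take x of valuation [a]. The w^i x have valuations a + i l, distinct
    modulo [p], and the pi^-nu_i w^i x form an integral basis. On it w^i multiplies by pi^(nu_(i+j)
    - nu_j) while i + j < p. The terms with i + j >= p are harmless, because the p-th power of sigma
    - sigma^-1 is divisible by [p] with an extra gain of [t] ([udiff_p]) and (p-1)t + 2a <= 2pe
    ([jump_bound], [jump_excess]). This yields the basis of the order ([preserve_coef]). The vector
    x generates when n_i = nu_i for all i ([principal_if]), which is the divisibility of p-1 by [a]
    ([w_exponent_eq_nu]). Below extremal ramification the wrapped terms vanish modulo pi, and a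
    triangular matrix gives the converse ([principal_only_if]).

    At extremal ramification [w] is exchanged for [Wop], built from a Teichmueller character, whose
    p-th power is a scalar multiple of itself ([Wop_p]). Modulo its kernel the generators of the
    order are weighted cyclic shifts. A generator of the integers makes a determinant a unit, whence
    a permutation ([unit_transversal]), which a combinatorial argument turns into a single start
    where all shifts are isometric ([transversal_start], [monomial_only_if]; conversely
    [monomial_if]). Such a start is described by record minima of y a modulo p ([start_good]), and
    Euclid's algorithm decides its existence ([euclid_within_start]); its divisions are the partial
    quotients of l/p ([cfrac_size]).

    If [p] divides [l], a rescaling of [wL] acts on the graded piece of degree n by n c with c a
    unit. The [p] residual eigenvalues are distinct, so a Vandermonde determinant is a unit: the
    order is generated by this operator, polynomials outside it have unbounded iterates, and a sum
    of approximate eigenvectors generates the integers ([graded_preserve], [graded_unbounded],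
    [graded_cyclic]). *)

(* [val_ge], extended to valuations on vector spaces. *)
Definition vge (V : zmodType) (v : V -> int) (n : int) (x : V) : bool :=
  (x == 0) || (n <= v x).

(** * Ultrametric and normalized valuations *)

Record ultrametric (V : zmodType) (v : V -> int) : Prop := {
  ultraD : forall x y, x != 0 -> y != 0 -> x + y != 0 ->
    Num.min (v x) (v y) <= v (x + y);
  ultraN : forall x, v (- x) = v x
}.

Section Ultrametric.
Variables (V : zmodType) (v : V -> int) (hv : ultrametric v).
Implicit Types (x y : V) (m n : int).

Lemma vge0 n : vge v n 0.
Proof. by rewrite /vge eqxx. Qed.

Lemma vgeE n x : x != 0 -> vge v n x = (n <= v x).
Proof. by rewrite /vge => /negPf->. Qed.

Lemma vge_leq n x : n <= v x -> vge v n x.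
Proof. by rewrite /vge orbC => ->. Qed.

Lemma vge_trans m n x : m <= n -> vge v n x -> vge v m x.
Proof. by move=> mn /orP[x0|nx]; rewrite /vge ?x0 // (le_trans mn nx) orbT. Qed.

Lemma vgeN n x : vge v n (- x) = vge v n x.
Proof. by rewrite /vge oppr_eq0 (ultraN hv). Qed.

Lemma vgeD n x y : vge v n x -> vge v n y -> vge v n (x + y).
Proof.
have [->|x0] := eqVneq x 0; first by rewrite add0r.
have [->|y0] := eqVneq y 0; first by rewrite addr0.
rewrite (vgeE n x0) (vgeE n y0) => nx ny; have [->|xy0] := eqVneq (x + y) 0; first exact: vge0.
by rewrite vgeE //; apply: le_trans (ultraD hv x0 y0 xy0); rewrite le_min nx.
Qed.

Lemma vgeB n x y : vge v n x -> vge v n y -> vge v n (x - y).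
Proof. by move=> nx ny; rewrite vgeD // vgeN. Qed.

Lemma vge_sum n (I : Type) (r : seq I) (P : pred I) (F : I -> V) :
  (forall i, P i -> vge v n (F i)) -> vge v n (\sum_(i <- r | P i) F i).
Proof. by move=> nF; elim/big_rec: _ => [|i x Pi]; [apply: vge0 | apply: vgeD (nF i Pi)]. Qed.

Lemma vge_addr n x y : vge v n y -> vge v n (x + y) = vge v n x.
Proof.
move=> ny; apply/idP/idP => [nxy|nx]; last exact: vgeD.
by rewrite -(addrK y x) vgeB.
Qed.

Lemma val_add_dom x y : x != 0 -> vge v (v x + 1) y -> x + y != 0 /\ v (x + y) = v x.
Proof.
move=> x0 ny; have xyN : ~~ vge v (v x + 1) (x + y).
  by rewrite vge_addr // vgeE //; lia.
have xy0 : x + y != 0 by apply: contraNneq xyN => ->; apply: vge0.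
split=> //; rewrite vgeE // in xyN.
have : vge v (v x) (x + y).
  by apply: vgeD; [apply: vge_leq | apply: vge_trans ny; lia].
by rewrite vgeE //; lia.
Qed.

Lemma val_sub_dom x y : x != 0 -> vge v (v x + 1) (y - x) -> y != 0 /\ v y = v x.
Proof. by move=> x0 /(val_add_dom x0); rewrite addrC subrK. Qed.

Lemma vge_nearby n x : ~~ vge v n x -> x != 0 /\ v x < n.
Proof. by rewrite /vge negb_or ltNge => /andP[]. Qed.

Lemma vge_all x : (forall n, vge v n x) -> x = 0.
Proof.
move=> nx; apply/eqP; have := nx (v x + 1).
by rewrite /vge => /orP[//|]; lia.
Qed.

End Ultrametric.

Section NormalizedValuation.
Variables (K : fieldType) (vK : K -> int) (hK : normalized_valuation vK).
Implicit Types (c d : K).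

Lemma nval1 : vK 1 = 0.
Proof.
have E : vK (1 * 1) = vK 1 + vK 1 := valM hK (oner_neq0 K) (oner_neq0 K).
by rewrite mulr1 in E; lia.
Qed.

Lemma nvalN1 : vK (-1) = 0.
Proof.
have n0 : (-1 : K) != 0 by rewrite oppr_eq0 oner_neq0.
have E : vK (-1 * -1) = vK (-1) + vK (-1) := valM hK n0 n0.
by rewrite mulrNN mulr1 nval1 in E; lia.
Qed.

Lemma nvalN c : vK (- c) = vK c.
Proof.
have [->|c0] := eqVneq c 0; first by rewrite oppr0.
by rewrite -mulN1r (valM hK) ?nvalN1 ?add0r // oppr_eq0 oner_neq0.
Qed.

Lemma nval_ultra : ultrametric vK.
Proof. by split=> [x y x0 y0 xy0|x]; [exact: (valD hK x0 y0 xy0) | apply: nvalN]. Qed.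

Lemma nvalV c : c != 0 -> vK c^-1 = - vK c.
Proof.
move=> c0; have E : vK (c / c) = vK c + vK c^-1 := valM hK c0 (invr_neq0 c0).
by rewrite divff // nval1 in E; lia.
Qed.

Lemma nvalX c n : c != 0 -> vK (c ^+ n) = n%:Z * vK c.
Proof.
move=> c0; elim: n => [|n IHn]; first by rewrite expr0 nval1 mul0r.
by rewrite exprS (valM hK) ?expf_neq0 // IHn; lia.
Qed.

Lemma nvalXV c n : c != 0 -> vK (c ^- n) = - (n%:Z * vK c).
Proof. by move=> c0; rewrite nvalV ?expf_neq0 // nvalX. Qed.

Lemma nval_prod (I : Type) (r : seq I) (P : pred I) (F : I -> K) :
  (forall i, P i -> F i != 0) ->
  vK (\prod_(i <- r | P i) F i) = \sum_(i <- r | P i) vK (F i).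
Proof.
move=> F0; suff: \prod_(i <- r | P i) F i != 0 /\
    vK (\prod_(i <- r | P i) F i) = \sum_(i <- r | P i) vK (F i) by case.
elim/big_rec2: _ => [|i x y Pi [y0 <-]]; first by rewrite oner_neq0 nval1.
by rewrite mulf_neq0 ?F0 // (valM hK) ?F0.
Qed.

Lemma vgeM m n c d : vge vK m c -> vge vK n d -> vge vK (m + n) (c * d).
Proof.
have [->|c0] := eqVneq c 0; first by rewrite mul0r !vge0.
have [->|d0] := eqVneq d 0; first by rewrite mulr0 !vge0.
by rewrite !vgeE ?mulf_neq0 // (valM hK) //; lia.
Qed.

Lemma vge_prod0 (I : Type) (r : seq I) (P : pred I) (F : I -> K) :
  (forall i, P i -> vge vK 0 (F i)) -> vge vK 0 (\prod_(i <- r | P i) F i).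
Proof.
move=> F0; elim/big_rec: _ => [|i x Pi]; first by rewrite vge_leq // nval1.
by move/(vgeM (F0 i Pi)); rewrite addr0.
Qed.

Lemma vgeX c n : vge vK 0 c -> vge vK 0 (c ^+ n).
Proof.
move=> c0; elim: n => [|n IHn]; first by rewrite vge_leq // nval1.
by rewrite exprS -[0]addr0 vgeM.
Qed.

Lemma vge_nat n : vge vK 0 n%:R.
Proof.
elim: n => [|n IHn]; first exact: vge0.
by rewrite -addn1 natrD (vgeD nval_ultra) // vge_leq // nval1.
Qed.

Lemma vge_int (n : int) : vge vK 0 n%:~R.
Proof. by case: n => n; rewrite ?NegzE ?mulrNz ?(vgeN nval_ultra) vge_nat. Qed.

(* Expand a determinant equal to a unit: one of its terms must be a unit. *)
Lemma unit_transversal n (C T : 'M[K]_n) :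
  (forall i j, vge vK 0 (C i j)) -> (forall i j, vge vK 0 (T i j)) ->
  C *m T = 1%:M -> exists s : {perm 'I_n}, forall i, ~~ vge vK 1 (T i (s i)).
Proof.
move=> C0 T0 CT; apply: contrapT => noS.
have detC : vge vK 0 (\det C).
  apply: (vge_sum nval_ultra) => s _; rewrite -[0]addr0 vgeM ?vgeX ?vge_prod0 //.
  by rewrite vge_leq // nvalN1.
have detT : vge vK 1 (\det T).
  apply: (vge_sum nval_ultra) => s _.
  have [i Ti] : exists i, vge vK 1 (T i (s i)).
    apply: contrapT => nT; apply: noS; exists s => i; apply/negP => Ti.
    by apply: nT; exists i.
  rewrite -[1]add0r vgeM ?vgeX //; first by rewrite vge_leq // nvalN1.
  by rewrite (bigD1 i) //= -[1]addr0 vgeM // vge_prod0.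
have := vgeM detC detT; rewrite -det_mulmx CT det1 vgeE ?oner_neq0 // nval1.
by [].
Qed.

End NormalizedValuation.

(** * Valued vector spaces and orthogonal families *)

Record valued_space (K : fieldType) (vK : K -> int) (V : lmodType K)
    (v : V -> int) (e : nat) : Prop := {
  valued_ultra : ultrametric v;
  valued_pos : (0 < e)%N;
  valuedZ : forall (c : K) (x : V), c != 0 -> x != 0 -> v (c *: x) = e%:Z * vK c + v x
}.

Section ValuedSpace.
Variables (K : fieldType) (vK : K -> int) (hK : normalized_valuation vK).
Variables (V : lmodType K) (v : V -> int) (e : nat) (hV : valued_space vK v e).
Let uV := valued_ultra hV.
Let e_gt0 := valued_pos hV.

Lemma vgeZ m n (c : K) (x : V) :
  vge vK m c -> vge v n x -> vge v (e%:Z * m + n) (c *: x).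
Proof.
have [->|c0] := eqVneq c 0; first by rewrite scale0r !vge0.
have [->|x0] := eqVneq x 0; first by rewrite scaler0 !vge0.
rewrite !vgeE // ?(valuedZ hV) //; last by rewrite scaler_eq0 negb_or c0.
by move=> mc nx; rewrite lerD // ler_pM2l // ltz_nat.
Qed.

Lemma vgeZ0 n (c : K) (x : V) : vge vK 0 c -> vge v n x -> vge v n (c *: x).
Proof. by move=> c0 /(vgeZ c0); rewrite mulr0 add0r. Qed.

(** Scalars shift valuations by multiples of [e], so terms whose valuations differ modulo [e] cannot
    cancel: a term of least valuation among those below [m] would dominate the sum. *)
Lemma vge_orthogonal (I : finType) (b : I -> V) (c : I -> K) (m : int) :
  (forall i, b i != 0) ->
  (forall i j, i != j -> ~~ (e%:Z %| v (b i) - v (b j))%Z) ->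
  vge v m (\sum_i c i *: b i) -> forall i, vge v m (c i *: b i).
Proof.
move=> b0 bN mS i0; apply: contrapT => /negP n0.
pose P i := ~~ vge v m (c i *: b i).
case: (@arg_minP _ _ _ i0 P (fun i => v (c i *: b i)) n0) => i Pi imin.
have [x0 xm] := vge_nearby Pi.
have cneq j : c j *: b j != 0 -> c j != 0 by apply: contraNneq => ->; rewrite scale0r.
have rest j : j != i -> vge v (v (c i *: b i) + 1) (c j *: b j).
  move=> ji; have [y0|y0] := eqVneq (c j *: b j) 0; first by rewrite y0 vge0.
  have nE : v (c j *: b j) != v (c i *: b i).
    apply: contraNneq (bN j i ji); rewrite !(valuedZ hV) ?b0 ?cneq // => E.
    by apply/dvdzP; exists (vK (c i) - vK (c j)); lia.
  rewrite vgeE //; have [/imin|] := boolP (P j); first by lia.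
  by rewrite /P negbK vgeE //; lia.
have [] := @val_add_dom _ _ uV (c i *: b i) (\sum_(j | j != i) c j *: b j) x0.
  by apply: (vge_sum uV) => j; apply: rest.
by move=> S0 Sv; move: mS; rewrite (bigD1 i) //= vgeE // Sv; lia.
Qed.

Lemma vge_coef (b : V) (c : K) m n : b != 0 -> (m <= v b)%R ->
  v b < e%:Z + m -> vge v (e%:Z * n + m) (c *: b) = vge vK n c.
Proof.
move=> b0 mb be; have [->|c0] := eqVneq c 0; first by rewrite scale0r !vge0.
rewrite !vgeE // ?(valuedZ hV) //; last by rewrite scaler_eq0 negb_or c0.
apply/idP/idP => H; last by have := ler_pM2l (x := e%:Z) e_gt0 n (vK c); lia.
by have := ler_pM2l (x := e%:Z) e_gt0 (vK c + 1) n; lia.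
Qed.

End ValuedSpace.

Section ValuedBasis.
Variables (K : fieldType) (vK : K -> int) (hK : normalized_valuation vK).
Variables (V : vectType K) (v : V -> int) (e : nat) (hV : valued_space vK v e).

Lemma orthogonal_basis n (b : 'I_n -> V) : \dim {:V} = n -> (forall i, b i != 0) ->
  (forall i j, i != j -> ~~ (e%:Z %| v (b i) - v (b j))%Z) ->
  basis_of {:V} [tuple b i | i < n].
Proof.
move=> dimV b0 bN; rewrite basisEfree subvf size_tuple dimV leqnn !andbT.
apply/freeP => k k0 i; have := vge_orthogonal hV (c := k) (m := _) b0 bN.
move=> H; have E (j : 'I_n) : [tuple b i | i < n]`_j = b j by rewrite -tnth_nth tnth_mktuple.
have {}H m : vge v m (k i *: b i).
  by apply: H; under eq_bigr => j _ do rewrite -E; rewrite k0 vge0.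
by have /eqP := vge_all H; rewrite scaler_eq0 (negPf (b0 i)) orbF => /eqP.
Qed.

Lemma basis_decomp n (b : 'I_n -> V) : basis_of {:V} [tuple b i | i < n] ->
  forall y, y = \sum_i coord [tuple b i | i < n] i y *: b i.
Proof.
move=> bb y; rewrite {1}(coord_basis bb (memvf y)).
by apply: eq_bigr => i _; rewrite -tnth_nth tnth_mktuple.
Qed.

Lemma coord_uniq n (b : 'I_n -> V) (c : 'I_n -> K) :
  basis_of {:V} [tuple b i | i < n] ->
  forall i, coord [tuple b i | i < n] i (\sum_j c j *: b j) = c i.
Proof.
move=> bb i; rewrite -[RHS](coord_sum_free c i (basis_free bb)).
by congr (coord _ _ _); apply: eq_bigr => j _; rewrite -tnth_nth tnth_mktuple.
Qed.

End ValuedBasis.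

(** * Combinatorics: from a tight transversal to a common start *)

Section Transversal.
Local Open Scope nat_scope.
Variables (N A : nat) (F n : nat -> nat) (s : {perm 'I_N}).
Hypothesis N_gt0 : 0 < N.
Hypothesis F_period : forall k, F (k + N) = F k + A.
Hypothesis n_le : forall i j, i < N -> j < N -> F j + n i <= F (i + j).
(* The shift by [i] is tight at the start [s i - i mod N], which depends on [i]. *)
Hypothesis s_eq : forall i : 'I_N,
  F (i + (s i + N - i) %% N) = F ((s i + N - i) %% N) + n i.

(** Extension of the exponents to all shifts, a full turn adding [A], so that shifts can be composed
    without reducing modulo [N]. *)
Let m i := n (i %% N) + i %/ N * A.

Let FN c k : F (k + c * N) = F k + c * A.
Proof. by elim: c => [|c IHc]; [rewrite !addn0|rewrite mulSn addnCA addnC F_period IHc; lia]. Qed.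

Let m_le i j : F j + m i <= F (i + j).
Proof.
rewrite /m (_ : i + j = i %% N + j %% N + (i %/ N + j %/ N) * N); last first.
  by rewrite {1}(divn_eq i N) {1}(divn_eq j N); lia.
rewrite FN {1}(divn_eq j N) [_ * N + _]addnC FN.
by have := n_le (ltn_pmod i N_gt0) (ltn_pmod j N_gt0); lia.
Qed.

Let m_small i : i < N -> m i = n i.
Proof. by move=> iN; rewrite /m modn_small // divn_small // mul0n addn0. Qed.

Let m_period c i : m (i + c * N) = m i + c * A.
Proof. by rewrite /m [i + _]addnC modnMDl divnMDl //; lia. Qed.

Let m_attained i : exists j, F (i + j) = F j + m i.
Proof.
pose i' := Ordinal (ltn_pmod i N_gt0); exists ((s i' + N - i') %% N).
rewrite (_ : i + _ = i' + (s i' + N - i') %% N + i %/ N * N); last first.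
  by rewrite {1}(divn_eq i N) /=; lia.
by rewrite FN s_eq /= /m; lia.
Qed.

Let mD i i' : m i + m i' <= m (i + i').
Proof.
have [j Fj] := m_attained (i + i').
by have := m_le i (i' + j); rewrite (addnA i) Fj; have := m_le i' j; lia.
Qed.

(** A tight shift, one with equality in [m_le], leads from [j] to the class of [k]. Since [m] is
    superadditive, composites of tight shifts along a path are tight, and this is a preorder. *)
Definition reach (j k : 'I_N) : Prop :=
  exists i c, i + j = k + c * N /\ F (i + j) = F j + m i.

Let reach_refl j : reach j j.
Proof.
exists 0, 0; split; first by lia.
by have := m_le 0 j; rewrite !add0n; lia.
Qed.

Let reach_trans j k q : reach j k -> reach k q -> reach j q.
Proof.
move=> [i [c [ijk Fi]]] [i' [c' [ikq Fi']]]; exists (i + i'), (c + c'); split; first by lia.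
have E : F (i + i' + j) = F j + m i + m i'.
  rewrite (_ : i + i' + j = i' + k + c * N); last by lia.
  by rewrite FN Fi' -Fi ijk FN; lia.
by have := m_le (i + i') j; have := mD i i'; lia.
Qed.

Definition invariant_shift (i : nat) := forall j, F (i + j) = F j + m i.

(** Membership in a minimal strongly connected component of [reach]. *)
Definition is_source (k : 'I_N) := forall j, reach j k -> reach k j.

(** The shift [i] leads tightly into the source [s i], so some tight [i'] leads back. The round trip
    makes [m i + m i'] equal to the gain of [F] over whole turns, which is the same from every
    start; hence neither inequality can be strict anywhere. *)
Let source_shift (i : 'I_N) : is_source (s i) -> invariant_shift i.
Proof.
move=> src j0; pose j := Ordinal (ltn_pmod (s i + N - i) N_gt0).
have [c ijE] : exists c, i + j = s i + c * N.
  have /= E := divn_eq (s i + N - i) N; have := ltn_ord i.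
  rewrite -/(nat_of_ord j) in E; have := ltn_ord (s i); have := ltn_ord j; rewrite /=.
  case: (leqP i (s i)) => [le|gt] *.
    by exists 0; rewrite /= (_ : s i + N - i = (s i - i) + N); [rewrite modnDr modn_small; lia | lia].
  by exists 1; rewrite /= modn_small; lia.
have rj : reach j (s i).
  by exists i, c; split=> //; rewrite /= s_eq m_small.
have [i' [c' [E Fi']]] := src _ rj.
have Fi : F (i + j) = F j + m i by rewrite /= s_eq m_small.
have mm : m i + m i' = (c + c') * A.
  have : F (j + (c + c') * N) = F j + m i + m i'.
    by rewrite (_ : _ + _ = i' + s i + c * N); [rewrite FN Fi' -Fi ijE FN; lia | lia].
  by rewrite FN; lia.
have : F (i' + (i + j0)) = F j0 + (c + c') * A.
  by rewrite -FN; congr (F _); lia.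
by have := m_le i' (i + j0); have := m_le i j0; lia.
Qed.

(** An invariant shift is undone by the shift [N - i], up to full turns, so [j] and [k] reach each
    other. *)
Let shift_source (i j k : 'I_N) c : i + j = k + c * N -> invariant_shift i ->
  is_source j -> is_source k.
Proof.
move=> ijk iU js q qk.
have [j0 Fj0] := m_attained (N - i).
have mm : m i + m (N - i) = A.
  have := iU (N - i + j0); rewrite Fj0.
  rewrite (_ : i + (N - i + j0) = j0 + N) ?F_period; last by have := ltn_ord i; lia.
  by lia.
have jk : reach j k by exists i, c.
have kj : reach k j.
  exists (N - i + c * N), 1; have iN := ltn_ord i; split; first by lia.
  have := iU j; rewrite ijk FN m_period.
  rewrite (_ : N - i + c * N + k = j + N); last by lia.
  by rewrite F_period; lia.
exact: reach_trans kj (js _ (reach_trans qk kj)).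
Qed.

(** Among the classes that reach [k], one with the fewest predecessors is a source. *)
Let source_below k : exists2 j, is_source j & reach j k.
Proof.
pose pred j := [set q : 'I_N | `[< reach q j >]].
have k_k : `[< reach k k >] by apply/asboolP.
case: (@arg_minP _ _ _ k (fun j => `[< reach j k >]) (fun j => #|pred j|) k_k).
move=> j /asboolP jk jmin; exists j => // q qj.
have sub : pred q \subset pred j.
  by apply/subsetP=> r; rewrite !inE => /asboolP rq; apply/asboolP/(reach_trans rq).
have /eqP E : pred q == pred j.
  by rewrite eqEcard sub; apply: jmin; apply/asboolP/(reach_trans qj).
have : j \in pred j by rewrite inE; apply/asboolP.
by rewrite -E inE => /asboolP.
Qed.

(* A source can only be hit by a shift which is invertible, and the orbit of   *)
(* one source under these shifts has as many elements as there are such        *)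
(* shifts; hence all sources are in one orbit.                                 *)
Lemma transversal_start : exists2 j, j < N & forall i, i < N -> F (i + j) = F j + n i.
Proof.
pose U := [set i : 'I_N | `[< invariant_shift i >]].
pose Src := [set k : 'I_N | `[< is_source k >]].
have [j js _] := source_below (Ordinal N_gt0).
pose g (i : 'I_N) : 'I_N := Ordinal (ltn_pmod (i + j) N_gt0).
have gE (i : 'I_N) : i + j = g i + (i + j) %/ N * N by rewrite {1}(divn_eq (i + j) N) addnC.
have g_inj : injective g.
  move=> i i' /(congr1 val)/= /eqP; rewrite eqn_modDr => /eqP.
  by rewrite !modn_small // => /val_inj.
have gU : g @: U \subset Src.
  apply/subsetP => _ /imsetP[i iU ->]; rewrite !inE in iU *; apply/asboolP.
  exact: (shift_source (gE i) (asboolW iU) js).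
have SU : Src \subset s @: U.
  apply/subsetP => k; rewrite inE => /asboolP ks; apply/imsetP.
  by exists (s^-1 k)%g; rewrite ?permKV // inE; apply/asboolP/source_shift; rewrite permKV.
have /eqP gUS : g @: U == Src.
  rewrite eqEcard gU card_imset //.
  by rewrite (leq_trans (subset_leq_card SU)) // card_imset //; apply: perm_inj.
exists j => // i iN; pose k := g (Ordinal iN).
have [q qs qk] := source_below k.
(* The source [q] is in the orbit of [j], so [j] reaches every class; the tight shift from [j] to
   [k] is then congruent to [i] modulo [N]. *)
have : q \in g @: U by rewrite gUS inE; apply/asboolP.
case/imsetP => i0; rewrite inE => /asboolP i0U qE.
have jq : reach j q by exists i0, ((i0 + j) %/ N); rewrite {1}qE; split=> //; apply: gE.
have [i1 [c [E Fi1]]] := reach_trans jq qk.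
have i1E : i1 %% N = i.
  rewrite -(modn_small iN); apply/eqP.
  by rewrite -(eqn_modDr j) E [k + _]addnC modnMDl /= modn_mod.
rewrite -(m_small iN); have : F (i1 + j) = F j + m i1 := Fi1.
rewrite (divn_eq i1 N) i1E [_ * N + i]addnC m_period (_ : i + _ + j = i + j + i1 %/ N * N).
  by rewrite FN; lia.
by lia.
Qed.

End Transversal.

(** * The exponents [nu] and [w_exponent] *)

Lemma bigmin_leq (I : eqType) (r : seq I) (f : I -> nat) d i :
  i \in r -> (\big[minn/d]_(j <- r) f j <= f i)%N.
Proof.
elim: r => //= j r IHr; rewrite inE big_cons => /orP[/eqP->|/IHr]; first exact: geq_minl.
exact: leq_trans (geq_minr _ _).
Qed.

(* When [w ^ p = C w], [p.-1] further applications of [w] only multiply by [C], *)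
(* whose valuation will be [nu p.-1].                                           *)
Definition nu_cyc p l a k := (nu p l a (k %% p.-1) + k %/ p.-1 * nu p l a p.-1)%N.

Section WExponent.
Local Open Scope nat_scope.
Variables (p l a : nat).
Hypothesis p_gt0 : 0 < p.

Lemma nu_mono i j : i <= j -> nu p l a i <= nu p l a j.
Proof. by move=> ij; rewrite leq_div2r // leq_add2l leq_mul2r ij orbT. Qed.

Lemma w_exponent_le i j : i + j < p -> w_exponent p l a i + nu p l a j <= nu p l a (i + j).
Proof.
move=> ijp; have jp : j < p - i by lia.
suff: w_exponent p l a i <= nu p l a (i + j) - nu p l a j.
  by have := nu_mono (leq_addl i j); lia.
exact: (bigmin_leq _ _ (mem_index_enum (Ordinal jp))).
Qed.

Lemma w_exponent_attained i : i < p ->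
  exists2 j, i + j < p & nu p l a (i + j) = w_exponent p l a i + nu p l a j.
Proof.
move=> ip; suff [j jp ->] : exists2 j, i + j < p &
    w_exponent p l a i = nu p l a (i + j) - nu p l a j.
  by exists j => //; rewrite subnK // nu_mono // leq_addl.
rewrite /w_exponent; elim/big_ind: _ => [|x y [j jp ->] [k kp ->]|j _].
- by exists 0; rewrite ?addn0.
- by case: leqP => _; [exists j | exists k].
- by exists j => //; have := ltn_ord j; lia.
Qed.

Lemma w_exponent_leq_nu i : i < p -> w_exponent p l a i <= nu p l a i.
Proof. by move=> ip; have := @w_exponent_le i 0; rewrite addn0 => /(_ ip); lia. Qed.

Lemma w_exponent_min i m : i < p ->
  (forall j, i + j < p -> m + nu p l a j <= nu p l a (i + j)) -> m <= w_exponent p l a i.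
Proof. by move=> /w_exponent_attained[j jp E] /(_ j jp); rewrite E leq_add2r. Qed.

End WExponent.

(** * The exponents in terms of the multiples of [a] modulo [p] *)

Section Floors.
Local Open Scope nat_scope.
Variables (p l : nat).
Hypothesis p_prime : prime p.
Let p_gt0 := prime_gt0 p_prime.
Let p_gt1 := prime_gt1 p_prime.
Let a := l %% p.
Let q0 := l %/ p.
Hypothesis a_gt0 : 0 < a.
Let ap : a < p. Proof. exact: ltn_pmod. Qed.

(** Remainder and quotient of [y * a] by [p]. The start [a] counts as one more step, which is why
    [nu i] involves [Phi i.+1]. *)
Let rho y := (y * a) %% p.
Let Phi y := (y * a) %/ p.
Let lE : l = q0 * p + a. Proof. exact: divn_eq. Qed.

Lemma nuE i : nu p l a i = q0 * i + Phi i.+1.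
Proof.
rewrite /nu (_ : a + i * l = q0 * i * p + i.+1 * a); last by rewrite {1}lE; lia.
by rewrite divnMDl.
Qed.

Let PhiD x y : Phi (x + y) = Phi x + Phi y + (p <= rho x + rho y).
Proof. by rewrite /Phi mulnDl divnD. Qed.

Let rho_ltp y : rho y < p. Proof. exact: ltn_pmod. Qed.

Let rho1 : rho 1 = a. Proof. by rewrite /rho mul1n modn_small. Qed.

Let rho_gt0 y : 0 < y < p -> 0 < rho y.
Proof.
move=> /andP[y0 yp]; rewrite lt0n; apply/eqP => /eqP; rewrite -/(dvdn _ _) Euclid_dvdM //.
by rewrite !gtnNdvd.
Qed.

Let rhoN y : 0 < y < p -> rho (p - y) = p - rho y.
Proof.
move=> yp; have ry := rho_gt0 yp; have := rho_ltp y; have := rho_ltp (p - y).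
have /dvdnP[k] : p %| rho (p - y) + rho y.
  by rewrite /dvdn modnDml modnDmr -mulnDl subnK ?modnMr //; case/andP: yp => _ /ltnW.
by case: k => [|[|k]]; nia.
Qed.

(** Equality for all [i] says that [nu] is superadditive. With [q] the quotient of [p.-1] by [a],
    this forces [k <= Phi (k * q).+1], and [k = a] leaves no room for a remainder. Conversely, if
    [p.-1 = q * a], then [Phi i.+1 = i %/ q], which is superadditive. *)
Lemma w_exponent_eq_nu :
  (forall i, i < p -> w_exponent p l a i = nu p l a i) <-> a %| p.-1.
Proof.
split=> [H|/dvdnP[q qE]].
  have sup i j : i + j < p -> Phi i.+1 + Phi j.+1 <= Phi (i + j).+1.
    move=> ijp; have := @w_exponent_le p l a p_gt0 i j ijp.
    by rewrite H ?(leq_ltn_trans (leq_addr j i)) // !nuE; lia.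
  pose q := p.-1 %/ a; have qE := divn_eq p.-1 a; rewrite -/q in qE.
  have r'a := ltn_pmod p.-1 a_gt0.
  have step k : k * q < p -> k <= Phi (k * q).+1.
    elim: k => // k IHk; rewrite mulSn addnC => kp; have := sup _ _ kp.
    have q1 : 1 <= Phi q.+1 by rewrite leq_divRL //; lia.
    by have := IHk (leq_ltn_trans (leq_addr q _) kp); lia.
  have := step a; rewrite mulnC leq_divRL // => /(_ ltac:(lia)).
  rewrite mulnC leq_pmul2r //= => pq.
  by apply/dvdnP; exists q; lia.
have q_gt0 : 0 < q by case: q qE => //; lia.
have PhiE i : i < p -> Phi i.+1 = i %/ q.
  move=> ip; rewrite /Phi; have E := divn_eq i q; have cq := ltn_pmod i q_gt0.
  have sa : i %/ q <= a by rewrite -(mulKn a q_gt0) leq_div2r // -qE; lia.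
  have pE : p = (q * a).+1 by lia.
  have sc : i %/ q <= (i %% q).+1 * a by nia.
  have ca : (i %% q).+1 * a <= q * a by rewrite leq_mul2r cq orbT.
  rewrite (_ : i.+1 * a = i %/ q * p + ((i %% q).+1 * a - i %/ q)).
    by rewrite divnMDl // [X in _ + X]divn_small ?addn0 // (leq_ltn_trans (leq_subr _ _)) // pE ltnS.
  apply/eqP; rewrite addnBA // -(eqn_add2r (i %/ q)) subnK ?(leq_trans sc) ?leq_addl //.
  by rewrite pE {1}E; apply/eqP; ring.
move=> i ip; apply/eqP; rewrite eqn_leq w_exponent_leq_nu // w_exponent_min // => j jp.
rewrite !nuE !PhiE //; try lia.
by rewrite mulnDr divnD //; move: (i %/ q) (j %/ q) => s s'; lia.
Qed.

(** A record minimum of the remainders; by [w_exponentE] these are what the minimum defining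
    [w_exponent] detects. *)
Definition record_low y := forall y', 0 < y' <= y -> rho y <= rho y'.

(** Arithmetic form of a start [x.-1] where every shift attains [w_exponent] (see [start_good]). The
    second clause comes from the shifts that pass a full turn, the third from those that do not. *)
Definition good_start x := [/\ record_low x,
  forall y, 0 < y <= x -> rho y <= a -> record_low y
  & forall y, x <= y < p -> rho y <= rho x -> record_low y].

Let rho_sum i y' : 0 < i < p -> (p <= rho i + rho y') = (rho (p - i) <= rho y').
Proof. by move=> ip; rewrite rhoN //; have := rho_ltp i; lia. Qed.

(** From [j] to [i + j], [nu] gains [q0 * i + Phi i] and a carry, present exactly when
    [rho (p - i) <= rho j.+1]. The minimum over [j] keeps the carry only if it always occurs, that
    is, if [p - i] is a record. *)
Lemma w_exponentE i : 0 < i < p ->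
  w_exponent p l a i = q0 * i + Phi i + `[< record_low (p - i) >].
Proof.
move=> ip; have nu_split j : nu p l a (i + j) =
    q0 * i + Phi i + (rho (p - i) <= rho j.+1) + nu p l a j.
  by rewrite !nuE -addnS PhiD rho_sum //; lia.
have /andP[_ ip'] := ip.
apply/eqP; rewrite eqn_leq; apply/andP; split.
  case: asboolP => [_|nr] /=.
    have := @w_exponent_le p l a p_gt0 i 0; rewrite addn0 => /(_ ip').
    by have := nu_split 0; rewrite addn0 => ->; case: (rho _ <= rho _); lia.
  apply: contrapT => /negP; rewrite -ltnNge => lt.
  apply: nr => y' /andP[y'0 y'y].
  have := @w_exponent_le p l a p_gt0 i y'.-1.
  by rewrite nu_split prednK // => /(_ ltac:(lia)); case: (rho _ <= rho _); lia.
apply: (w_exponent_min p_gt0 ip') => j jp; rewrite nu_split leq_add2r leq_add2l.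
by case: asboolP => // r; rewrite r //; lia.
Qed.

Let nu0 : nu p l a 0 = 0.
Proof. by rewrite /nu mul0n addn0 divn_small. Qed.

Let shift_low i x : 0 < i -> 0 < x -> i + x <= p -> i < p ->
  nu_cyc p l a (i + x.-1) = nu_cyc p l a x.-1 + w_exponent p l a i <->
  (rho (p - i) <= rho x) = `[< record_low (p - i) >].
Proof.
move=> i0 x0 ixp ip; have ip' : 0 < i < p by rewrite i0.
have small k : k <= p.-1 -> nu_cyc p l a k = nu p l a k.
  rewrite leq_eqVlt /nu_cyc => /orP[/eqP->|kp]; last by rewrite modn_small // divn_small // addn0.
  by rewrite modnn divnn (_ : 0 < p.-1) ?nu0 ?mul1n //; lia.
rewrite !small ?w_exponentE // ?nuE; try lia.
by rewrite (_ : (i + x.-1).+1 = i + x) ?prednK // ?PhiD ?rho_sum //; lia.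
Qed.

(** Past a full turn two carries appear, one in passing from [i] to [i.+1] and one in adding [x];
    tightness says that their sum is the record bit of [p - i]. *)
Let shift_high i x : 0 < i -> p < i + x -> i < p.-1 -> x < p ->
  nu_cyc p l a (i + x.-1) = nu_cyc p l a x.-1 + w_exponent p l a i <->
  (rho (p - i) <= a) + (rho (p - i).-1 <= rho x) = `[< record_low (p - i) >].
Proof.
move=> i0 ixp ip xp; have ip' : 0 < i < p by rewrite i0; lia.
have -> : nu_cyc p l a (i + x.-1) = nu p l a (i + x - p) + nu p l a p.-1.
  rewrite /nu_cyc (_ : i + x.-1 = (i + x - p) + p.-1); last by lia.
  by rewrite modnDr divnDr // divnn modn_small ?divn_small //; lia.
have -> : nu_cyc p l a x.-1 = nu p l a x.-1.
  by rewrite /nu_cyc modn_small ?divn_small; lia.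
have -> : nu p l a p.-1 = q0 * p.-1 + a by rewrite nuE prednK // /Phi mulKn.
rewrite w_exponentE // !nuE prednK; last by lia.
have E : a + Phi (i + x - p).+1 = Phi (i.+1 + x).
  have := PhiD p (i + x - p).+1; rewrite /rho modnMr add0n -/(rho _) leqNgt rho_ltp addn0.
  by rewrite (_ : p + _ = i.+1 + x) ?[X in _ = X + _]mulKn //; lia.
have E1 : rho i.+1 + rho x >= p = (rho (p - i).-1 <= rho x).
  by rewrite rho_sum 1?(_ : p - i.+1 = (p - i).-1) //; lia.
have E2 : Phi i.+1 = Phi i + (rho (p - i) <= a).
  by rewrite -addn1 PhiD rho_sum // rho1 [Phi 1]divn_small ?mul1n ?addn0.
have {}E : Phi (i + x - p).+1 + a = Phi i + Phi x +
    ((rho (p - i) <= a) + (rho (p - i).-1 <= rho x)).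
  by rewrite addnC E PhiD E1 E2; lia.
have Eq : q0 * (i + x - p) + q0 * p.-1 = q0 * x.-1 + q0 * i.
  by rewrite -!mulnDr; congr (_ * _); lia.
by split=> H; lia.
Qed.

Let rho_inj y y' : 0 < y < p -> 0 < y' < p -> rho y = rho y' -> y = y'.
Proof.
wlog yy' : y y' / y <= y' => [H yp yp' E|].
  by case: (leqP y y') => [|/ltnW] le; [|apply: esym]; apply: H.
move=> yp yp' E; apply/eqP; rewrite eqn_leq yy' leqNgt; apply/negP => lt.
have /rho_gt0 : 0 < y' - y < p by lia.
have /eqP := E; rewrite eq_sym eqn_mod_dvd ?leq_mul2r ?yy' ?orbT //.
by rewrite -mulnBl /dvdn -/(rho _) => /eqP->.
Qed.

Lemma start_good x : 0 < x < p ->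
  (forall i, i < p.-1 -> nu_cyc p l a (i + x.-1) = nu_cyc p l a x.-1 + w_exponent p l a i)
  <-> good_start x.
Proof.
move=> /andP[x0 xp].
have rec1 : record_low 1 by case=> [|[]].
split=> [H|[rx lowx highx] i ip].
  have high y : x <= y < p -> rho y <= rho x -> record_low y.
    move=> /andP[xy yp] ryx; have [->//|y1] := eqVneq y 1.
    have := iffLR (@shift_low (p - y) x ltac:(lia) x0 ltac:(lia) ltac:(lia))
      (H (p - y) ltac:(lia)).
    by rewrite subKn ?(ltnW yp) // ryx => /esym/asboolP.
  have rx : record_low x by apply: high; rewrite ?leqnn.
  split=> // y /andP[y0]; rewrite leq_eqVlt => /orP[/eqP->//|yx] ya.
  have [->//|y1] := eqVneq y 1.
  have := iffLR (@shift_high (p - y) x ltac:(lia) ltac:(lia) ltac:(lia) xp)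
    (H (p - y) ltac:(lia)).
  by rewrite subKn ?ya; [case: asboolP => //; lia | lia].
have [->|i0] := posnP i.
  have := @w_exponent_leq_nu p l a p_gt0 0; rewrite nu0 => /(_ p_gt0).
  by rewrite leqn0 => /eqP->; rewrite addn0.
case: (leqP (i + x) p) => ixp.
  apply/shift_low => //; first by lia.
  apply/idP/asboolP => [|r]; first by apply: highx; lia.
  by apply: r; lia.
apply/shift_high => //.
(* As [x] is a record, the inequality would be an equality, and [rho] is injective between 0 and
   [p]. *)
have -> : (rho (p - i).-1 <= rho x) = false.
  apply/negP => le; have : rho x <= rho (p - i).-1 by apply: rx; lia.
  move=> le'; have /rho_inj : rho x = rho (p - i).-1 by lia.
  by move=> /(_ ltac:(lia) ltac:(lia)); lia.
rewrite addn0; congr nat_of_bool; apply/idP/asboolP => [|r]; first by apply: lowx; lia.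
by rewrite -rho1; apply: r; lia.
Qed.

Let rho_eq y k s : y * a = k * p + s -> s < p -> rho y = s.
Proof. by rewrite /rho => -> sp; rewrite modnMDl modn_small. Qed.

(** * Euclid's algorithm and the only candidate for a good start *)

Section Euclid.
Variables (q r q2 r2 q3 r3 : nat).
Hypotheses (pE : p = q * a + r) (aE : a = q2 * r + r2) (rE : r = q3 * r2 + r3).
Hypotheses (ra : r < a) (r2r : r2 < r) (r3r : r3 < r2).

Let q_gt0 : 0 < q. Proof. by case: q pE => //; lia. Qed.
Let q2_gt0 : 0 < q2. Proof. by case: q2 aE => //; lia. Qed.
(* The only candidate for a good start; [rho x0 = r2]. *)
Let x0 := 1 + q * q2.
(** [x0] and [X] are the denominators of two consecutive convergents of [a / p]: [x0 * a] exceeds a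
    multiple of [p] by [r2], [X * a] falls short of one by [r3], and [p_lattice] is the
    corresponding determinant identity. *)
Let X := q + q3 * x0.

Let x0a : x0 * a = q2 * p + r2.
Proof. by rewrite /x0 pE mulnDl mul1n {1}aE; ring. Qed.

Let Xa : X * a + r3 = (1 + q3 * q2) * p.
Proof.
rewrite /X mulnDl -mulnA x0a mulnDr [LHS](_ : _ = q * a + (q3 * r2 + r3) + q3 * q2 * p).
  by rewrite -rE -pE; ring.
by ring.
Qed.

Let p_lattice : p = r3 * x0 + r2 * X.
Proof.
apply/eqP; rewrite -(eqn_pmul2r a_gt0); apply/eqP.
have -> : (r3 * x0 + r2 * X) * a = r3 * (x0 * a) + r2 * (X * a + r3) - r2 * r3.
  by rewrite mulnDr addnA addnK; ring.
rewrite x0a Xa mulnDr addnAC [r3 * r2]mulnC addnK aE.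
by rewrite [in LHS]rE; ring.
Qed.

Let rho_x0 : rho x0 = r2.
Proof. by apply: (rho_eq x0a); lia. Qed.

(** Up to index [x0] the multiples of [a] come in blocks of [q] steps, each block falling [r] short
    of [p]. *)
Let rho_below s c : s <= q2 -> c < q -> rho (1 + s * q + c) = c.+1 * a - s * r.
Proof.
move=> sq cq; have sr : s * r <= q2 * r by rewrite leq_mul2r sq orbT.
have ca : c.+1 * a <= q * a by rewrite leq_mul2r cq orbT.
have ac : a <= c.+1 * a by rewrite leq_pmull.
apply: (@rho_eq _ s); last by lia.
have E : (1 + s * q + c) * a + s * r = s * p + c.+1 * a by rewrite pE; ring.
by lia.
Qed.

Let below y : 0 < y <= x0 ->
  exists s c, [/\ y = 1 + s * q + c, s <= q2, c < q & s = q2 -> c = 0].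
Proof.
move=> /andP[y0 yx]; exists (y.-1 %/ q), (y.-1 %% q).
have E := divn_eq y.-1 q; have cq := ltn_pmod y.-1 q_gt0.
have yq : y.-1 <= q2 * q by rewrite mulnC; rewrite /x0 in yx; lia.
have sq : y.-1 %/ q <= q2 by rewrite -(mulnK q2 q_gt0) leq_div2r.
split=> //; first by lia.
by move=> sE; rewrite sE in E; lia.
Qed.

Let record_below s : s <= q2 -> record_low (1 + s * q).
Proof.
move=> sq y' /andP[y'0 y's]; have sq' : s * q <= q2 * q by rewrite leq_mul2r sq orbT.
have [|s' [c' [y'E s'q c'q _]]] := @below y'; first by rewrite y'0 /x0 mulnC; lia.
have := @rho_below s 0 sq q_gt0; rewrite addn0 => ->; rewrite {}y'E rho_below // mul1n in y's *.
rewrite leq_sub ?leq_pmull // leq_mul2r leqNgt; apply/orP; right; apply/negP => lt.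
have : s.+1 * q <= s' * q by rewrite leq_mul2r lt orbT.
by lia.
Qed.

(** If [r3 = 0], then [r2 = 1] and no index but [x0] has remainder at most [r2]. If [r3 = 1], the
    indices with remainder at most [r2] are the [x0 + v * X], with remainders [r2 - v]: they
    decrease, so each is a record. *)
Lemma good_start_euclid : r3 <= 1 -> coprime r2 r3 -> good_start x0.
Proof.
move=> r31 co; have rx0 : record_low x0 by rewrite /x0 mulnC; apply: record_below.
split=> // y => [yx ya | /andP[xy yp]].
  have [s [c [yE sq cq _]]] := below yx; rewrite yE rho_below // in ya.
  suff c0 : c = 0 by rewrite yE c0 addn0; apply: record_below.
  have : s * r <= q2 * r by rewrite leq_mul2r sq orbT.
  case: (c) ya => // c' ya; have : a <= c'.+1 * a by rewrite leq_pmull.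
  by rewrite mulSn in ya; lia.
rewrite rho_x0 => ry; have y0 : 0 < y < p by rewrite yp (leq_trans _ xy).
have ry0 := rho_gt0 y0.
have [r30|r3n] := posnP r3.
  have r21 : r2 = 1 by move: co; rewrite r30 /coprime gcdn0 => /eqP.
  suff -> : y = x0 by [].
  by apply: rho_inj => //; [rewrite /x0 add1n /= -/x0; lia | rewrite rho_x0; lia].
have r3E : r3 = 1 by lia.
have x00 : 0 < x0 by rewrite /x0.
have X0 : 0 < X by rewrite /X addn_gt0 q_gt0.
have yv v : v < r2 -> 0 < x0 + v * X < p /\ rho (x0 + v * X) = r2 - v.
  move=> vr; have vX : v * X < r2 * X by rewrite ltn_pmul2r.
  split; first by rewrite p_lattice r3E mul1n ltn_add2l vX addn_gt0 x00.
  apply: (@rho_eq _ (q2 + v * (1 + q3 * q2))); last by lia.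
  have : v * (X * a) + v = v * (1 + q3 * q2) * p by rewrite -mulnA -Xa r3E mulnDr muln1.
  by rewrite !(mulnDl _ _ p) mulnDl x0a -mulnA; lia.
have yE u : 0 < u < p -> rho u <= r2 -> u = x0 + (r2 - rho u) * X.
  move=> u0 ru; have ru0 := rho_gt0 u0.
  have [|y1 y2] := yv (r2 - rho u); first by lia.
  by apply: rho_inj => //; rewrite y2; lia.
move=> y' /andP[y'0 y'y]; rewrite leqNgt; apply/negP => lt.
have y'p : 0 < y' < p by rewrite y'0; lia.
have := yE y y0 ry; have := yE y' y'p; move/(_ ltac:(lia)).
have ry'0 := rho_gt0 y'p.
have : (r2 - rho y) * X < (r2 - rho y') * X by rewrite ltn_pmul2r //; lia.
by lia.
Qed.

(** The three clauses leave only [x0]. If then [r3 > 1], some [x0 + k * X] has remainder [r2 %% r3],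
    and going further by [X + x0] gives a larger remainder, still below [r2], at an index below [p]:
    the third clause fails. *)
Lemma euclid_good_start x : coprime r2 r3 -> 0 < x < p -> good_start x -> r3 <= 1.
Proof.
move=> co /andP[x_gt0 xp] [rx lowx highx]; rewrite leqNgt; apply/negP => r31.
have x00 : 0 < x0 by rewrite /x0.
have xE : x = x0.
  have le0 : x <= x0.
    rewrite leqNgt; apply/negP => gt0.
    (* This remainder is at most [a] but not a record, so by the second clause [x] stays below
       [x0 + q.+1]; between the two, remainders exceed that of [x0]. *)
    have yE : (x0 + q.+1) * a = q2.+1 * p + (a - r + r2).
      by rewrite mulnDl x0a [q2.+1 * p]mulSn {2}pE; lia.
    have ry := rho_eq yE ltac:(lia).
    have lt : x < x0 + q.+1.
      rewrite ltnNge; apply/negP => ge.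
      have := lowx (x0 + q.+1); rewrite ry => /(_ ltac:(lia) ltac:(lia)) /(_ x0).
      by rewrite ry rho_x0; lia.
    have xcE : x = x0 + (x - x0) by lia.
    have ca : (x - x0) * a <= q * a by rewrite leq_mul2r; lia.
    have : rho x = r2 + (x - x0) * a.
      apply: (@rho_eq _ q2); last by lia.
      by rewrite {1}xcE mulnDl x0a addnA.
    have ac : a <= (x - x0) * a by rewrite leq_pmull //; lia.
    by have := rx x0; rewrite rho_x0 => /(_ ltac:(lia)); lia.
  have [s [c [E sq cq cE]]] := @below x ltac:(lia).
  have rxE : rho x = c.+1 * a - s * r by rewrite E rho_below.
  have c0 : c = 0.
    have := rx (1 + s * q); have := @rho_below s 0 sq q_gt0.
    rewrite addn0 rxE => ->; have : s * r <= q2 * r by rewrite leq_mul2r sq orbT.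
    have H1 : 0 < 1 + s * q <= x by rewrite add1n /= E -add1n leq_addr.
    case: (c) => // c' sr /(_ H1).
    have : a <= c'.+1 * a by rewrite leq_pmull.
    by rewrite mulSn; lia.
  have [sE|sn] := eqVneq s q2; first by rewrite E c0 sE /x0; lia.
  have sr : s * r + r <= q2 * r by rewrite -mulSnr leq_mul2r; lia.
  (* If [s < q2], then [rho x] is at least [r + r2], and [2 * x0] violates the third clause, [x0]
     having a smaller remainder. *)
  have r2x0 : rho (2 * x0) = 2 * r2.
    by apply: (@rho_eq _ (2 * q2)); [rewrite -[2 * x0 * a]mulnA x0a; lia | lia].
  have q2r : q2 * 3 <= q2 * r by rewrite leq_mul2l; lia.
  have p2 : 2 * x0 < p.
    have : q * (q2 * 3 + 1) <= q * a by rewrite leq_mul2l; lia.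
    by rewrite /x0 mulnDr; have := muln_gt0 q q2; rewrite q_gt0 q2_gt0; lia.
  have := highx (2 * x0) ltac:(lia); rewrite r2x0 rxE => /(_ ltac:(lia)) /(_ x0).
  by rewrite r2x0 rho_x0; lia.
pose k := r2 %/ r3; pose r4 := r2 %% r3.
have E := divn_eq r2 r3; rewrite -/k -/r4 in E.
have r43 : r4 < r3 by apply: ltn_pmod; lia.
have r40 : 0 < r4.
  rewrite lt0n; apply/negP => /eqP r40; move: co; rewrite E r40 addn0 /coprime gcdnC gcdnMl.
  by lia.
have k0 : 0 < k by rewrite divn_gt0; lia.
have X0 : 0 < X by rewrite /X addn_gt0 q_gt0.
have kr : k.+2 <= r2.
  by have : k * 2 <= k * r3; [rewrite leq_mul2l; lia | lia].
have rk : rho (x0 + k * X) = r4.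
  apply: (@rho_eq _ (q2 + k * (1 + q3 * q2))); last by lia.
  have H : k * (X * a) + k * r3 = k * (1 + q3 * q2) * p by rewrite -mulnDr Xa mulnA.
  by rewrite mulnDl x0a -[k * X * a]mulnA (mulnDl q2) -H {1}E; lia.
have rk' : rho (x0 + k * X + (X + x0)) = r4 + r2 - r3.
  apply: (@rho_eq _ (q2 + q2 + k.+1 * (1 + q3 * q2))); last by lia.
  have H : k.+1 * (X * a) + k.+1 * r3 = k.+1 * (1 + q3 * q2) * p by rewrite -mulnDr Xa mulnA.
  rewrite (_ : _ * a = x0 * a + x0 * a + k.+1 * (X * a)); last by ring.
  by rewrite x0a 2!mulnDl -H; lia.
have lp : x0 + k * X + (X + x0) < p.
  rewrite p_lattice; have : 2 * x0 <= r3 * x0 by rewrite leq_mul2r r31 orbT.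
  by have : k.+2 * X <= r2 * X; [rewrite leq_mul2r kr orbT | lia].
have := highx (x0 + k * X + (X + x0)); rewrite xE rk' rho_x0.
move=> /(_ ltac:(lia) ltac:(lia)) /(_ (x0 + k * X)); rewrite rk rk'.
by move=> /(_ ltac:(lia)); lia.
Qed.

End Euclid.

End Floors.

(** * Continued fractions and the length of Euclid's algorithm *)

Fixpoint euclid_within (k m n : nat) : bool :=
  (n %| m)%N || (if k is k'.+1 then euclid_within k' n (m %% n) else false).

Lemma cfrac_val_gt1 (b : int) (s : seq int) : 0 < b ->
  all (fun b : int => 0 < b) s -> 2 <= last b s -> 1 < cfrac_val b s.
Proof.
elim: s b => [|b' s IHs] b b0 /=; first by move=> _ b2; rewrite (ltr_int _ 1); lia.
case/andP=> b'0 s0 lb; have v1 := IHs b' b'0 s0 lb.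
have b1 : 1 <= b%:~R :> rat by rewrite (ler_int _ 1); lia.
by rewrite (le_lt_trans b1) // ltrDl invr_gt0 (lt_trans ltr01).
Qed.

(** The condition on the last partial quotient makes the value of every nonempty tail exceed 1, so
    the leading term must be the floor of [m / n] and the tail expands [n / (m %% n)]. *)
Lemma cfrac_size (m n : nat) (a : int) (s : seq int) k : (0 < n)%N ->
  cfrac_expansion (m%:R / n%:R) a s -> (size s <= k)%N = euclid_within k m n.
Proof.
elim: s m n a k => [|b s IHs] m n a k n0 [E s0 l2].
  have n0' : n%:R != 0 :> rat by rewrite pnatr_eq0 -lt0n.
  have {}E : m%:Z = a * n%:Z.
    apply: (@intr_inj rat); rewrite intrM -[a%:~R]/(cfrac_val a [::]) -E.
    by rewrite -!pmulrn divfK.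
  suff nm : (n %| m)%N by case: k => *; rewrite /= nm.
  by have : (n%:Z %| m%:Z)%Z by [apply/dvdzP; exists a]; rewrite dvdzE.
move: s0 E => /andP[b0 s0]; rewrite [cfrac_val _ _]/=; move: (l2 isT) => {}l2 E.
have v1 := cfrac_val_gt1 b0 s0 l2; set x := cfrac_val b s in v1 E *.
have x0 : 0 < x by apply: lt_trans v1.
have n0' : n%:R != 0 :> rat by rewrite pnatr_eq0 -lt0n.
have n0'' : 0 < n%:R :> rat by rewrite ltr0n.
have {}E : (m%:R - a%:~R * n%:R) * x = n%:R.
  have : (m%:R / n%:R - a%:~R) * x = 1 by rewrite E addrAC subrr add0r mulVf ?gt_eqF.
  move/(congr1 (fun u => n%:R * u)); rewrite mulr1 => H.
  by rewrite -[RHS]H; field.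
pose d : int := m%:Z - a * n%:Z.
have dE : d%:~R = m%:R - a%:~R * n%:R :> rat by rewrite /d intrB intrM -!pmulrn.
rewrite -dE in E.
have d0 : 0 < d.
  by rewrite -(ltr0z rat) -(pmulr_lgt0 _ x0) E.
have dn : d < n%:Z.
  rewrite -(ltr_int rat) -[n%:~R]/(n%:R) -E -[X in X < _]mulr1.
  by rewrite ltr_pM2l // ltr0z.
have a0 : 0 <= a by rewrite leNgt; apply/negP => an; move: dn; rewrite /d; nia.
have [a' aE] : exists a' : nat, a = a'%:Z by exists `|a|%N; rewrite gez0_abs.
have mE : m = (a' * n + `|d|)%N by rewrite /d aE; move: d0 dn; rewrite /d aE; lia.
have mn : (m %% n)%N = `|d|%N by rewrite mE modnMDl modn_small //; lia.
have nm : (n %| m)%N = false by rewrite /dvdn mn; lia.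
case: k => [|k] /=; rewrite nm //= ltnS.
apply: (IHs _ _ b); first by rewrite mn; lia.
split=> //.
have d0' : d%:~R != 0 :> rat by rewrite intr_eq0 gt_eqF.
rewrite -/x -E mn; have -> : `|d|%:R = d%:~R :> rat by case: (d) d0.
by rewrite mulrAC divff // mul1r.
Qed.

Section Start.
Local Open Scope nat_scope.
Variables (p l : nat).
Hypothesis p_prime : prime p.
Let a := l %% p.
Hypothesis a_gt0 : 0 < a.

(** Consecutive remainders are coprime, so a division is exact only when the divisor is 1. Stopping
    at [a = 1] or [r = 1] gives [a %| p.-1]; otherwise that divisibility fails, and stopping at [r2]
    or [r3] means [r3 <= 1]. *)
Lemma euclid_within_start : 
  euclid_within 4 l p <-> a %| p.-1 \/ exists2 x, 0 < x < p & good_start p l x.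
Proof.
have p_gt0 := prime_gt0 p_prime; have p_gt1 := prime_gt1 p_prime.
have ap : a < p := ltn_pmod l p_gt0.
have co_pa : coprime p a by rewrite prime_coprime // gtnNdvd.
rewrite /= -/a {1}/dvdn -/a eqn0Ngt a_gt0 /=.
have dvd_coprime m n : coprime m n -> (n %| m) = (n == 1).
  move=> co; apply/idP/eqP => [nm|->]; last exact: dvd1n.
  by move: co; rewrite coprime_sym /coprime (gcdn_idPl nm) => /eqP.
have co_mod m n : coprime m n -> coprime n (m %% n).
  by rewrite /coprime gcdn_modr gcdnC.
rewrite dvd_coprime //; set r := p %% a.
have [a1|a1] := eqVneq a 1; first by rewrite a1 /=; split=> // _; left.
have ra : r < a by apply: ltn_pmod.
have co_ar : coprime a r := co_mod _ _ co_pa.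
have pE := divn_eq p a; rewrite -/r in pE.
rewrite dvd_coprime //=; set r2 := a %% r.
have [r1|r1] := eqVneq r 1.
  by split=> // _; left; apply/dvdnP; exists (p %/ a); lia.
have r_gt0 : 0 < r.
  by rewrite lt0n; apply: contraNneq a1 => r0; move: co_ar; rewrite r0 /coprime gcdn0.
have r2r : r2 < r by apply: ltn_pmod.
have co_r : coprime r r2 := co_mod _ _ co_ar.
have aE := divn_eq a r; rewrite -/r2 in aE.
rewrite dvd_coprime //=; set r3 := r %% r2.
have r2_gt0 : 0 < r2.
  by rewrite lt0n; apply: contraNneq r1 => r0; move: co_r; rewrite r0 /coprime gcdn0.
have r3r : r3 < r2 by apply: ltn_pmod.
have co_r2 : coprime r2 r3 := co_mod _ _ co_r.
have rE := divn_eq r r2; rewrite -/r3 in rE.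
rewrite dvd_coprime // orbF.
have aN : ~ (a %| p.-1).
  rewrite (_ : p.-1 = p %/ a * a + r.-1); last by lia.
  by rewrite dvdn_addr ?dvdn_mull // gtnNdvd; lia.
have r3E : (r2 == 1) || (r3 == 1) = (r3 <= 1).
  case: {rE} r3 co_r2 r3r => [|[|r3']] //= co r3r; try by rewrite orbT.
    by move: co; rewrite /coprime gcdn0 => ->.
  by rewrite orbF; lia.
rewrite r3E; split=> [r31|[//|[x xp gx]]].
  right; exists (1 + p %/ a * (a %/ r)); last first.
    exact: (@good_start_euclid p l p_prime a_gt0 _ _ _ _ _ _ pE aE rE ra r2r r3r r31 co_r2).
  have r_gt1 : 1 < r by move: r_gt0 r1; clear; lia.
  have ur : p %/ a * (a %/ r) * r <= p %/ a * a by rewrite -mulnA leq_mul2l leq_divM orbT.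
  have u2 : p %/ a * (a %/ r) * 2 <= p %/ a * (a %/ r) * r.
    by rewrite leq_mul2l r_gt1 orbT.
  by move: pE ur u2 r_gt1; set u := p %/ a * (a %/ r); set y := p %/ a * a; set z := u * r; clearbody u y z r; clear; lia.
exact: (@euclid_good_start p l p_prime a_gt0 _ _ _ _ _ _ pE aE rE ra r2r r3r x co_r2 xp gx).
Qed.

End Start.

(** * Polynomials in an operator with a cyclic vector *)

Lemma big_ord_last (V : nmodType) (p N : nat) (le : (N <= p)%N) (lt : (N < p)%N)
    (F : 'I_p -> V) : p = N.+1 ->
  \sum_i F i = \sum_(i < N) F (widen_ord le i) + F (Ordinal lt).
Proof.
move=> pE; subst p; rewrite big_ord_recr /=; congr (_ + F _); last exact: val_inj.
by apply: eq_bigr => i _; congr (F _); apply: val_inj.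
Qed.

Section LinearIterates.
Variables (K : fieldType) (V : lmodType K) (p : nat) (w : V -> V).
Hypothesis w_lin : linear w.

Definition pw (c : 'I_p -> K) (y : V) : V := \sum_(i < p) c i *: iter i w y.

Lemma lin0 (f : V -> V) : linear f -> f 0 = 0.
Proof. by move=> fl; have := fl (-1) 0 0; rewrite scaler0 addr0 scaleN1r addrC subrr. Qed.

Lemma linD (f : V -> V) : linear f -> {morph f : x y / x + y}.
Proof. by move=> fl x y; have := fl 1 x y; rewrite !scale1r. Qed.

Lemma linZ (f : V -> V) : linear f -> forall k, {morph f : x / k *: x}.
Proof. by move=> fl k x; have := fl k x 0; rewrite (lin0 fl) !addr0. Qed.

Lemma linB (f : V -> V) : linear f -> {morph f : x y / x - y}.
Proof. by move=> fl x y; rewrite -scaleN1r addrC fl scaleN1r addrC. Qed.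

Lemma lin_sum (f : V -> V) (I : Type) (r : seq I) (P : pred I) (F : I -> V) : linear f ->
  f (\sum_(i <- r | P i) F i) = \sum_(i <- r | P i) f (F i).
Proof. by move=> fl; rewrite (big_morph f (linD fl) (lin0 fl)). Qed.

Lemma iter_lin i : linear (iter i w).
Proof. by elim: i => [|i IHi] k x y //=; rewrite IHi w_lin. Qed.

Lemma pw_lin c : linear (pw c).
Proof.
move=> k x y; rewrite /pw scaler_sumr -big_split; apply: eq_bigr => i _ /=.
by rewrite (linD (iter_lin i)) (linZ (iter_lin i)) scalerDr !scalerA mulrC.
Qed.

Lemma pw_comm (h : V -> V) c y : linear h -> (forall y, h (w y) = w (h y)) ->
  h (pw c y) = pw c (h y).
Proof.
move=> hl hw; rewrite /pw lin_sum //; apply: eq_bigr => i _; rewrite linZ //; congr (_ *: _).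
by elim: (val i) y => //= n IHn y; rewrite hw IHn.
Qed.

Lemma pw_w c y : pw c (w y) = w (pw c y).
Proof. by apply: esym; apply: pw_comm. Qed.

Lemma pwD c d y : pw (fun i => c i + d i) y = pw c y + pw d y.
Proof. by rewrite /pw -big_split; apply: eq_bigr => i _; rewrite scalerDl. Qed.

Lemma pwZ k c y : pw (fun i => k * c i) y = k *: pw c y.
Proof. by rewrite /pw scaler_sumr; apply: eq_bigr => i _; rewrite scalerA. Qed.

Lemma pw_delta k (i : 'I_p) y : pw (fun j => if j == i then k else 0) y = k *: iter i w y.
Proof.
rewrite /pw (bigD1 i) //= eqxx big1 ?addr0 // => j /negPf->.
by rewrite scale0r.
Qed.

(** An operator commuting with [w] is determined by its value at a cyclic vector, where some
    polynomial in [w] takes the same value. *)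
Lemma commutant (x : V) (h : V -> V) : (forall y, exists c, y = pw c x) ->
  linear h -> (forall y, h (w y) = w (h y)) -> exists c, forall y, h y = pw c y.
Proof.
move=> cyc hl hw; have [c hx] := cyc (h x); exists c => y.
have [d ->] := cyc y.
by rewrite (pw_comm d x hl hw) hx -(pw_comm d x (pw_lin c)) // => z; apply: pw_w.
Qed.

End LinearIterates.

Section AssociatedOrder.
Variables (K : fieldType) (V : lmodType K) (v : V -> int) (w : V -> V).

Definition preserving (h : V -> V) : Prop :=
  [/\ linear h, forall y, h (w y) = w (h y) & forall y, vge v 0 y -> vge v 0 (h y)].

(** Freeness of the integers over the associated order, phrased with operators commuting with [w];
    the translation is [principal_free]. *)
Definition principal : Prop := exists2 x, vge v 0 x &
  forall y, vge v 0 y -> exists2 h, preserving h & y = h x.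

End AssociatedOrder.

(** What the action of [w] and its substitute [WV] have in common, so that one analysis serves
    both. *)
Record raises (K : fieldType) (V : lmodType K) (v : V -> int) (p l : nat) (w : V -> V) := {
  raise_lin : linear w;
  raise_ge : forall n y, vge v n y -> vge v (n + l%:Z) (w y);
  raise_eq : forall y, y != 0 -> ~~ (p%:Z %| v y)%Z -> w y != 0 /\ v (w y) = v y + l%:Z
}.

(** * The associated order when [p] does not divide [l] *)

Section Orders.
Variables (K : fieldType) (vK : K -> int) (hK : normalized_valuation vK).
Variables (V : vectType K) (v : V -> int) (p : nat) (p_prime : prime p).
Variables (hV : valued_space vK v p) (dimV : \dim {:V} = p).
Variables (pi : K) (pi0 : pi != 0) (vpi : vK pi = 1).
Let uV := valued_ultra hV.
Let uK := nval_ultra hK.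
Let p_gt0 := prime_gt0 p_prime.

Section IntegralBasis.
Variables (b : 'I_p -> V) (b0 : forall i, b i != 0).
Hypothesis b_bounds : forall i, 0 <= v (b i) < p%:Z.
Hypothesis b_inj : forall i j, i != j -> v (b i) != v (b j).

Lemma bounded_orthogonal i j : i != j -> ~~ (p%:Z %| v (b i) - v (b j))%Z.
Proof.
move=> ij; apply: contra (b_inj ij) => /dvdzP[k E].
have /andP[i0 ip] := b_bounds i; have /andP[j0 jp] := b_bounds j.
have k0 : k = 0 by move: (v _) (v _) i0 ip j0 jp E => r s; clear; nia.
by rewrite -subr_eq0 E k0 mul0r.
Qed.

Lemma integral_basis : basis_of {:V} [tuple b i | i < p].
Proof. exact: (orthogonal_basis hV dimV b0 bounded_orthogonal). Qed.

Lemma vge_coord n y : vge v (p%:Z * n) y <->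
  forall i, vge vK n (coord [tuple b i | i < p] i y).
Proof.
have vc i c : vge v (p%:Z * n) (c *: b i) = vge vK n c.
  by rewrite -[p%:Z * n]addr0 (vge_coef hV c n (b0 i)) //; have /andP[] := b_bounds i; move: (v _); clear; lia.
split=> [ny i|ny].
  rewrite -(vc i); rewrite (basis_decomp integral_basis y) in ny.
  exact: (vge_orthogonal hV b0 bounded_orthogonal ny).
rewrite (basis_decomp integral_basis y); apply: (vge_sum uV) => i _.
by rewrite vc.
Qed.

Lemma vge0_coord y : vge v 0 y <-> forall i, vge vK 0 (coord [tuple b i | i < p] i y).
Proof. by rewrite -vge_coord mulr0. Qed.

End IntegralBasis.

Section Raising.
Variables (w : V -> V) (l : nat) (hw : raises v p l w).
Let a := (l %% p)%N.
Hypothesis a_gt0 : (0 < a)%N.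
Variables (x : V) (x0 : x != 0) (vx : v x = a%:Z).
Let w_lin := raise_lin hw.
Let nu := nu p l a.
Let n := w_exponent p l a.

Lemma iter_ge i m y : vge v m y -> vge v (m + (i * l)%N%:Z) (iter i w y).
Proof.
elim: i => [|i IHi] my /=; first by rewrite mul0n addr0.
by rewrite mulSn addnC PoszD addrA; apply/(raise_ge hw)/IHi.
Qed.

(** As [a] is congruent to [l], so is [a + i * l] to [i.+1 * l]. Starting at valuation [a] thus
    avoids the multiples of [p], where exactness may fail, until [i = p.-1]. *)
Lemma dvdn_iter i : (p %| a + i * l)%N = (p %| i.+1)%N.
Proof.
rewrite /dvdn /a modnDml -mulSn -/(dvdn _ _) Euclid_dvdM //.
by rewrite -[(p %| l)%N]negbK -lt0n -/a a_gt0 orbF.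
Qed.

Lemma val_iter i : (i < p)%N -> iter i w x != 0 /\ v (iter i w x) = (a + i * l)%N%:Z.
Proof.
elim: i => [|i IHi] ip; first by rewrite mul0n addn0.
have [y0 vy] := IHi (ltnW ip); have [|z0 vz] /= := raise_eq hw y0.
  by rewrite vy dvdzE /= dvdn_iter gtnNdvd.
by split=> //; rewrite vz vy mulSn; lia.
Qed.

Lemma iter_orthogonal (i j : 'I_p) : i != j ->
  ~~ (p%:Z %| v (iter i w x) - v (iter j w x))%Z.
Proof.
wlog ij : i j / (i < j)%N => [H ne|ne].
  case: (ltngtP i j) (ne) => [ij|ji|/val_inj->]; rewrite ?eqxx //; first by move=> _; apply: H.
  by move=> _; rewrite -opprB dvdzE abszN -dvdzE H // eq_sym.
have [_ ->] := val_iter (ltn_ord i); have [_ ->] := val_iter (ltn_ord j).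
rewrite -opprB dvdzE abszN -dvdzE.
have -> : (a + j * l)%N%:Z - (a + i * l)%N%:Z = ((j - i) * l)%N%:Z by rewrite mulnBl; nia.
rewrite dvdzE /= Euclid_dvdM // -[(p %| l)%N]negbK -lt0n -/a a_gt0 orbF gtnNdvd //.
  by rewrite subn_gt0.
by have := ltn_ord j; lia.
Qed.

Lemma iter_coef (c : 'I_p -> K) m : vge v m (\sum_(i < p) c i *: iter i w x) ->
  forall i : 'I_p, vge v m (c i *: iter i w x).
Proof.
apply: (vge_orthogonal hV (b := fun k : 'I_p => iter k w x)); last exact: iter_orthogonal.
by move=> j; case: (val_iter (ltn_ord j)).
Qed.

Definition ebase k : V := pi ^- nu k *: iter k w x.

Lemma nu_bounds k : (p * nu k <= a + k * l < p * nu k + p)%N.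
Proof. by rewrite /nu /Defs.nu mulnC leq_divM -mulSnr ltn_ceil. Qed.

Lemma ebase_neq0 k : (k < p)%N -> ebase k != 0.
Proof.
move=> /val_iter[y0 _]; rewrite scaler_eq0 negb_or y0 andbT.
by rewrite invr_eq0 expf_neq0.
Qed.

Lemma val_ebase k : (k < p)%N -> v (ebase k) = ((a + k * l) %% p)%N%:Z.
Proof.
move=> /val_iter[y0 vy]; rewrite (valuedZ hV) ?invr_eq0 ?expf_neq0 //.
have E := divn_eq (a + k * l) p; rewrite -[(_ %/ _)%N]/(nu k) in E.
by rewrite vy nvalXV // vpi mulr1 {1}E PoszD PoszM mulrN mulrC addKr.
Qed.

Lemma nu_zero : nu 0 = 0%N.
Proof. by rewrite /nu /Defs.nu mul0n addn0 divn_small // ltn_pmod. Qed.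

Lemma ebase0 : ebase 0 = x.
Proof. by rewrite /ebase nu_zero expr0 invr1 scale1r. Qed.

Lemma vge_low i j c : (i + j < p)%N -> vge vK (- (n i)%:Z) c ->
  vge v 0 ((c * pi ^- nu j) *: iter (i + j) w x).
Proof.
move=> ij nc; have [y0 vy] := val_iter ij.
have := w_exponent_le l a p_gt0 ij; rewrite -/n -/nu => nle.
have [c0|c0] := eqVneq c 0; first by rewrite c0 mul0r scale0r vge0.
have pj0 : pi ^- nu j != 0 by rewrite invr_eq0 expf_neq0.
rewrite vgeE ?scaler_eq0 ?negb_or ?mulf_neq0 // (valuedZ hV) ?mulf_neq0 //.
rewrite (valM hK) // nvalXV // vpi vy; rewrite vgeE // in nc.
have /andP[nuij _] := nu_bounds (i + j); move: nuij nle nc; move: (vK c) (_ + _)%N => d e; clear; nia.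
Qed.

Lemma nu_sum_bound i j : (p * (nu i + nu j) <= 2 * a + (i + j) * l)%N.
Proof.
by have /andP[+ _] := nu_bounds i; have /andP[+ _] := nu_bounds j; rewrite mulnDr mulnDl; lia.
Qed.

Section Wrap.
Variable s : nat.
Hypothesis wrap : vge v (2 * a + p * l + s)%N%:Z (iter p w x).

(** Dividing by the powers [nu i] and [nu j] of [pi] costs at most [2 * a + (i + j) * l]; once [w]
    has been applied [p] times, [wrap] pays for this and leaves [s]. *)
Lemma vge_high i j c : (p <= i + j)%N -> vge vK (- (nu i)%:Z) c ->
  vge v s%:Z ((c * pi ^- nu j) *: iter (i + j) w x).
Proof.
move=> pij nc; have := iter_ge (i + j - p) wrap.
rewrite -iterD subnK // => H.
have nj : vge vK (- (nu i + nu j)%N%:Z) (c * pi ^- nu j).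
  rewrite PoszD opprD; apply: (vgeM hK nc); rewrite vge_leq // nvalXV // vpi mulr1.
  by [].
apply: vge_trans (vgeZ hV nj H); have := nu_sum_bound i j.
rewrite (_ : (i + j) * l = p * l + (i + j - p) * l)%N; first by nia.
by rewrite -mulnDl; congr (_ * _)%N; lia.
Qed.

End Wrap.

Hypothesis wrap : vge v (2 * a + p * l)%N%:Z (iter p w x).
Let wrap0 : vge v (2 * a + p * l + 0)%N%:Z (iter p w x).
Proof. by rewrite addn0. Qed.

Let eb (k : 'I_p) := ebase k.

Lemma eb_neq0 k : eb k != 0. Proof. exact: ebase_neq0. Qed.

Lemma eb_bounds k : 0 <= v (eb k) < p%:Z.
Proof. by rewrite val_ebase // ltz_nat ltn_pmod. Qed.

Lemma residue_inj (i j : 'I_p) : i != j ->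
  ((a + i * l) %% p)%N%:Z != ((a + j * l) %% p)%N%:Z :> int.
Proof.
move=> ij; have := iter_orthogonal ij.
have [_ ->] := val_iter (ltn_ord i); have [_ ->] := val_iter (ltn_ord j).
apply: contra => /eqP[E]; rewrite {1}(divn_eq (a + i * l) p) {1}(divn_eq (a + j * l) p) E.
apply/dvdzP; exists (((a + i * l) %/ p)%N%:Z - ((a + j * l) %/ p)%N%:Z).
by rewrite !PoszD !PoszM opprD addrACA subrr addr0 mulrBl.
Qed.

Lemma eb_inj i j : i != j -> v (eb i) != v (eb j).
Proof. by rewrite !val_ebase //; apply: residue_inj. Qed.

Local Notation coordE := (coord [tuple eb i | i < p]).
Let ebasis : basis_of {:V} [tuple eb i | i < p] :=
  integral_basis eb_neq0 eb_bounds eb_inj.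

Lemma pw_ebase c j : pw w c (ebase j) = \sum_(i < p) (c i * pi ^- nu j) *: iter (i + j) w x.
Proof.
rewrite /pw; apply: eq_bigr => i _.
by rewrite (linZ (iter_lin w_lin i)) -iterD scalerA.
Qed.

(** Evaluation at [x] gives the weak bounds by [nu], which already make all terms with [i + j >= p]
    integral. Evaluation at the basis vector [j] realizing the minimum [n i] then gives the sharp
    bound, since the remaining terms are orthogonal. *)
Lemma preserve_coef (c : 'I_p -> K) :
  (forall y, vge v 0 y -> vge v 0 (pw w c y)) <-> (forall i : 'I_p, vge vK (- (n i)%:Z) (c i)).
Proof.
split=> [pres i|nc y /(vge0_coord eb_neq0 eb_bounds eb_inj) y_int].
  have coef (j k : 'I_p) m : vge v 0 ((c k * pi ^- m) *: iter j w x) ->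
      vge vK (m%:Z - (nu j)%:Z) (c k).
    have [->|ck0] := eqVneq (c k) 0; first by rewrite !vge0.
    have [y0 vy] := val_iter (ltn_ord j).
    have pm0 : pi ^- m != 0 by rewrite invr_eq0 expf_neq0.
    rewrite !vgeE ?scaler_eq0 ?negb_or ?mulf_neq0 // (valuedZ hV) ?mulf_neq0 //.
    rewrite (valM hK) // nvalXV // vpi vy => H.
    have /andP[_ nuj] := nu_bounds j; move: (vK _) (_ + _)%N H nuj => d e; clear; nia.
  have c_nu (k : 'I_p) : vge vK (- (nu k)%:Z) (c k).
    have /pres : vge v 0 (ebase 0) by rewrite ebase0 vge_leq // vx.
    rewrite pw_ebase => H; rewrite -[- _]add0r -[0]/(0%N%:Z); apply: coef.
    rewrite -nu_zero; apply: (iter_coef (c := fun k => c k * pi ^- nu 0)).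
    by under eq_bigr => j _ do rewrite -[X in iter X]addn0.
  have [j ij nij] := w_exponent_attained l a p_gt0 (ltn_ord i).
  rewrite -/n -/nu in nij; have jp : (j < p)%N by lia.
  have : vge v 0 (pw w c (ebase j)).
    by apply: pres; rewrite vge_leq //; have /andP[] := eb_bounds (Ordinal jp).
  rewrite pw_ebase (bigID (fun k : 'I_p => (k + j < p)%N)) /= (vge_addr uV); last first.
    apply: (vge_sum uV) => k; rewrite -leqNgt => pkj.
    exact: (vge_high wrap0 pkj (c_nu k)).
  pose r (k : 'I_p) : 'I_p := Ordinal (ltn_pmod (k + j) p_gt0).
  have r_inj : injective r.
    move=> k k' /(congr1 val)/= /eqP; rewrite eqn_modDr => /eqP.
    by rewrite !modn_small // => /val_inj.
  rewrite big_mkcond /= (eq_bigr (fun k : 'I_p => (if (k + j < p)%N then c k * pi ^- nu j else 0)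
      *: iter (r k) w x)); last first.
    by move=> k _; case: ifP => kj; rewrite ?scale0r // /r /= modn_small.
  move=> /(vge_orthogonal hV) H.
  have {H} := H _ _ i; rewrite ij /r /= modn_small // => H.
  have {}H : vge v 0 ((c i * pi ^- nu j) *: iter (Ordinal ij) w x).
    apply: H => [k|k k' kk']; first by case: (val_iter (ltn_ord (r k))).
    by apply: (@iter_orthogonal (r k) (r k')); rewrite (inj_eq r_inj).
  by apply: vge_trans (coef _ _ _ H); rewrite /= nij; lia.
rewrite (basis_decomp ebasis y) (lin_sum _ _ _ (pw_lin w_lin c)).
apply: (vge_sum uV) => j _; rewrite (linZ (pw_lin w_lin c)).
apply: (vgeZ0 hV (y_int j)); rewrite pw_ebase; apply: (vge_sum uV) => i _.
case: (ltnP (i + j) p) => ij; first exact: vge_low (nc i).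
apply: (vge_high wrap0 ij); apply: vge_trans (nc i).
by rewrite lerN2 lez_nat w_exponent_leq_nu.
Qed.

Lemma pw_cyclic y : exists c : 'I_p -> K, y = pw w c x.
Proof.
exists (fun i => coordE i y * pi ^- nu i); rewrite {1}(basis_decomp ebasis y) /pw.
by apply: eq_bigr => i _; rewrite scalerA.
Qed.

Definition reachable (y0 y : V) :=
  exists2 c : 'I_p -> K, (forall i : 'I_p, vge vK (- (n i)%:Z) (c i)) & y = pw w c y0.

Lemma principalP : principal v w <->
  exists2 y0, vge v 0 y0 & forall y, vge v 0 y -> reachable y0 y.
Proof.
split=> -[y0 y0_int H]; exists y0 => // y /H.
  case=> h [hl hc hp] ->; have [c hE] := commutant w_lin pw_cyclic hl hc.
  by exists c; rewrite ?hE //; apply/preserve_coef => z zi; rewrite -hE; apply: hp.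
case=> c nc ->; exists (pw w c) => //; split; first exact: pw_lin.
  by move=> z; apply: pw_w.
exact/preserve_coef.
Qed.

Lemma reachableD y0 y y' : reachable y0 y -> reachable y0 y' -> reachable y0 (y + y').
Proof.
move=> [c nc ->] [d nd ->]; exists (fun i => c i + d i); rewrite ?pwD //.
by move=> i; apply: (vgeD uK).
Qed.

Lemma reachableZ k y0 y : vge vK 0 k -> reachable y0 y -> reachable y0 (k *: y).
Proof.
move=> k0 [c nc ->]; exists (fun i => k * c i); rewrite ?pwZ //.
by move=> i; rewrite -[X in vge _ X _]add0r; apply: (vgeM hK).
Qed.

Lemma reachable_ord_elt (i : 'I_p) y0 : reachable y0 (pi ^- n i *: iter i w y0).
Proof.
exists (fun j => if j == i then pi ^- n i else 0); last by rewrite pw_delta.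
move=> j; case: eqVneq => [->|_]; last exact: vge0.
by rewrite vge_leq // nvalXV // vpi mulr1.
Qed.

(** In this case the elements [pi ^- n i *: w ^ i] carry [x] to the integral basis [eb] itself. *)
Lemma principal_if : (forall i, (i < p)%N -> n i = nu i) -> principal v w.
Proof.
move=> nnu; apply/principalP; exists x; first by rewrite vge_leq // vx.
move=> y /(vge0_coord eb_neq0 eb_bounds eb_inj) y_int.
rewrite (basis_decomp ebasis y).
elim/big_ind: _ => [|z z' |i _]; last first.
- by apply: reachableZ (y_int i) _; rewrite /eb /ebase -nnu //; apply: reachable_ord_elt.
- exact: reachableD.
rewrite -(scale0r (x : V)); apply: reachableZ; first exact: vge0.
have := @reachable_ord_elt (Ordinal p_gt0) x; rewrite /= nnu // nu_zero expr0 invr1 scale1r.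
by [].
Qed.

Definition ord_elt (i : nat) (y : V) : V := pi ^- n i *: iter i w y.

Lemma ord_elt_lin i : linear (ord_elt i).
Proof.
move=> k y z; rewrite /ord_elt (linD (iter_lin w_lin i)) (linZ (iter_lin w_lin i)).
by rewrite scalerDr !scalerA mulrC.
Qed.

Lemma ord_elt_integral (i : 'I_p) y : vge v 0 y -> vge v 0 (ord_elt i y).
Proof.
rewrite /ord_elt -pw_delta; apply: (iffRL (preserve_coef _)) => j.
case: eqVneq => [->|_]; last exact: vge0.
by rewrite vge_leq // nvalXV // vpi mulr1.
Qed.

Lemma ord_elt_ebase i j : (i + j < p)%N ->
  ord_elt i (ebase j) = pi ^+ (nu (i + j) - nu j - n i) *: ebase (i + j).
Proof.
move=> ij; have := w_exponent_le l a p_gt0 ij; rewrite -/n -/nu => nle.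
rewrite /ord_elt /ebase (linZ (iter_lin w_lin i)) -iterD !scalerA; congr (_ *: _).
set m := (_ - _ - _)%N; have E : nu (i + j) = (m + (n i + nu j))%N by rewrite /m; lia.
by rewrite E exprD invfM mulrA mulfV ?expf_neq0 // mul1r exprD invfM.
Qed.

Lemma reachable_sum y0 y : reachable y0 y ->
  exists2 c : 'I_p -> K, (forall i, vge vK 0 (c i)) & y = \sum_i c i *: ord_elt i y0.
Proof.
case=> c nc ->; exists (fun i => c i * pi ^+ n i).
  move=> i; rewrite -(addNr (n i)%:Z); apply: (vgeM hK) => //.
  by rewrite vge_leq // nvalX // vpi mulr1.
apply: eq_bigr => i _; rewrite /ord_elt scalerA -mulrA mulfV ?mulr1 //.
by rewrite expf_neq0.
Qed.

Lemma perm_leq_id (m : nat) (s : {perm 'I_m}) : (forall i : 'I_m, i <= s i)%N ->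
  forall i, s i = i.
Proof.
move=> ge i; apply/val_inj/eqP; rewrite /= eqn_leq ge andbT leqNgt; apply/negP => lt.
have : (\sum_(j < m) j < \sum_(j < m) s j)%N.
  rewrite (bigD1 i) //= [X in (_ < X)%N](bigD1 i) //= -addSn leq_add //.
  exact: leq_sum.
by rewrite [X in (X < _)%N](reindex_inj (@perm_inj _ s)) ltnn.
Qed.

Section Strict.
Hypothesis strict_wrap : vge v (2 * a + p * l + p)%N%:Z (iter p w x).

(** A surplus of [p] in [v] is one unit of [vK], so the wrapped terms disappear modulo the maximal
    ideal. *)
Lemma coord_ord_elt_high (i j k : 'I_p) : (p <= i + j)%N -> vge vK 1 (coordE k (ord_elt i (ebase j))).
Proof.
move=> pij; apply: (iffLR (vge_coord eb_neq0 eb_bounds eb_inj 1 _)).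
rewrite mulr1 /ord_elt (linZ (iter_lin w_lin i)) -iterD scalerA.
apply: (vge_high strict_wrap pij); rewrite vge_leq // nvalXV // vpi mulr1.
by rewrite lerN2 lez_nat w_exponent_leq_nu.
Qed.

(* Modulo the maximal ideal the matrix of the [ord_elt i y] is upper triangular, *)
(* so that a generator [y] forces its diagonal entries to be units.              *)
Lemma principal_only_if : principal v w -> forall i, (i < p)%N -> n i = nu i.
Proof.
case/principalP => y0 y0_int reach i0 i0p.
have ek_int k : vge v 0 (eb k) by rewrite vge_leq //; have /andP[] := eb_bounds k.
have Hk (k : 'I_p) : exists c : {ffun 'I_p -> K}, (forall i, vge vK 0 (c i)) /\
    eb k = \sum_i c i *: ord_elt i y0.
  have [c c0 cE] := reachable_sum (reach _ (ek_int k)).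
  by exists (finfun c); split=> [i|]; [|rewrite cE; apply: eq_bigr => i _]; rewrite ffunE.
have [f fP] := choice Hk.
pose C : 'M[K]_p := \matrix_(k, i) f k i.
pose T : 'M[K]_p := \matrix_(i, k) coordE k (ord_elt i y0).
have CT : C *m T = 1%:M.
  apply/matrixP => k k'; rewrite !mxE; have [_ E] := fP k.
  transitivity (coordE k' (eb k)).
    rewrite E linear_sum; apply: eq_bigr => i _; rewrite !mxE.
    by move: (ord_elt i y0) => z; rewrite linearZ.
  have -> : eb k = \sum_j (k == j)%:R *: eb j.
    rewrite (bigD1 k) //= eqxx scale1r big1 ?addr0 // => j.
    by rewrite eq_sym => /negPf->; rewrite scale0r.
  exact: (coord_uniq _ ebasis).
have T0 i k : vge vK 0 (T i k).
  by rewrite mxE; apply: (iffLR (vge0_coord eb_neq0 eb_bounds eb_inj _)); apply: ord_elt_integral.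
have [s sT] : exists s : {perm 'I_p}, forall i, ~~ vge vK 1 (T i (s i)).
  by apply: (unit_transversal hK _ T0 CT) => k i; rewrite mxE; case: (fP k).
have y0E := basis_decomp ebasis y0.
have y0c := iffLR (vge0_coord eb_neq0 eb_bounds eb_inj _) y0_int.
(* Below the diagonal only wrapped terms contribute; on it there is also the term [j = 0], with
   factor [pi ^+ (nu i - n i)]. *)
have Tlow (i k : 'I_p) : (k < i)%N \/ k = i /\ (n i < nu i)%N -> vge vK 1 (T i k).
  move=> ki; rewrite mxE [in ord_elt _ _]y0E (lin_sum _ _ _ (ord_elt_lin i)) linear_sum.
  apply: (vge_sum uK) => j _; rewrite (linZ (ord_elt_lin i)) linearZ -[1]add0r.
  apply: (vgeM hK) => //; case: (leqP p (i + j)) => ij; first exact: coord_ord_elt_high.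
  rewrite (ord_elt_ebase ij) linearZ /=.
  have -> : coordE k (ebase (i + j)) = (Ordinal ij == k)%:R.
    have -> : ebase (i + j) = \sum_k (Ordinal ij == k)%:R *: eb k.
      rewrite (bigD1 (Ordinal ij)) //= eqxx scale1r big1 ?addr0 // => k'.
      by rewrite eq_sym => /negPf->; rewrite scale0r.
    exact: (coord_uniq _ ebasis).
  case: eqVneq => [kE|_]; last by rewrite mulr0 vge0.
  have kE' : k = (i + j)%N :> nat by rewrite -kE.
  rewrite mulr1 vge_leq // nvalX // vpi mulr1.
  case: ki => [|[ki lt]]; first by rewrite kE' ltnNge leq_addr.
  have j0 : nat_of_ord j = 0%N by move: kE'; rewrite ki; lia.
  by rewrite j0 addn0 nu_zero; lia.
have s_ge (i : 'I_p) : (i <= s i)%N.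
  by rewrite leqNgt; apply: contra (sT i) => lt; apply: Tlow; left.
have := sT (Ordinal i0p); rewrite (perm_leq_id s_ge) => N.
apply/eqP; rewrite eqn_leq w_exponent_leq_nu // leqNgt; apply: contra N => lt.
by apply: Tlow; right.
Qed.

End Strict.

(** * The extremal case: an operator whose p-th power is a multiple of itself *)

Section Monomial.
Variables (C : K) (o : V).
Hypotheses (C0 : C != 0) (vC : vK C = (nu p.-1)%:Z).
Hypothesis wC : forall y, iter p w y = C *: w y.
Hypotheses (o0 : o != 0) (vo : v o = 0) (wo : w o = 0).
Let N := p.-1.
Let pE : p = N.+1. Proof. by rewrite /N prednK. Qed.
Let N_gt0 : (0 < N)%N. Proof. by rewrite -ltnS -pE prime_gt1. Qed.
Let Np : (N < p)%N. Proof. by rewrite pE. Qed.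

(** [ebase N] has valuation 0, like [o], so [o] can replace it in the integral basis; this isolates
    the kernel of [w]. *)
Let ob (k : 'I_p) : V := if (k < N)%N then ebase k else o.

Let ob_neq0 k : ob k != 0.
Proof. by rewrite /ob; case: ifP => // _; apply: ebase_neq0. Qed.

Let residue_gt0 k : (k < N)%N -> (0 < (a + k * l) %% p)%N.
Proof. by move=> kN; rewrite lt0n -/(dvdn _ _) dvdn_iter gtnNdvd // pE. Qed.

Let ob_bounds k : 0 <= v (ob k) < p%:Z.
Proof. by rewrite /ob; case: ifP => _; [apply: eb_bounds | rewrite vo ltz_nat p_gt0]. Qed.

Let ob_inj i j : i != j -> v (ob i) != v (ob j).
Proof.
rewrite /ob; case: ifP => iN; case: ifP => jN ij; first exact: (@eb_inj i j).
- by rewrite val_ebase // vo eqz_nat -lt0n residue_gt0.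
- by rewrite val_ebase // vo eqz_nat eq_sym -lt0n residue_gt0.
- by case/eqP: ij; apply/val_inj => /=; have := ltn_ord i; have := ltn_ord j; lia.
Qed.

Let obasis := integral_basis ob_neq0 ob_bounds ob_inj.
Local Notation coordO := (coord [tuple ob i | i < p]).

Let obN : ob (Ordinal Np) = o. Proof. by rewrite /ob /= ltnn. Qed.

Let iota : 'I_N -> 'I_p := widen_ord (ltnW Np).

Let ob_iota i : ob (iota i) = ebase i.
Proof. by rewrite /ob /= ltn_ord. Qed.

Let decomp y : y = \sum_i coordO (iota i) y *: ebase i + coordO (Ordinal Np) y *: o.
Proof.
rewrite {1}(basis_decomp obasis y) (big_ord_last (ltnW Np) Np) // obN; congr (_ + _).
by apply: eq_bigr => i _; rewrite ob_iota.
Qed.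

Let coord_iota i (d : 'I_N -> K) k : coordO (iota i) (\sum_i d i *: ebase i + k *: o) = d i.
Proof.
pose c (j : 'I_p) := if insub (j : nat) is Some i' then d i' else k.
have c_iota i' : c (iota i') = d i' by rewrite /c /= valK.
have cN : c (Ordinal Np) = k by rewrite /c insubF //= ltnn.
rewrite -c_iota -(coord_uniq c obasis) (big_ord_last (ltnW Np) Np) // obN cN.
congr (coordO _ (_ + _)).
by apply: eq_bigr => i' _; rewrite c_iota ob_iota.
Qed.

(** A nonzero combination of the [ebase k] with [k < N] has valuation prime to [p], and there
    [raise_eq] forbids [w] to vanish. *)
Let ker_w y : w y = 0 -> y = coordO (Ordinal Np) y *: o.
Proof.
move=> wy; set k := coordO _ y.
pose y' := \sum_i coordO (iota i) y *: ebase i.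
have yE : y = y' + k *: o by apply: decomp.
have wy' : w y' = 0.
  by rewrite -(addrK (k *: o) y') -yE -scaleNr (linD w_lin) wy (linZ w_lin) wo scaler0 addr0.
suff y'0 : y' = 0 by rewrite {1}yE y'0 add0r.
apply/eqP/contraT => y'0.
have [|+ _] := raise_eq hw y'0; last by rewrite wy' eqxx.
have y'v : vge v (v y') y' by rewrite vge_leq.
have {}y'v := vge_orthogonal hV (b := fun i : 'I_N => ebase i) _ _ y'v.
have [i Ni] : exists i, ~~ vge v (v y' + 1) (coordO (iota i) y *: ebase i).
  apply: contrapT => nex; have : vge v (v y' + 1) y'.
    apply: (vge_sum uV) => i _; apply: contrapT => /negP Ni; apply: nex; exists i => //.
  by rewrite vgeE // lezD1 ltxx.
have [z0 zlt] := vge_nearby Ni.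
have : vge v (v y') (coordO (iota i) y *: ebase i).
  apply: y'v => [j|j j' jj']; first exact/ebase_neq0/(ltn_trans _ Np).
  rewrite -!ob_iota; apply: (bounded_orthogonal ob_bounds ob_inj).
  by apply: contra jj' => /eqP/(congr1 val)/= E; apply/eqP/val_inj.
rewrite vgeE // => zge; have vE : v y' = v (coordO (iota i) y *: ebase i).
  by apply: le_anti; rewrite zge -ltzD1 zlt.
have d0 : coordO (iota i) y != 0 by apply: contraNneq z0 => ->; rewrite scale0r.
have iN := ltn_ord i; have ip := ltn_trans iN Np.
rewrite vE (valuedZ hV) ?ebase_neq0 // val_ebase //.
have r0 := residue_gt0 iN; have rp := ltn_pmod (a + i * l) p_gt0.
move: (_ %% _)%N (vK _) r0 rp => r c; clear => r0 rp; apply/negP => /dvdzP[q E].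
have {}E : r%:Z = (q - c) * p%:Z by rewrite mulrBl -E [c * _]mulrC addrAC subrr add0r.
by have : q - c = 0; [nia | lia].
Qed.

Let u := C * pi ^- nu N.
Let u0 : u != 0. Proof. by rewrite mulf_neq0 ?invr_eq0 ?expf_neq0. Qed.
Let vu : vK u = 0.
Proof. by rewrite (valM hK) ?invr_eq0 ?expf_neq0 // nvalXV // vpi vC mulr1 subrr. Qed.

(** Because [w ^ p = C w], the operator [w] takes the same value at [ebase N] and at
    [u *: ebase 0]. *)
Let ebaseN : exists k, ebase N = u *: ebase 0 + k *: o.
Proof.
have /ker_w E : w (ebase N - u *: ebase 0) = 0.
  rewrite ebase0 /ebase -scaleNr (linD w_lin) !(linZ w_lin) -iterS -pE wC scalerA.
  by rewrite mulrC -scalerDl subrr scale0r.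
by eexists; rewrite -[LHS](subrK (u *: ebase 0)) addrC E.
Qed.

Let n_N : n N = nu N.
Proof.
apply/eqP; rewrite eqn_leq w_exponent_leq_nu // w_exponent_min // => j.
rewrite {1}pE -addSn => /ltnSE; rewrite -{2}[N]addn0 leq_add2l leqn0 => /eqP->.
by rewrite -/nu nu_zero !addn0.
Qed.

Let ord_elt_o i : (0 < i)%N -> ord_elt i o = 0.
Proof.
case: i => // i _; rewrite /ord_elt iterSr wo (lin0 (iter_lin w_lin i)).
by rewrite scaler0.
Qed.

Let iter_wrap m y : (0 < m)%N -> iter (m + N) w y = C *: iter m w y.
Proof.
case: m => // m _; rewrite addSnnS -pE iterD wC (linZ (iter_lin w_lin m)).
by rewrite -iterSr.
Qed.

Let F := nu_cyc p l a.
Let F_small k : (k < N)%N -> F k = nu k.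
Proof. by move=> kN; rewrite /F /nu_cyc -/N modn_small // divn_small // mul0n addn0. Qed.

Let F_period k : F (k + N) = (F k + nu N)%N.
Proof. by rewrite /F /nu_cyc -/N modnDr divnDr ?divnn ?N_gt0 //= mulnDl mul1n addnA. Qed.

(* Modulo [o], each [ord_elt i] is a weighted cyclic shift of the [ebase j]. *)
Let ord_elt_cyc i j : (i <= N)%N -> (j < N)%N -> exists g k,
  [/\ ord_elt i (ebase j) = g *: ebase ((i + j) %% N) + k *: o, g != 0
    & vK g = (F (i + j))%:Z - (F j)%:Z - (n i)%:Z].
Proof.
move=> iN jN; rewrite (F_small jN); have pi_n m : pi ^+ m != 0 by rewrite expf_neq0.
have vpi_n m : vK (pi ^+ m) = m by rewrite nvalX // vpi mulr1.
case: (ltngtP (i + j) N) => ijN.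
- have ijp := ltn_trans ijN Np; have := w_exponent_le l a p_gt0 ijp.
  rewrite -/n -/nu => nle; exists (pi ^+ (nu (i + j) - nu j - n i)), 0.
  rewrite scale0r addr0 modn_small // ord_elt_ebase //; split=> //.
  by rewrite vpi_n F_small //; move: nle; clear; lia.
- exists (pi ^- n i * pi ^- nu j * C * pi ^+ nu (i + j - N)), 0.
  have lt : (i + j - N < N)%N by rewrite ltn_subLR ?(ltnW ijN) // -addnS leq_add.
  have E : (i + j = (i + j - N) + N)%N by rewrite subnK // ltnW.
  rewrite scale0r addr0 {2}E modnDr modn_small //; split.
  + rewrite /ord_elt /ebase (linZ (iter_lin w_lin i)) -iterD.
    rewrite [in LHS]E iter_wrap ?subn_gt0 // !scalerA mulfK //.
  + by rewrite !mulf_neq0 ?invr_eq0.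
  + rewrite !(valM hK) ?mulf_neq0 ?invr_eq0 // !(nvalV hK) // !vpi_n vC {2}E F_period F_small //.
    by rewrite PoszD -/N; clear; lia.
- have [k kE] := ebaseN; have ijp : (i + j < p)%N by rewrite ijN.
  have := w_exponent_le l a p_gt0 ijp; rewrite -/n -/nu => nle.
  exists (pi ^+ (nu N - nu j - n i) * u), (pi ^+ (nu N - nu j - n i) * k).
  rewrite ord_elt_ebase // ijN modnn kE scalerDr !scalerA; split=> //; first by rewrite mulf_neq0.
  have FN : F N = nu N by have := F_period 0; rewrite (F_small N_gt0) nu_zero.
  by rewrite (valM hK) // vpi_n vu FN; rewrite ijN in nle; move: nle; clear; lia.
Qed.

Let coord_top (d : 'I_N -> K) k : coordO (Ordinal Np) (\sum_i d i *: ebase i + k *: o) = k.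
Proof.
set y := _ + _; have := decomp y; under eq_bigr => i _ do rewrite coord_iota.
rewrite /y => /addrI/eqP; rewrite -subr_eq0 -scalerBl scaler_eq0 (negPf o0) orbF subr_eq0.
by move=> /eqP.
Qed.

Let single (j : 'I_N) g k : g *: ebase j + k *: o =
  \sum_i (if i == j then g else 0) *: ebase i + k *: o.
Proof.
rewrite (bigD1 j) //= eqxx big1 ?addr0 // => i /negPf->.
by rewrite scale0r.
Qed.

Let ob_int := vge0_coord ob_neq0 ob_bounds ob_inj.

Let cyc (i j : nat) : 'I_N := Ordinal (ltn_pmod (i + j) N_gt0).

Let ord_elt_cyc_int i j : (i <= N)%N -> (j < N)%N -> exists g k,
  [/\ ord_elt i (ebase j) = g *: ebase (cyc i j) + k *: o, vge vK 0 g, vge vK 0 k, g != 0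
    & vK g = (F (i + j))%:Z - (F j)%:Z - (n i)%:Z].
Proof.
move=> iN jN; have [g [k [E g0 vg]]] := ord_elt_cyc iN jN; exists g, k.
have ip : (i < p)%N by rewrite pE ltnS.
have Hint : vge v 0 (ord_elt i (ebase j)).
  apply: (@ord_elt_integral (Ordinal ip)); rewrite vge_leq //.
  by have /andP[] := eb_bounds (Ordinal (ltn_trans jN Np)).
have {}Hint := iffLR (ob_int _) Hint.
have {}E : ord_elt i (ebase j) = g *: ebase (cyc i j) + k *: o by [].
split=> //.
  have := Hint (iota (cyc i j)); rewrite E single coord_iota eqxx.
  by [].
by have := Hint (Ordinal Np); rewrite E single coord_top.
Qed.

Let n_le i j : (i < N)%N -> (j < N)%N -> (F j + n i <= F (i + j))%N.
Proof.
move=> iN jN; have [g [k [_ + _ g0 vg]]] := ord_elt_cyc_int (ltnW iN) jN.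
by rewrite vgeE // vg; clear; lia.
Qed.

Let ord_elt_N (j : 'I_N) : exists k, ord_elt N (ebase j) = u *: ebase j + k *: o.
Proof.
have [j0|j0] := posnP j.
  have [k kE] := ebaseN; exists k; rewrite j0 -kE ebase0 /ord_elt n_N.
  by [].
exists 0; rewrite scale0r addr0 /ord_elt /ebase (linZ (iter_lin w_lin N)) -iterD.
rewrite [(N + _)%N]addnC iter_wrap // n_N !scalerA; congr (_ *: _).
by rewrite /u; ring.
Qed.

(** Modulo [o], [ord_elt N] is multiplication by the unit [u], so its coefficients can be merged
    with those of [ord_elt 0], the identity, and the matrices become square of size [N]. A
    transversal of units provides for each shift a start where it is isometric; [transversal_start]
    makes the start common. *)
Lemma monomial_only_if : principal v w ->
  exists2 j, (j < N)%N & forall i, (i < N)%N -> F (i + j) = (F j + n i)%N.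
Proof.
case/principalP => y0 y0_int reach.
have ek_int (k : 'I_N) : vge v 0 (ebase k).
  by rewrite vge_leq // -ob_iota; have /andP[] := ob_bounds (iota k).
have Hk (k : 'I_N) : exists c : {ffun 'I_p -> K}, (forall i, vge vK 0 (c i)) /\
    ebase k = \sum_i c i *: ord_elt i y0.
  have [c c0 cE] := reachable_sum (reach _ (ek_int k)).
  by exists (finfun c); split=> [i|]; [|rewrite cE; apply: eq_bigr => i _]; rewrite ffunE.
have [f fP] := choice Hk.
pose phi k y := coordO (iota k) y.
have phi0 k : phi k 0 = 0 by apply: linear0.
have phiD k z z' : phi k (z + z') = phi k z + phi k z' by apply: linearD.
have phiZ k z c : phi k (c *: z) = c * phi k z by apply: linearZ.
have phi_sum k I (r : seq I) (G : I -> V) : phi k (\sum_(i <- r) G i) = \sum_(i <- r) phi k (G i).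
  by rewrite (big_morph (phi k) (phiD k) (phi0 k)).
have phi_o k : phi k o = 0.
  have := coord_iota k (fun _ => 0) 1; rewrite big1 ?add0r ?scale1r // => i _.
  by rewrite scale0r.
have phi_e k (k' : 'I_N) : phi k (ebase k') = (k == k')%:R.
  have := coord_iota k (fun i => if i == k' then 1 else 0) 0.
  by rewrite -single scale1r scale0r addr0 /phi => ->; case: eqVneq.
have H0 y : ord_elt 0 y = y.
  have := w_exponent_leq_nu l a p_gt0 p_gt0; rewrite -/n -/nu nu_zero leqn0 /ord_elt => /eqP->.
  by rewrite expr0 invr1 scale1r.
have phi_elt i k y : phi k (ord_elt i y) =
    \sum_(j < N) phi j y * phi k (ord_elt i (ebase j)).
  rewrite {1}(decomp y) (linD (ord_elt_lin i)) phiD (linZ (ord_elt_lin i) _ o) (phiZ k (ord_elt i o)).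
  rewrite (_ : phi k (ord_elt i o) = 0); last by case: i => [|i]; rewrite ?H0 ?ord_elt_o.
  rewrite mulr0 addr0 (lin_sum _ _ _ (ord_elt_lin i)) phi_sum.
  by apply: eq_bigr => j _; rewrite (linZ (ord_elt_lin i)) (phiZ k (ord_elt i (ebase j))).
have phi_eltN k y : phi k (ord_elt N y) = u * phi k y.
  rewrite phi_elt (bigD1 k) //= big1 ?addr0 => [|j /negPf jk].
    by have [c ->] := ord_elt_N k; rewrite phiD (phiZ k (ebase k)) (phiZ k o) phi_o phi_e eqxx mulr1 mulr0 addr0 mulrC.
  by have [c ->] := ord_elt_N j; rewrite phiD (phiZ k (ebase j)) (phiZ k o) phi_o phi_e eq_sym jk !mulr0 addr0 mulr0.
pose D : 'M[K]_N :=
  \matrix_(k, i) (f k (iota i) + (if i == 0%N :> nat then u * f k (Ordinal Np) else 0)).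
pose T : 'M[K]_N := \matrix_(i, k) phi k (ord_elt i y0).
have DT : D *m T = 1%:M.
  apply/matrixP => k k'; rewrite !mxE eq_sym -phi_e; have [_ ->] := fP k.
  rewrite phi_sum (big_ord_last (ltnW Np) Np) //= (phiZ k' (ord_elt N y0)) phi_eltN.
  under eq_bigr => i _ do rewrite !mxE mulrDl.
  rewrite big_split /=; congr (_ + _); first by apply: eq_bigr => i _; rewrite (phiZ k' (ord_elt i y0)).
  rewrite (bigD1 (Ordinal N_gt0)) //= big1 ?addr0 => [|i i0].
    by rewrite H0 mulrCA mulrA.
  by case: eqP => [i0'|_]; [case/eqP: i0; apply: val_inj | rewrite mul0r].
have D0 k i : vge vK 0 (D k i).
  have [fk _] := fP k; rewrite mxE; apply: (vgeD uK) => //; case: ifP => _; last exact: vge0.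
  by rewrite -[0]addr0; apply: (vgeM hK) => //; rewrite vge_leq ?vu.
have y0c k : vge vK 0 (phi k y0) by apply: (iffLR (ob_int _) y0_int).
have T0 i k : vge vK 0 (T i k).
  rewrite mxE; apply: (iffLR (ob_int _)); apply: (@ord_elt_integral (iota i)) => //.
have [s sT] := unit_transversal hK D0 T0 DT.
apply: (@transversal_start N (nu N) F n s) => // i.
set j := (_ %% N)%N; have jN : (j < N)%N by rewrite ltn_pmod.
apply/eqP; rewrite eqn_leq n_le // andbT leqNgt; apply: contra (sT i) => lt.
rewrite mxE phi_elt; apply: (vge_sum uK) => j' _; rewrite -[1]add0r; apply: (vgeM hK) => //.
have [g [c [-> _ _ g0 vg]]] := ord_elt_cyc_int (ltnW (ltn_ord i)) (ltn_ord j').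
rewrite phiD (phiZ _ (ebase _)) (phiZ _ o) phi_o phi_e mulr0 addr0; case: eqVneq => [sE|_]; last by rewrite mulr0 vge0.
rewrite mulr1 vgeE // vg; suff -> : j' = j :> nat by move: lt; clear; lia.
have siE : s i = ((i + j') %% N)%N :> nat by rewrite sE.
rewrite /j siE; have iN := ltn_ord i; have j'N := ltn_ord j'.
case: (ltnP (i + j') N) => ij.
  by rewrite (modn_small ij) -addnA addKn modnDr modn_small.
have -> : ((i + j') %% N = i + j' - N)%N.
  by rewrite -{1}(subnK ij) modnDr modn_small // ltn_subLR // -addnS leq_add // ltnW.
by rewrite subnK // addKn modn_small.
Qed.

(** For [j > 0], [o + ebase j] generates: [ord_elt N] kills [o] and multiplies [ebase j] by a unit,
    which separates the two summands, and the isometric shifts carry [ebase j] to units times the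
    other [ebase k], modulo [o]. For [j = 0] the hypothesis is [n = nu]. *)
Lemma monomial_if j : (j < N)%N -> (forall i, (i < N)%N -> F (i + j) = (F j + n i)%N) ->
  principal v w.
Proof.
move=> jN start; have [j0|j0] := posnP j.
  apply: principal_if => i; rewrite pE ltnS leq_eqVlt => /orP[/eqP->//|iN].
  by have := start i iN; rewrite j0 addn0 !F_small // nu_zero.
apply/principalP; pose y0 := o + ebase j; exists y0.
  apply: (vgeD uV); first by rewrite vge_leq ?vo.
  by rewrite vge_leq // -[j]/(val (Ordinal jN)) -ob_iota; have /andP[] := ob_bounds (iota (Ordinal jN)).
have reachH i : (i < p)%N -> reachable y0 (ord_elt i y0).
  by move=> ip; apply: (reachable_ord_elt (Ordinal ip)).
have HE i : (0 < i)%N -> ord_elt i y0 = ord_elt i (ebase j).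
  by move=> i0; rewrite (linD (ord_elt_lin i)) ord_elt_o // add0r.
have reach_y0 : reachable y0 y0.
  have := reachH 0%N p_gt0; have := w_exponent_leq_nu l a p_gt0 p_gt0.
  by rewrite -/n -/nu nu_zero leqn0 /ord_elt => /eqP->; rewrite expr0 invr1 scale1r.
have reach_e : reachable y0 (ebase j).
  have -> : ebase j = u^-1 *: ord_elt N y0.
    rewrite HE // /ord_elt /ebase (linZ (iter_lin w_lin N)) -iterD addnC iter_wrap // n_N !scalerA.
    by congr (_ *: _); rewrite /u; field; rewrite !expf_neq0.
  by apply: reachableZ; [rewrite vge_leq // (nvalV hK) // vu | apply: reachH].
have reach_o : reachable y0 o.
  rewrite -(addrK (ebase j) o) -scaleN1r; apply: reachableD => //.
  by apply: reachableZ => //; rewrite vge_leq // nvalN1.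
have reach_k (k : 'I_N) : reachable y0 (ebase k).
  have [->//|kj] := eqVneq (k : nat) j; have kN := ltn_ord k.
  pose i := ((k + N - j) %% N)%N; have iN : (i < N)%N by rewrite ltn_pmod.
  have kE : k = cyc i j.
    apply: val_inj; rewrite /= /i modnDml subnK ?modnDr ?modn_small //.
    by rewrite (leq_trans (ltnW jN)) // leq_addl.
  have i0 : (0 < i)%N.
    rewrite lt0n; apply: contra kj => /eqP i0; rewrite kE /= i0 add0n modn_small //.
  have [g [c [E _ c0 g0 vg]]] := ord_elt_cyc_int (ltnW iN) jN.
  have -> : ebase k = g^-1 *: (ord_elt i y0 + (- c) *: o).
    by rewrite HE // E -kE scaleNr addrK scalerA mulVf // scale1r.
  apply: reachableZ.
    by rewrite vge_leq // (nvalV hK) // vg start //; clear; lia.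
  apply: reachableD; first by apply: reachH; rewrite (ltn_trans iN).
  by apply: reachableZ => //; rewrite (vgeN uK).
move=> y /(iffLR (ob_int _)) y_int; rewrite (decomp y).
apply: reachableD; last exact: reachableZ.
elim/big_ind: _ => [|z z'|i _]; last exact: reachableZ.
- by rewrite -(scale0r o); apply: reachableZ => //; apply: vge0.
- exact: reachableD.
Qed.

End Monomial.
End Raising.
End Orders.

(** * The case where [p] divides [l]: an operator acting by degrees *)

Section Graded.
Variables (K : fieldType) (vK : K -> int) (hK : normalized_valuation vK).
Variables (V : vectType K) (v : V -> int) (p : nat) (p_prime : prime p).
Variables (hV : valued_space vK v p) (dimV : \dim {:V} = p).
Hypothesis v_onto : forall m, exists2 y, y != 0 & v y = m.
Variables (pi : K) (pi0 : pi != 0) (vpi : vK pi = 1).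
Hypothesis int_unit : forall m : int, ~~ (p%:Z %| m)%Z -> m%:~R != 0 :> K /\ vK m%:~R = 0.
Hypothesis int_nonunit : forall m : int, (p%:Z %| m)%Z -> vge vK 1 m%:~R.
Variables (w : V -> V) (c : K).
Hypotheses (w_lin : linear w) (c0 : c != 0) (vc : vK c = 0).
Hypothesis w_graded : forall y, y != 0 ->
  vge v (v y + 1) (w y - ((v y)%:~R * c) *: y).
Implicit Types d : 'I_p -> K.
Let uV := valued_ultra hV.
Let uK := nval_ultra hK.
Let p_gt0 := prime_gt0 p_prime.
Let c_int : vge vK 0 c. Proof. by rewrite vge_leq // vc. Qed.
Let sc_int (s : int) : vge vK 0 (s%:~R * c).
Proof. by rewrite -[0]addr0; apply: (vgeM hK) => //; apply: vge_int. Qed.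

Let w_ge n y : vge v n y -> vge v n (w y).
Proof.
have [->|y0] := eqVneq y 0; first by rewrite (lin0 w_lin).
rewrite vgeE // => ny; rewrite -(subrK ((v y)%:~R * c *: y) (w y)).
apply: (vgeD uV); first by apply: vge_trans (w_graded y0); move: ny; clear; lia.
by apply: (vgeZ0 hV) => //; apply: vge_leq.
Qed.

Let iter_w_ge i n y : vge v n y -> vge v n (iter i w y).
Proof. by move=> ny; elim: i => //= i; apply: w_ge. Qed.

(** The polynomial with coefficients [d] at [s c], the residual eigenvalue of [w] in degree [s]. *)
Definition graded_eval (d : 'I_p -> K) (s : int) : K := \sum_i d i * (s%:~R * c) ^+ i.

Let iter_cong (s m : int) y : vge v m (w y - (s%:~R * c) *: y) ->
  forall i, vge v m (iter i w y - (s%:~R * c) ^+ i *: y).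
Proof.
move=> wy; elim=> [|i IHi] /=; first by rewrite expr0 scale1r subrr vge0.
have -> : w (iter i w y) - (s%:~R * c) ^+ i.+1 *: y =
   w (iter i w y - (s%:~R * c) ^+ i *: y) + (s%:~R * c) ^+ i *: (w y - (s%:~R * c) *: y).
  by rewrite (linB w_lin) (linZ w_lin) scalerBr scalerA -exprSr addrA subrK.
by apply: (vgeD uV); [apply: w_ge | apply: (vgeZ0 hV) => //; apply: vgeX].
Qed.

Let pw_cong (s m : int) d y : (forall i, vge vK 0 (d i)) ->
  vge v m (w y - (s%:~R * c) *: y) -> vge v m (pw w d y - graded_eval d s *: y).
Proof.
move=> d0 wy; rewrite /pw /graded_eval scaler_suml -sumrB; apply: (vge_sum uV) => i _.
by rewrite -scalerA -scalerBr; apply: (vgeZ0 hV) => //; apply: iter_cong.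
Qed.

(* The [s c], for [s < p], are distinct in the residue field. *)
Let eval_nonzero d : (forall i, vge vK 0 (d i)) ->
  (forall s : 'I_p, vge vK 1 (graded_eval d s%:Z)) -> forall i, vge vK 1 (d i).
Proof.
move=> d0 ds i; pose A := Vandermonde p (\row_(s < p) ((s : nat)%:Z%:~R * c)).
have A0 k s : vge vK 0 (A k s) by rewrite !mxE; apply: vgeX.
have detA : \det A != 0 /\ vK (\det A) = 0.
  rewrite det_Vandermonde.
  have [u0 u] : (forall s k : 'I_p, (s < k)%N ->
      (\row_(s < p) ((s : nat)%:Z%:~R * c)) 0 k - (\row_(s < p) ((s : nat)%:Z%:~R * c)) 0 s != 0) /\
      (forall s k : 'I_p, (s < k)%N -> vK
      ((\row_(s < p) ((s : nat)%:Z%:~R * c)) 0 k - (\row_(s < p) ((s : nat)%:Z%:~R * c)) 0 s) = 0).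
    apply: all_and2 => s; apply: all_and2 => k; apply: all_and2 => sk.
    rewrite !mxE -mulrBl -intrB; have [|m0 vm] := int_unit (m := (k : nat)%:Z - (s : nat)%:Z).
      by rewrite subzn ?(ltnW sk) // dvdzE /= gtnNdvd ?subn_gt0 // (leq_ltn_trans (leq_subr _ _)).
    by rewrite mulf_neq0 // (valM hK) // vm vc.
  have inner (s : 'I_p) : \prod_(k < p | (s < k)%N) ((\row_(s < p) ((s : nat)%:Z%:~R * c)) 0 k -
      (\row_(s < p) ((s : nat)%:Z%:~R * c)) 0 s) != 0.
    by apply/prodf_neq0 => k; apply: u0.
  split; first by apply/prodf_neq0.
  rewrite (nval_prod hK) // big1 // => s _; rewrite (nval_prod hK) ?big1 // => k; first exact: u.
  exact: u0.
have E : \sum_(s < p) graded_eval d s%:Z * \adj A s i = \det A * d i.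
  have /(congr1 (fun M : 'M_p => ((\row_k d k) *m M) 0 i)) := mul_mx_adj A.
  rewrite mulmxA scalar_mxC mul_scalar_mx !mxE => <-; apply: eq_bigr => s _; congr (_ * _).
  by rewrite !mxE; apply: eq_bigr => k _; rewrite !mxE.
have : vge vK 1 (\det A * d i).
  rewrite -E; apply: (vge_sum uK) => s _; rewrite -[1]addr0; apply: (vgeM hK) => //.
  rewrite !mxE /cofactor -[0]addr0; apply: (vgeM hK).
    by apply: (vgeX hK); rewrite vge_leq // nvalN1.
  apply: (vge_sum uK) => t _; rewrite -[0]addr0; apply: (vgeM hK).
    by apply: (vgeX hK); rewrite vge_leq // nvalN1.
  by apply: (vge_prod0 hK) => k _; rewrite !mxE; apply: (vgeX hK).
have [->|di0] := eqVneq (d i) 0; first by rewrite vge0.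
case: detA => A0' vA; rewrite !vgeE ?mulf_neq0 // (valM hK) // vA add0r.
by [].
Qed.

(* Some shift by a multiple of [p]: a polynomial in [w] with minimal coefficient *)
(* valuation [m] lowers some class of valuations modulo [p] by exactly [- p m].   *)
Lemma graded_step d i : (exists s : int, exists m, [/\ m <= vK (d i) &
  forall y, y != 0 -> (p%:Z %| v y - s)%Z -> pw w d y != 0 /\ v (pw w d y) = v y + p%:Z * m]) \/
  d i = 0.
Proof.
have [di0|di0] := eqVneq (d i) 0; [by right | left].
case: (@arg_minP _ _ _ i (fun k => d k != 0) (fun k => vK (d k)) di0) => k dk0 kmin.
pose m := vK (d k); have [t t0 vt] := val_onto hK m.
pose d' j := t^-1 * d j; have tV := nvalV hK t0.
have d'0 j : vge vK 0 (d' j).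
  have [dj0|dj0] := eqVneq (d j) 0; first by rewrite /d' dj0 mulr0 vge0.
  rewrite vge_leq // (valM hK) ?invr_eq0 // tV vt.
  by rewrite addrC subr_ge0 kmin.
have [s sN] : exists s : 'I_p, ~~ vge vK 1 (graded_eval d' s%:Z).
  apply: contrapT => nex; have : vge vK 1 (d' k).
    apply: eval_nonzero => // s; apply: contrapT => /negP Ns.
    by apply: nex; exists s.
  by rewrite vgeE ?mulf_neq0 ?invr_eq0 // (valM hK) ?invr_eq0 // tV vt /m addrC subrr.
exists s%:Z, m; split; first exact: kmin.
move=> y y0 sy.
have cong : vge v (v y + 1) (w y - (s%:Z%:~R * c) *: y).
  have -> : w y - (s%:Z%:~R * c) *: y =
      (w y - ((v y)%:~R * c) *: y) + ((v y - s%:Z)%:~R * c) *: y.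
    by rewrite intrB mulrBl scalerBl addrA subrK.
  apply: (vgeD uV); first exact: w_graded.
  apply: (@vge_trans _ _ _ (p%:Z * 1 + v y)); first by have := p_gt0; clear; lia.
  apply: (vgeZ hV); last exact: vge_leq.
  by rewrite -[1]addr0; apply: (vgeM hK) => //; apply: int_nonunit.
have {cong}cong := pw_cong d'0 cong.
have [q0 q1] := vge_nearby sN.
have ev0 : vge vK 0 (graded_eval d' s%:Z).
  apply: (vge_sum uK) => j _; rewrite -[0]addr0; apply: (vgeM hK) => //.
  exact: (vgeX hK).
have vq : vK (graded_eval d' s%:Z) = 0 by move: ev0 q1; rewrite vgeE //; move: (vK _); clear; lia.
have z0 : graded_eval d' s%:Z *: y != 0 by rewrite scaler_eq0 negb_or q0.
have vz : v (graded_eval d' s%:Z *: y) = v y by rewrite (valuedZ hV) // vq mulr0 add0r.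
have [|z1 vz1] := val_sub_dom uV z0 (y := pw w d' y); first by rewrite vz.
have pwE : pw w d y = t *: pw w d' y.
  by rewrite -pwZ; apply: eq_bigr => j _; rewrite /d' mulVKf.
rewrite pwE scaler_eq0 negb_or t0 z1; split=> //.
by rewrite (valuedZ hV) // vz1 vz vt addrC.
Qed.

(** If a coefficient is not integral, [graded_step] lowers a whole class of valuations modulo [p] by
    at least [p], and the representative of this class in [0, p) leaves the integers. *)
Lemma graded_preserve d :
  (forall y, vge v 0 y -> vge v 0 (pw w d y)) <-> (forall i, vge vK 0 (d i)).
Proof.
split=> [pres i|d0 y y0]; last first.
  by apply: (vge_sum uV) => i _; apply: (vgeZ0 hV) => //; apply: iter_w_ge.
case: (graded_step d i) => [[s [m [mi step]]]|->]; last exact: vge0.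
apply: contrapT => /negP /vge_nearby[_ di].
have [y y0 vy] := v_onto (s %% p%:Z)%Z; have p0 : p%:Z != 0 by have := p_gt0; clear; lia.
have sE : s = (s %/ p%:Z)%Z * p%:Z + v y.
  by rewrite vy; apply: divz_eq.
have vy0 : 0 <= v y by rewrite vy modz_ge0.
have vyp : v y < p%:Z by rewrite vy ltz_pmod // ltz_nat.
have [|z0 vz] := step y y0; first by apply/dvdzP; exists (- (s %/ p%:Z)%Z); rewrite mulNr {1}sE opprD addrCA subrr addr0.
have := pres y; rewrite !vgeE // => /(_ vy0); rewrite vz.
have m0 : m + 1 <= 0 by move: mi di; clear; lia.
by have := mulr_ge0_le0 (isT : 0 <= p%:Z) m0; move: vyp; clear; lia.
Qed.

(** The lowering in [graded_step] stays within one class modulo [p], so it can be iterated. This is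
    what excludes larger orders. *)
Lemma graded_unbounded d i : ~~ vge vK 0 (d i) -> exists2 y, y != 0 &
  forall k : nat, exists k', ~~ vge v (- k%:Z) (iter k' (pw w d) y).
Proof.
case: (graded_step d i) => [[s [m [mi step]]]|->]; last by rewrite vge0.
move=> /vge_nearby[_ di]; have [y y0 vy] := v_onto s; exists y => // k.
have H k' : iter k' (pw w d) y != 0 /\ v (iter k' (pw w d) y) = v y + p%:Z * m * k'%:Z.
  elim: k' => [|k' [z0 vz]] /=; first by rewrite mulr0 addr0.
  have [|z1 vz1] := step _ z0; last by split=> //; rewrite vz1 vz; clear; lia.
  by rewrite vz vy addrAC subrr add0r -mulrA dvdz_mulr.
have pm : p%:Z * m <= -1.
  have m0 : m + 1 <= 0 by move: mi di; clear; lia.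
  by have := mulr_ge0_le0 (isT : 0 <= p%:Z) m0; have := p_gt0; clear; lia.
pose k' := (`|v y| + k + 1)%N; exists k'; have [z0 vz] := H k'.
rewrite vgeE // vz -ltNge; have : p%:Z * m * k'%:Z <= -1 * k'%:Z by apply: ler_wpM2r.
by rewrite /k'; clear; lia.
Qed.

Let D (s : int) y := w y - (s%:~R * c) *: y.

Let D_ge s y : vge v s y -> vge v (s + 1) (D s y).
Proof.
have [->|y0] := eqVneq y 0; first by rewrite /D (lin0 w_lin) scaler0 subrr !vge0.
rewrite vgeE // le_eqVlt => /orP[/eqP->|lt]; first exact: w_graded.
have ny : vge v (s + 1) y by rewrite vgeE // lezD1.
by apply: (vgeB uV); [apply: w_ge | apply: (vgeZ0 hV)].
Qed.

Let D_keep (r s : int) y : ~~ (p%:Z %| r - s)%Z -> y != 0 -> v y = r ->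
  D s y != 0 /\ v (D s y) = r.
Proof.
move=> rs y0 vy; have [m0 vm] := int_unit rs.
have z0 : ((r - s)%:~R * c) *: y != 0 by rewrite scaler_eq0 negb_or mulf_neq0.
have vz : v (((r - s)%:~R * c) *: y) = r by rewrite (valuedZ hV) ?mulf_neq0 // (valM hK) // vm vc addr0 mulr0 add0r.
rewrite -vz; apply: (val_sub_dom uV) => //; rewrite vz /D -addrA -opprD -scalerDl -mulrDl.
by rewrite -intrD addrCA subrr addr0 -vy; apply: w_graded.
Qed.

Let D_comm s t y : D s (D t y) = D t (D s y).
Proof.
rewrite /D !(linB w_lin) !(linZ w_lin) !scalerBr !scalerA [_ * c * (_ * c)]mulrC.
by rewrite !opprB addrACA [RHS]addrACA; congr (_ + _); rewrite addrC.
Qed.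

(** Apply [D s] for s = r + 1, ..., r + p - 1 to a vector of valuation [r]: no factor changes the
    valuation, as [s - r] is prime to [p]. A final [D r] commutes to the front, lifts to [r + 1],
    and each [D s] then lifts by one more. *)
Let eigen (r : nat) : (r < p)%N -> exists x, [/\ x != 0, v x = r%:Z &
  vge v p%:Z (w x - (r%:Z%:~R * c) *: x)].
Proof.
move=> rp; have [y y0 vy] := v_onto r%:Z.
pose X k := foldr (fun s z => D s%:Z z) y (rev (iota r.+1 k)).
have XS k : X k.+1 = D (r + k.+1)%N%:Z (X k).
  by rewrite /X -[Y in iota _ Y]addn1 iotaD rev_cat /= addSnnS.
have XD k : vge v (r + k.+1)%N%:Z (D r%:Z (X k)).
  elim: k => [|k IHk]; first by rewrite addn1 -addn1; apply: D_ge; rewrite vge_leq // vy.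
  by rewrite XS D_comm addnS -addn1 PoszD; apply: D_ge.
have Xv k : (k < p)%N -> X k != 0 /\ v (X k) = r%:Z.
  elim: k => [|k IHk] kp //; have [z0 vz] := IHk (ltnW kp).
  rewrite XS; apply: D_keep => //; rewrite -opprB dvdzE abszN -dvdzE PoszD.
  by rewrite addrAC subrr add0r dvdzE /= gtnNdvd.
have [|x0 vx] := Xv p.-1; first by rewrite prednK.
exists (X p.-1); split=> //; apply: vge_trans (XD p.-1).
by rewrite prednK // lez_nat leq_addl.
Qed.

(** The vector is the sum of one approximate eigenvector per residual eigenvalue. An integral
    polynomial that kills it modulo the maximal ideal vanishes residually at all [p] eigenvalues, so
    its coefficients lie in the maximal ideal. *)
Lemma graded_cyclic : exists2 x, vge v 0 x & forall y, exists2 d : 'I_p -> K, y = pw w d x &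
  vge v 0 y -> forall i, vge vK 0 (d i).
Proof.
have [x xP] := choice (fun r : 'I_p => eigen (ltn_ord r)).
have x_bounds r : 0 <= v (x r) < p%:Z by have [_ -> _] := xP r; rewrite ltz_nat ltn_ord.
have x_neq0 r : x r != 0 by have [] := xP r.
have x_inj r s : r != s -> v (x r) != v (x s).
  have [_ -> _] := xP r; have [_ -> _] := xP s; apply: contra => /eqP[E].
  exact/eqP/val_inj.
have x_int := vge_coord hV dimV x_neq0 x_bounds x_inj.
have x_basis := integral_basis hV dimV x_neq0 x_bounds x_inj.
pose z := \sum_r x r.
have low d : (forall i, vge vK 0 (d i)) -> vge v p%:Z (pw w d z) -> forall i, vge vK 1 (d i).
  move=> d0 pz; apply: eval_nonzero => // s.
  have {pz} : vge v p%:Z (\sum_(r < p) graded_eval d r%:Z *: x r).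
    rewrite -[X in vge _ _ X](subKr (pw w d z)); apply: (vgeB uV) => //.
    rewrite (lin_sum _ _ _ (pw_lin w_lin d)) -sumrB; apply: (vge_sum uV) => r _.
    by apply: pw_cong => //; have [] := xP r.
  rewrite -[p%:Z]mulr1 x_int => /(_ s).
  by rewrite (coord_uniq (fun r : 'I_p => graded_eval d r%:Z) x_basis).
have scale d i : d i != 0 -> vge v (p%:Z * (vK (d i) + 1)) (pw w d z) ->
    exists j, vK (d j) < vK (d i) /\ d j != 0.
  move=> di0 pz; apply: contrapT => nex; have [t t0 vt] := val_onto hK (vK (d i)).
  have tV : vK t^-1 = - vK (d i) by rewrite (nvalV hK) // vt.
  have H j : vge vK 0 (t^-1 * d j).
    have [->|dj0] := eqVneq (d j) 0; first by rewrite mulr0 vge0.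
    rewrite vge_leq // (valM hK) ?invr_eq0 // tV; apply: contrapT => lt.
    by apply: nex; exists j; split=> //; move: lt; clear; lia.
  have : vge vK 1 (t^-1 * d i).
    apply: (low (fun j => t^-1 * d j)) => //; rewrite pwZ.
    have -> : p%:Z = p%:Z * - vK (d i) + p%:Z * (vK (d i) + 1) :> int by ring.
    by apply: (vgeZ hV) => //; rewrite vge_leq // tV.
  by rewrite vgeE ?mulf_neq0 ?invr_eq0 // (valM hK) ?invr_eq0 // tV addrC subrr.
have int_d d : vge v 0 (pw w d z) -> forall i, vge vK 0 (d i).
  move=> z0 i; apply: contrapT => /negP Ni; have [di0 _] := vge_nearby Ni.
  case: (@arg_minP _ _ _ i (fun k => d k != 0) (fun k => vK (d k)) di0) => k dk0 kmin.
  have lt : vK (d k) < 0 by have := kmin i di0; have [_] := vge_nearby Ni; clear; lia.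
  have [] := scale d k dk0; last by move=> j [+ /kmin]; clear; lia.
  by apply: vge_trans z0; apply: mulr_ge0_le0 => //; move: lt; clear; lia.
exists z; first by apply: (vge_sum uV) => r _; rewrite vge_leq //; have /andP[] := x_bounds r.
have b_basis : basis_of {:V} [tuple iter i w z | i < p].
  rewrite basisEfree subvf size_tuple dimV leqnn !andbT.
  apply/freeP => d d0 i; apply/eqP/contraT => di0.
  have {}d0 : pw w d z = 0.
    by rewrite -[RHS]d0; apply: eq_bigr => j _; rewrite -tnth_nth tnth_mktuple.
  case: (@arg_minP _ _ _ i (fun k => d k != 0) (fun k => vK (d k)) di0) => k dk0 kmin.
  have [] := scale d k dk0; last by move=> j [+ /kmin]; clear; lia.
  by rewrite d0 vge0.
move=> y; exists (fun i => coord [tuple iter i w z | i < p] i y).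
  exact: (basis_decomp b_basis y).
by rewrite {1}(basis_decomp b_basis y) => /int_d.
Qed.

End Graded.

(** * Totally ramified extensions and first-order action of [sigma] *)

Section TotallyRamified.
Variables (K : fieldType) (vK : K -> int) (hK : normalized_valuation vK).
Variables (E : splittingFieldType K) (v : E -> int) (hv : normalized_valuation v).
Variables (d : nat) (d_gt0 : (0 < d)%N) (dimE : \dim {:E} = d).
Hypothesis ram : forall c : K, c != 0 -> v c%:A = d%:Z * vK c.
Let uE := nval_ultra hv.

Lemma scale_alg (c : K) (x : E) : c *: x = c%:A * x.
Proof. by rewrite -scalerAl mul1r. Qed.

Lemma alg_neq0 (c : K) : c != 0 -> c%:A != 0 :> E.
Proof. by move=> c0; rewrite scaler_eq0 negb_or c0 oner_neq0. Qed.

Lemma ramified_space : valued_space vK v d.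
Proof.
split=> // c x c0 x0; rewrite scale_alg (valM hv) ?ram //.
exact: alg_neq0.
Qed.

Section Uniformizer.
Variables (Pi : E) (Pi0 : Pi != 0) (vPi : v Pi = 1).

Lemma val_Pi i : v (Pi ^+ i) = i%:Z.
Proof. by rewrite (nvalX hv) // vPi mulr1. Qed.

Lemma Pi_orthogonal (i j : 'I_d) : i != j -> ~~ (d%:Z %| v (Pi ^+ i) - v (Pi ^+ j))%Z.
Proof.
move=> ij; rewrite !val_Pi; apply: contra ij => /dvdzP[k kE].
have := ltn_ord i; have := ltn_ord j; move=> jd id; apply/eqP/val_inj => /=.
have k0 : k = 0 by move: (nat_of_ord i) (nat_of_ord j) id jd kE => m n; clear; nia.
by move: kE; rewrite k0; clear; lia.
Qed.

Lemma Pi_expansion y n : vge v n y -> exists c : 'I_d -> K,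
  y = \sum_i c i *: Pi ^+ i /\ forall i, vge v n (c i *: Pi ^+ i).
Proof.
have Pn0 (i : 'I_d) : Pi ^+ i != 0 by rewrite expf_neq0.
have bb := orthogonal_basis ramified_space dimE Pn0 Pi_orthogonal.
move=> ny; have yE := basis_decomp bb y.
exists (fun i => coord [tuple Pi ^+ i | i < d] i y); split=> // i.
rewrite yE in ny; exact: (vge_orthogonal ramified_space Pn0 Pi_orthogonal ny).
Qed.

(** In the expansion of an integral element in powers of [Pi], only the constant term can have
    valuation 0. *)
Lemma residue_field y : vge v 0 y -> exists k : K, vge v 1 (y - k%:A).
Proof.
move=> /Pi_expansion[c [yE cE]]; exists (c (Ordinal d_gt0)).
rewrite yE (bigD1 (Ordinal d_gt0)) //= expr0 addrAC subrr add0r.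
apply: (vge_sum uE) => i i0; have [->|ci0] := eqVneq (c i) 0; first by rewrite scale0r vge0.
have := cE i; rewrite !vgeE ?scaler_eq0 ?negb_or ?ci0 ?expf_neq0 //.
rewrite (valuedZ ramified_space) ?expf_neq0 // val_Pi.
have : i != 0%N :> nat by apply: contra i0 => /eqP i0; apply/eqP/val_inj.
have := ltn_ord i; move: (nat_of_ord i) (vK _) => m k; clear => md m0 H.
have k0 : 0 <= k by nia.
by have := mulr_ge0 (isT : 0 <= d%:Z) k0; lia.
Qed.

Section Invariance.
Variable g : gal_of {:E}.

Lemma gal_alg (k : K) : g k%:A = k%:A.
Proof. by rewrite linearZ rmorph1. Qed.

(* The powers of an integral element lie in a finitely generated module, so     *)
(* their conjugates have bounded denominators.                                 *)
Lemma gal_integral y : vge v 0 y -> vge v 0 (g y).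
Proof.
move=> y0; apply: contrapT => /negP /vge_nearby[gy0 gyv].
pose B := (\sum_(i < d) `|v (g (Pi ^+ i))|)%N.
have bnd k : vge v (- B%:Z) (g (y ^+ k)).
  have [c [-> cE]] := Pi_expansion (vgeX hv k y0).
  rewrite linear_sum; apply: (vge_sum uE) => i _; rewrite linearZ /=.
  have [->|ci0] := eqVneq (c i) 0; first by rewrite scale0r vge0.
  have Pn0 : Pi ^+ i != 0 by rewrite expf_neq0.
  have gPn0 : g (Pi ^+ i) != 0 by rewrite fmorph_eq0.
  have := cE i; rewrite !vgeE ?scaler_eq0 ?negb_or ?ci0 //.
  rewrite !(valuedZ ramified_space) // val_Pi.
  have := ltn_ord i; have : (`|v (g (Pi ^+ i))| <= B)%N.
    by rewrite /B (bigD1 i) //= leq_addr.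
  move: (v (g (Pi ^+ i))) (vK (c i)) (nat_of_ord i) d_gt0 => a b m d0 aB md H.
  have b0 : 0 <= b by nia.
  have := mulr_ge0 (isT : 0 <= d%:Z) b0; move: aB H; clear; lia.
have := bnd B.+1; rewrite rmorphXn vgeE ?expf_neq0 // (nvalX hv) //.
by move: (B) (v (g y)) gyv => b a; clear; nia.
Qed.

(** Up to a unit [y ^+ d] lies in [K], and automorphisms preserve units, being integral on a unit
    and on its inverse. *)
Lemma val_gal y : v (g y) = v y.
Proof.
have [->|y0] := eqVneq y 0; first by rewrite rmorph0.
have unit_inv u : u != 0 -> v u = 0 -> v (g u) = 0.
  move=> u0 vu; have gu0 : g u != 0 by rewrite fmorph_eq0.
  have A : 0 <= v (g u) by rewrite -vgeE // gal_integral // vge_leq ?vu.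
  have : vge v 0 (g u^-1) by rewrite gal_integral // vge_leq // (nvalV hv) // vu.
  rewrite fmorphV vgeE ?invr_eq0 // (nvalV hv) // oppr_ge0 => B.
  by apply: le_anti; rewrite A B.
have [k k0 vk] := val_onto hK (v y).
have gy0 : g y != 0 by rewrite fmorph_eq0.
have := unit_inv (y ^+ d / k%:A); rewrite rmorphM fmorphV rmorphXn /= gal_alg.
rewrite !(valM hv) ?invr_eq0 ?mulf_neq0 ?expf_neq0 ?alg_neq0 ?invr_eq0 ?alg_neq0 //.
rewrite (nvalV hv) ?alg_neq0 // ram // !(nvalX hv) // vk subrr => /(_ isT erefl) /eqP.
by rewrite subr_eq0 => /eqP/mulfI; apply; rewrite eqz_nat -lt0n.
Qed.

Lemma vge_gal n y : vge v n (g y) = vge v n y.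
Proof. by rewrite /vge val_gal fmorph_eq0. Qed.

End Invariance.

Section Jump.
Variables (sigma : gal_of {:E}) (t : nat) (t_gt0 : (0 < t)%N).
Hypothesis sigma_jump : forall y, vge v 0 y -> vge v t.+1%:Z (sigma y - y).
Hypothesis sigma_jump_max : exists2 y, vge v 0 y & ~~ vge v t.+2%:Z (sigma y - y).

Definition theta := sigma Pi / Pi - 1.

Let L (y : E) := sigma y / y.
(** Says that [sigma y / y] is [1 + m theta] to first order. As [t > 0] makes the square of [theta]
    negligible, both sides are multiplicative, and it suffices to treat [Pi] and the units. *)
Let Q (y : E) (m : int) := vge v t.+1%:Z (L y - 1 - m%:~R * theta).

Let theta_ge : vge v t%:Z theta.
Proof.
have -> : theta = (sigma Pi - Pi) / Pi by rewrite mulrBl divff.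
rewrite (_ : t%:Z = t.+1%:Z + -1); last by clear; lia.
apply: (vgeM hv); first by apply: sigma_jump; rewrite vge_leq ?vPi.
by rewrite vge_leq // (nvalV hv) // vPi.
Qed.

Let int_ge (m : int) : vge v 0 (m%:~R : E). Proof. exact: vge_int. Qed.

Let intM_ge (m : int) n x : vge v n x -> vge v n (m%:~R * x).
Proof. by move=> nx; rewrite -[n]add0r; apply: (vgeM hv). Qed.

Let theta2_ge : vge v t.+1%:Z (theta * theta).
Proof.
by apply: vge_trans (vgeM hv theta_ge theta_ge); move: t_gt0; clear; lia.
Qed.

Let L_ge y : y != 0 -> vge v 0 (L y).
Proof.
move=> y0; have sy0 : sigma y != 0 by rewrite fmorph_eq0.
by rewrite vge_leq // (valM hv) ?invr_eq0 // (nvalV hv) // val_gal subrr.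
Qed.

Let QM y y' m m' : y' != 0 -> Q y m -> Q y' m' -> Q (y * y') (m + m').
Proof.
move=> y'0 Qy Qy'; rewrite /Q.
have -> : L (y * y') - 1 - (m + m')%:~R * theta =
   (L y - 1 - m%:~R * theta) * L y' + (1 + m%:~R * theta) * (L y' - 1 - m'%:~R * theta)
   + (m * m')%:~R * (theta * theta).
  have -> : L (y * y') = L y * L y' by rewrite /L rmorphM invfM mulrACA.
  by move: (L y) (L y') theta => a b c; rewrite intrD intrM; ring.
apply: (vgeD uE); last exact: intM_ge.
apply: (vgeD uE); first by rewrite -[_%:Z]addr0; apply: (vgeM hv) => //; apply: L_ge.
rewrite -[_%:Z]add0r; apply: (vgeM hv) => //; apply: (vgeD uE); first by rewrite vge_leq ?(nval1 hv).
by apply/intM_ge/vge_trans/theta_ge.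
Qed.

Let QV y m : y != 0 -> Q y m -> Q y^-1 (- m).
Proof.
move=> y0 Qy; rewrite /Q; have y'0 : y^-1 != 0 by rewrite invr_eq0.
have LL : L y * L y^-1 = 1.
  by rewrite /L fmorphV mulrACA mulfV ?fmorph_eq0 // mulfV ?invr_eq0 // mulr1.
have -> : L y^-1 - 1 - (- m)%:~R * theta =
  L y^-1 * (- (L y - 1 - m%:~R * theta) * (1 - m%:~R * theta)
            + (m * m)%:~R * (theta * theta)).
  have -> : - (L y - 1 - m%:~R * theta) * (1 - m%:~R * theta) + (m * m)%:~R * (theta * theta)
     = 1 - L y * (1 - m%:~R * theta).
    by move: (L y) theta => a c; rewrite intrM; ring.
  move: (L y) (L y^-1) LL => a b ab.
  by rewrite (mulrBr b) mulr1 (mulrA b) (mulrC b a) ab mul1r mulrNz mulNr; ring.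
rewrite -[_%:Z]add0r; apply: (vgeM hv); first exact: L_ge.
apply: (vgeD uE); last exact: intM_ge.
rewrite -[_%:Z]addr0; apply: (vgeM hv); first by rewrite (vgeN uE).
apply: (vgeB uE); first by rewrite vge_leq ?(nval1 hv).
by apply/intM_ge/vge_trans/theta_ge.
Qed.

Let Q_nat y (n : nat) : y != 0 -> v y = n -> Q y n.
Proof.
move=> y0 vy; pose u := y / Pi ^+ n.
have u0 : u != 0 by rewrite mulf_neq0 ?invr_eq0 ?expf_neq0.
have vu : v u = 0 by rewrite (valM hv) ?invr_eq0 ?expf_neq0 // (nvalXV hv) // vy vPi; clear; lia.
have Qu : Q u 0.
  rewrite /Q mul0r subr0 (_ : L u - 1 = (sigma u - u) / u); last by rewrite mulrBl divff.
  rewrite -[_%:Z]addr0; apply: (vgeM hv); first by apply: sigma_jump; rewrite vge_leq ?vu.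
  by rewrite vge_leq // (nvalV hv) // vu.
have QPi k : Q (Pi ^+ k) k.
  elim: k => [|k IHk].
    by rewrite /Q /L expr0 rmorph1 divr1 mul0r subrr subr0 vge0.
  rewrite exprSr -addn1 PoszD; apply: QM => //.
  by rewrite /Q mul1r /L subrr vge0.
by rewrite -[y](divfK (expf_neq0 n Pi0)) -[n%:Z]add0r; apply: QM; rewrite ?expf_neq0.
Qed.

Let Q_int y : y != 0 -> Q y (v y).
Proof.
move=> y0; case vyE : (v y) => [n|n]; first exact: Q_nat.
have vE : v y^-1 = n.+1%:Z by rewrite (nvalV hv) // vyE NegzE opprK.
have yV0 : y^-1 != 0 by rewrite invr_eq0.
by have := QV yV0 (Q_nat yV0 vE); rewrite invrK NegzE.
Qed.

(** On the graded ring [sigma - 1] multiplies degree n by n [theta]; every exact valuation below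
    rests on this. *)
Lemma sigma_derivation y : y != 0 ->
  vge v (v y + t.+1%:Z) (sigma y - y - (v y)%:~R * theta * y).
Proof.
move=> y0; have := vgeM hv (Q_int y0) (vge_leq (lexx (v y))).
by rewrite addrC !mulrBl mul1r divfK.
Qed.

(** Were the valuation of [theta] larger, then subtracting a constant of [K], which [sigma] fixes,
    would show that [sigma - 1] sends all integers to valuation at least [t + 2]. *)
Lemma theta_val : theta != 0 /\ v theta = t.
Proof.
suff N : ~~ vge v t.+1%:Z theta.
  have [th0 lt] := vge_nearby N; split=> //.
  by have := theta_ge; rewrite vgeE //; move: lt; clear; lia.
apply/negP => th; have [y y_int /negP[]] := sigma_jump_max.
have [k kE] := residue_field y_int; rewrite -[y](subrK k%:A).
move: (y - _) kE => u u1; rewrite rmorphD /= gal_alg opprD addrACA subrr addr0.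
have [->|u0] := eqVneq u 0; first by rewrite rmorph0 subrr vge0.
rewrite vgeE // in u1.
rewrite -[sigma u - u](subrK ((v u)%:~R * theta * u)); apply: (vgeD uE).
  by apply: vge_trans (sigma_derivation u0); move: u1; clear; lia.
rewrite -mulrA; apply: intM_ge; apply: vge_trans (vgeM hv th (vge_leq (lexx (v u)))).
by move: u1; clear; lia.
Qed.

Lemma sigma_raises n y : vge v n y -> vge v (n + t%:Z) (sigma y - y).
Proof.
have [->|y0] := eqVneq y 0; first by rewrite rmorph0 subrr !vge0.
rewrite vgeE // => ny; rewrite -[sigma y - y](subrK ((v y)%:~R * theta * y)); apply: (vgeD uE).
  by apply: vge_trans (sigma_derivation y0); move: ny; clear; lia.
rewrite -mulrA; apply: intM_ge; apply: vge_trans (vgeM hv theta_ge (vge_leq (lexx (v y)))).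
by move: ny; clear; lia.
Qed.

Lemma sigma_iter_raises c n y : vge v n y -> vge v (n + t%:Z) (iter c sigma y - y).
Proof.
move=> ny; elim: c => [|c IHc] /=; first by rewrite subrr vge0.
have -> : sigma (iter c sigma y) - y = sigma (iter c sigma y - y) + (sigma y - y).
  by rewrite rmorphB /= addrA subrK.
by apply: (vgeD uE); [rewrite vge_gal | apply: sigma_raises].
Qed.

Lemma sigma_iter_derivation c y : y != 0 ->
  vge v (v y + t.+1%:Z) (iter c sigma y - y - (c%:Z * v y)%:~R * theta * y).
Proof.
move=> y0; elim: c => [|c IHc] /=; first by rewrite !mul0r subrr subr0 vge0.
have -> : sigma (iter c sigma y) - y - (c.+1%:Z * v y)%:~R * theta * y =
  (iter c sigma y - y - (c%:Z * v y)%:~R * theta * y) +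
  ((sigma (iter c sigma y - y) - (iter c sigma y - y)) + (sigma y - y - (v y)%:~R * theta * y)).
  rewrite rmorphB /= (_ : c.+1%:Z * v y = c%:Z * v y + v y); last by clear; lia.
  by rewrite intrD; ring.
apply: (vgeD uE) => //; apply: (vgeD uE); last exact: sigma_derivation.
apply: vge_trans (sigma_raises (sigma_iter_raises c (vge_leq (lexx (v y))))).
by move: t_gt0; clear; lia.
Qed.

End Jump.
End Uniformizer.
End TotallyRamified.

(** * Powers of a difference operator *)

Section IterDifference.
Variables (R : zmodType) (rho : {additive R -> R}).

Let dlt y := rho y - y.
(** The coefficient of X^i in (X - 1)^n. *)
Definition binz (n i : nat) : int := (-1) ^+ (n - i) *+ 'C(n, i).

Lemma binzS n i : (i <= n)%N -> binz n.+1 i.+1 = binz n i - binz n i.+1.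
Proof.
rewrite leq_eqVlt /binz => /orP[/eqP->|lt].
  by rewrite !binn bin_small // !subnn mulr0n subr0.
rewrite binS mulrnDr subSS addrC (_ : n - i = (n - i.+1).+1)%N; last by lia.
by rewrite exprS mulN1r !mulNrn.
Qed.

Lemma iter_difference n y : iter n dlt y = \sum_(i < n.+1) iter i rho y *~ binz n i.
Proof.
elim: n => [|n IHn]; first by rewrite big_ord1 /binz bin0 mulr1z.
have last0 : \sum_(i < n.+2) iter i rho y *~ binz n i = \sum_(i < n.+1) iter i rho y *~ binz n i.
  by rewrite big_ord_recr /= {2}/binz bin_small // mulr0n mulr0z addr0.
rewrite iterS IHn {1}/dlt -{2}last0 [in X in _ - X]big_ord_recl [RHS]big_ord_recl.
have -> : binz n.+1 (@ord0 n.+1) = - binz n 0 by rewrite /binz !bin0 !subn0 exprS mulN1r.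
rewrite raddf_sum opprD addrCA mulrNz -sumrB; congr (_ + _).
apply: eq_bigr => i _; rewrite binzS; last by rewrite -ltnS.
by rewrite raddfMz /= mulrzBr.
Qed.

Lemma sum_binz n : (0 < n)%N -> \sum_(i < n.+1) binz n i = 0.
Proof.
case: n => // n _; transitivity ((-1 + 1 : int) ^+ n.+1); last by rewrite addNr exprS mul0r.
by rewrite exprDn; apply: eq_bigr => i _; rewrite expr1n mulr1.
Qed.

(** By Pascal's rule two consecutive coefficients differ by a coefficient of (X - 1)^p, which [p]
    divides. *)
Lemma binz_prime p i : prime p -> odd p -> (i < p)%N -> (p%:Z %| binz p.-1 i - 1)%Z.
Proof.
move=> p_prime p_odd; have p_gt0 := prime_gt0 p_prime.
elim: i => [|i IHi] ip.
  rewrite /binz bin0 subn0 -signr_odd -subn1 oddB // p_odd /= expr0 subrr.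
  by apply/dvdzP; exists 0; rewrite mul0r.
have E : binz p i.+1 = binz p.-1 i - binz p.-1 i.+1.
  by rewrite -{1}(prednK p_gt0) binzS //; move: ip; clear; lia.
have -> : binz p.-1 i.+1 - 1 = (binz p.-1 i - 1) - binz p i.+1 by rewrite E; ring.
rewrite rpredB ?IHi ?(ltnW ip) // /binz -mulr_natr dvdz_mull //.
by rewrite natz dvdzE /= prime_dvd_bin.
Qed.

End IterDifference.

(** * Ramification of the dihedral extension and the action of [w] *)

Section Dihedral.
Variables (K : fieldType) (vK : K -> int) (hK : normalized_valuation vK).
Variables (E : splittingFieldType K) (v : E -> int) (hv : normalized_valuation v).
Variables (p : nat) (p_prime : prime p) (p_odd : odd p).
Hypothesis dimE : \dim {:E} = (2 * p)%N.
Hypothesis ram : forall c : K, c != 0 -> v c%:A = (2 * p)%N%:Z * vK c.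
Variables (e : nat) (e_gt0 : (0 < e)%N).
Hypothesis nat_val : forall n, (0 < n)%N -> n%:R != 0 :> K /\ vK n%:R = (e * logn p n)%N%:Z.
Let uE := nval_ultra hv.
Let uK := nval_ultra hK.
Let p_gt0 := prime_gt0 p_prime.
Let d_gt0 : (0 < 2 * p)%N. Proof. by rewrite muln_gt0. Qed.
Variables (Pi : E) (Pi0 : Pi != 0) (vPi : v Pi = 1).
Let val_gal := val_gal hK hv d_gt0 dimE ram Pi0 vPi.
Let vge_gal := vge_gal hK hv d_gt0 dimE ram Pi0 vPi.

Lemma nat_algE n : n%:R = (n%:R : K)%:A :> E.
Proof. by rewrite scaler_nat. Qed.

Lemma int_unitK (m : int) : ~~ (p%:Z %| m)%Z -> m%:~R != 0 :> K /\ vK m%:~R = 0.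
Proof.
rewrite dvdzE /= => pm; have m0 : (0 < `|m|)%N by case: m pm => [[|n]|n] //; rewrite dvdn0.
have [n0 vn] := nat_val m0; have {}vn : vK (`|m|%:R) = 0.
  by rewrite vn lognE (negPf pm) !andbF muln0.
case: m pm m0 n0 vn => m pm m0 n0 vn; first by split.
by rewrite NegzE mulrNz oppr_eq0 (nvalN hK).
Qed.

Lemma int_nonunitK (m : int) : (p%:Z %| m)%Z -> vge vK e m%:~R.
Proof.
case/dvdzP => k ->; rewrite intrM -[e%:Z]add0r; apply: (vgeM hK); first exact: vge_int.
have [p0 vp] := nat_val p_gt0; rewrite vge_leq // [vK _]vp lognE p_prime p_gt0 dvdnn /=.
by rewrite divnn p_gt0 logn1 muln1.
Qed.

Lemma int_algE (m : int) : m%:~R = (m%:~R : K)%:A :> E.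
Proof. by rewrite scaler_int. Qed.

Lemma int_unitE (m : int) : ~~ (p%:Z %| m)%Z -> m%:~R != 0 :> E /\ v m%:~R = 0.
Proof.
move=> /int_unitK[m0 vm]; rewrite int_algE alg_neq0 // ram // vm mulr0.
by [].
Qed.

Lemma p_val : p%:R != 0 :> E /\ v p%:R = (2 * p * e)%N%:Z.
Proof.
have [p0 vp] := nat_val p_gt0; rewrite nat_algE alg_neq0 // ram // vp lognE p_prime p_gt0.
by rewrite dvdnn divnn p_gt0 logn1 muln1 PoszM.
Qed.

Variables (sigma tau : gal_of {:E}).
Hypothesis sigma_p : forall y, iter p sigma y = y.
Hypothesis tau_tau : forall y, tau (tau y) = y.
Hypothesis sigma_tau : forall y, sigma (tau (sigma y)) = tau y.
Hypothesis K_fixed : forall y, sigma y = y -> tau y = y -> exists k : K, y = k%:A.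
Variables (t : nat) (t_gt0 : (0 < t)%N).
Hypothesis sigma_jump : forall y, vge v 0 y -> vge v t.+1%:Z (sigma y - y).
Hypothesis sigma_jump_max : exists2 y, vge v 0 y & ~~ vge v t.+2%:Z (sigma y - y).
Let theta := theta Pi sigma.
Let theta_val : theta != 0 /\ v theta = t :=
  theta_val hK hv d_gt0 dimE ram Pi0 vPi t_gt0 sigma_jump sigma_jump_max.
Let iter_raises c n y : vge v n y -> vge v (n + t%:Z) (iter c sigma y - y) :=
  @sigma_iter_raises _ _ hK _ _ hv _ d_gt0 dimE ram _ Pi0 vPi _ _ t_gt0 sigma_jump c n y.
Let iter_derivation c y (y0 : y != 0) :
  vge v (v y + t.+1%:Z) (iter c sigma y - y - (c%:Z * v y)%:~R * theta * y) :=
  sigma_iter_derivation hK hv d_gt0 dimE ram Pi0 vPi t_gt0 sigma_jump c y0.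

Lemma val_iter_sigma c y : v (iter c sigma y) = v y.
Proof. by elim: c => //= c IHc; rewrite val_gal. Qed.

Lemma iter_exact c y : ~~ (p %| c)%N -> y != 0 -> ~~ (p%:Z %| v y)%Z ->
  iter c sigma y - y != 0 /\ v (iter c sigma y - y) = v y + t%:Z.
Proof.
move=> pc y0 py; have [th0 vth] := theta_val.
have [m0 vm] : ((c%:Z * v y)%:~R : E) != 0 /\ v ((c%:Z * v y)%:~R : E) = 0.
  by apply: int_unitE; rewrite dvdzE abszM /= Euclid_dvdM // negb_or pc; move: py; rewrite dvdzE.
have z0 : (c%:Z * v y)%:~R * theta * y != 0 by rewrite !mulf_neq0.
have vz : v ((c%:Z * v y)%:~R * theta * y) = v y + t%:Z.
  by rewrite !(valM hv) ?mulf_neq0 // vm vth add0r addrC.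
rewrite -vz; apply: (val_sub_dom uE) => //; rewrite vz.
by apply: vge_trans (iter_derivation c y0); clear; lia.
Qed.

(** [m * tau m] lies in [K], so twice the valuation of [m] is a multiple of [2 * p]. *)
Lemma dvd_val_fixed m : m != 0 -> sigma m = m -> (p%:Z %| v m)%Z.
Proof.
move=> m0 sm; have tm0 : tau m != 0 by rewrite fmorph_eq0.
have [||k kE] := @K_fixed (m * tau m).
- have stm : sigma (tau m) = tau m by rewrite -{1}sm sigma_tau.
  by rewrite rmorphM /= sm stm.
- by rewrite rmorphM /= tau_tau mulrC.
have k0 : k != 0.
  apply: contraNneq (mulf_neq0 m0 tm0) => k0; by rewrite kE k0 scale0r.
have : v (m * tau m) = v k%:A by rewrite kE.
rewrite (valM hv) // val_gal ram // => H; apply/dvdzP; exists (vK k).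
by move: (v m) (vK k) H; clear; lia.
Qed.

Definition Tr (r : E -> E) y := \sum_(i < p) iter i r y.

(* The coefficients of [(rho - 1)^(p-1)] are congruent to 1 modulo p and sum to 0. *)
Lemma trace_split (rho : {additive E -> E}) :
  (forall i n y, vge v n y -> vge v (n + t%:Z) (iter i rho y - y)) ->
  exists2 G : E -> E,
    forall y, iter p.-1 (fun x => rho x - x) y = Tr rho y + p%:R * G y &
    forall n y, vge v n y -> vge v (n + t%:Z) (G y + y).
Proof.
move=> rho_raises.
have Hg (i : 'I_p) : exists g : int, binz p.-1 i = 1 + g * p%:Z.
  have /dvdzP[g gE] := binz_prime p_prime p_odd (ltn_ord i).
  by exists g; rewrite -gE; clear; lia.
have [g gE] := choice Hg.
have sum_g : \sum_i g i = -1.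
  have p1 : (0 < p.-1)%N by rewrite -ltnS prednK // prime_gt1.
  have := sum_binz p1; rewrite prednK // (eq_bigr _ (fun i _ => gE i)).
  rewrite big_split /= -mulr_suml sumr_const card_ord => H.
  have p0 : p%:Z != 0 by move: p_gt0; clear; lia.
  by apply: (mulIf p0); rewrite mulN1r; apply/eqP; rewrite -addr_eq0 addrC -[X in X + _]natz H.
exists (fun y => \sum_(i < p) iter i rho y *~ g i) => [y|n y ny].
  rewrite iter_difference prednK // /Tr mulr_sumr -big_split; apply: eq_bigr => i _ /=.
  by rewrite gE mulrzDr mulr1z mulrzA mulr_natl.
have -> : \sum_(i < p) iter i rho y *~ g i + y = \sum_(i < p) (iter i rho y - y) *~ g i.
  under [RHS]eq_bigr => i _ do rewrite mulrzBl.
  rewrite sumrB; congr (_ + _).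
  have -> : \sum_(i < p) y *~ g i = y *~ (\sum_(i < p) g i).
    by rewrite (big_morph (fun m => y *~ m) (mulrzDr y) (mulr0z y)).
  by rewrite sum_g mulrNz opprK.
apply: (vge_sum uE) => i _; rewrite -mulrzr mulrC -[_ + _]add0r.
by apply: (vgeM hv); [apply: vge_int | apply: rho_raises].
Qed.

Let dlt y := sigma y - y.

Let dlt_ge n y : vge v n y -> vge v (n + t%:Z) (dlt y).
Proof. by move=> ny; have := iter_raises 1 ny. Qed.

Let iter_dlt_ge i n y : vge v n y -> vge v (n + (i * t)%N%:Z) (iter i dlt y).
Proof.
move=> ny; elim: i => [|i IHi] /=; first by rewrite mul0n addr0.
by rewrite mulSn addnC PoszD addrA; apply: dlt_ge.
Qed.

Lemma Tr_fixed (rho : {additive E -> E}) y : (forall y, iter p rho y = y) ->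
  rho (Tr rho y) = Tr rho y.
Proof.
move=> rho_p; rewrite /Tr raddf_sum /= -(prednK p_gt0) big_ord_recr [RHS]big_ord_recl /=.
rewrite -iterS prednK // rho_p addrC; congr (_ + _).
Qed.

Let G_val G y : (forall n y, vge v n y -> vge v (n + t%:Z) (G y + y)) -> y != 0 ->
  G y != 0 /\ v (G y) = v y.
Proof.
move=> GP y0; have yN0 : - y != 0 by rewrite oppr_eq0.
rewrite -[RHS](ultraN uE); apply: (val_sub_dom uE) => //; rewrite opprK (ultraN uE).
by apply: vge_trans (GP _ _ (vge_leq (lexx (v y)))); move: t_gt0; clear; lia.
Qed.

(** Otherwise [p G] dominates in [trace_split], and the trace of [Pi] has valuation 2pe + 1, prime
    to [p], although [sigma] fixes it. *)
Lemma jump_bound : (p.-1 * t <= 2 * p * e)%N.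
Proof.
have [G GE GP] := trace_split iter_raises.
rewrite leqNgt; apply/negP => lt; have [p0 vp] := p_val.
have [G0 vG] := G_val GP Pi0.
have pG0 : p%:R * G Pi != 0 by rewrite mulf_neq0.
have vpG : v (- (p%:R * G Pi)) = (2 * p * e)%N%:Z + 1 by rewrite (ultraN uE) (valM hv) // vp vG vPi.
have pGN0 : - (p%:R * G Pi) != 0 by rewrite oppr_eq0.
have [|T0 vT] := val_sub_dom uE pGN0 (y := Tr sigma Pi).
  rewrite vpG opprK -GE; apply: vge_trans (iter_dlt_ge p.-1 (vge_leq (lexx (v Pi)))).
  by rewrite vPi; move: lt; clear; lia.
have := dvd_val_fixed T0 (Tr_fixed Pi sigma_p); rewrite vT vpG.
rewrite -mulnA mulnCA PoszM => /dvdzP[k kE].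
have : (p%:Z %| 1)%Z by apply/dvdzP; exists (k - (2 * e)%N%:Z); rewrite mulrBl -kE; clear; lia.
by rewrite dvdzE /= dvdn1 gtn_eqF // prime_gt1.
Qed.

(** With strict inequality the other side dominates: each difference is exact, as the valuations
    stay 1 modulo [p], so the trace of [Pi] has valuation 1 + (p-1)t, again prime to [p]. *)
Lemma jump_max : (p %| t)%N -> (p.-1 * t = 2 * p * e)%N.
Proof.
move=> pt; apply/eqP; rewrite eqn_leq jump_bound leqNgt; apply/negP => lt.
have [G GE GP] := trace_split iter_raises; have [p0 vp] := p_val.
have p1 := prime_gt1 p_prime.
have H i : iter i dlt Pi != 0 /\ v (iter i dlt Pi) = (1 + i * t)%N%:Z.
  elim: i => [|i [z0 vz]] /=; first by rewrite mul0n addn0.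
  have [||z1 vz1] := @iter_exact 1 _ _ z0; first by rewrite gtnNdvd.
    by rewrite vz dvdzE /= dvdn_addl ?dvdn_mull // gtnNdvd.
  by split=> //; rewrite [v _]vz1 vz mulSn; clear; lia.
have [z0 vz] := H p.-1.
have pG : vge v (v (iter p.-1 dlt Pi) + 1) (p%:R * G Pi).
  have [G0 vG] := G_val GP Pi0; rewrite vge_leq // (valM hv) // vp vG vPi vz.
  by move: lt; clear; lia.
have [|T0 vT] := val_sub_dom uE z0 (y := Tr sigma Pi).
  by rewrite [X in Tr _ _ - X]GE opprD addrA subrr add0r (vgeN uE).
have := dvd_val_fixed T0 (Tr_fixed Pi sigma_p); rewrite vT vz dvdzE /=.
by rewrite dvdn_addl ?dvdn_mull // gtnNdvd.
Qed.

Let sinv := iter p.-1 sigma.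
Definition udiff y := sigma y - sinv y.

Lemma sigma_sinv y : sigma (sinv y) = y.
Proof. by rewrite /sinv -iterS prednK. Qed.

Lemma sinv_sigma y : sinv (sigma y) = y.
Proof. by rewrite /sinv -iterSr prednK. Qed.

Lemma udiff_ge n y : vge v n y -> vge v (n + t%:Z) (udiff y).
Proof.
move=> ny.
have -> : udiff y = (sigma y - y) - (sinv y - y) by rewrite /udiff opprB addrA subrK.
by apply: (vgeB uE); [apply: (iter_raises 1) | apply: iter_raises].
Qed.

Lemma p_ge : vge v (2 * p * e)%N%:Z (p%:R : E).
Proof. by have [p0 vp] := p_val; rewrite vge_leq // vp. Qed.

Lemma e2_gt0 : (0 < 2 * p * e)%N. Proof. by rewrite !muln_gt0 p_gt0 e_gt0. Qed.

(** The inverse of [sigma] is its power [p.-1], so the first-order factor is 1 - (p-1), that is 2 up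
    to the negligible [p]. *)
Lemma udiff_graded y : y != 0 ->
  vge v (v y + t.+1%:Z) (udiff y - (2 * v y)%:~R * theta * y).
Proof.
move=> y0; have [th0 vth] := theta_val.
have -> : udiff y - (2 * v y)%:~R * theta * y =
  (sigma y - y - (1%:Z * v y)%:~R * theta * y) -
  (sinv y - y - (p.-1%:Z * v y)%:~R * theta * y) - p%:R * (v y)%:~R * (theta * y).
  have -> : p%:R = p.-1%:Z%:~R + 1 :> E by rewrite -[in LHS](prednK p_gt0) -natr1.
  rewrite /udiff !intrM; move: (sigma y) (sinv y) => a b; ring.
apply: (vgeB uE).
  by apply: (vgeB uE); [apply: (iter_derivation 1) | apply: (iter_derivation p.-1)].
rewrite -mulrA; apply: vge_trans (vgeM hv p_ge (vgeM hv (vge_int hv (v y))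
  (vgeM hv (vge_leq (lexx (v theta))) (vge_leq (lexx (v y)))))).
by rewrite vth; have := e2_gt0; clear; lia.
Qed.

Lemma udiff_exact y : y != 0 -> ~~ (p%:Z %| v y)%Z ->
  udiff y != 0 /\ v (udiff y) = v y + t%:Z.
Proof.
move=> y0 py; have [th0 vth] := theta_val.
have [m0 vm] : ((2 * v y)%:~R : E) != 0 /\ v ((2 * v y)%:~R : E) = 0.
  apply: int_unitE; rewrite dvdzE abszM /= Euclid_dvdM // negb_or.
  rewrite dvdzE in py; rewrite py andbT; apply/negP => /dvdn_leq => /(_ isT).
  by have := prime_gt1 p_prime; case: p p_odd => [|[|[|]]].
have z0 : (2 * v y)%:~R * theta * y != 0 by rewrite !mulf_neq0.
have vz : v ((2 * v y)%:~R * theta * y) = v y + t%:Z.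
  by rewrite !(valM hv) ?mulf_neq0 // vm vth add0r addrC.
rewrite -vz; apply: (val_sub_dom uE) => //; rewrite vz.
by apply: vge_trans (udiff_graded y0); clear; lia.
Qed.

Let rho : {additive E -> E} := sigma \o sigma.

Let rho_iter i y : iter i rho y = iter (2 * i) sigma y.
Proof. by elim: i => // i IHi; rewrite iterS IHi mulnS. Qed.

Let udiff_sigma y : udiff (sigma y) = rho y - y.
Proof. by rewrite /udiff sinv_sigma. Qed.

Let udiff_iter n y : iter n (fun x => rho x - x) y = iter n udiff (iter n sigma y).
Proof.
elim: n y => // n IHn y; rewrite iterS IHn [RHS]iterS -udiff_sigma; congr udiff.
have comm k x : iter k udiff (sigma x) = sigma (iter k udiff x).
  elim: k x => // k IHk x; rewrite !iterS IHk /udiff rmorphB /=; congr (_ - _).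
  by rewrite sinv_sigma sigma_sinv.
by rewrite iterS comm.
Qed.

(** As sigma^p = 1, the p-th power of sigma - sigma^-1 is that of sigma^2 - 1. By [trace_split] it
    is sigma^2 - 1 applied to a trace, which it kills, plus [p G]. *)
Lemma udiff_p n y : vge v n y -> vge v (n + t%:Z + (2 * p * e)%N%:Z) (iter p udiff y).
Proof.
move=> ny; have [|G GE GP] := @trace_split rho.
  by move=> i m x mx; rewrite rho_iter; apply: iter_raises.
rewrite -{1}[y]sigma_p -udiff_iter -[X in iter X _ _](prednK p_gt0) iterS GE.
have rho_p x : iter p rho x = x by rewrite rho_iter mul2n -addnn iterD !sigma_p.
rewrite mulr_natl raddfD raddfMn Tr_fixed // opprD addrACA subrr add0r -mulrnBl -[_ *+ p]mulr_natl addrC.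
apply: (vgeM hv); first exact: p_ge.
have Gn : vge v n (G y).
  rewrite -(addrK y (G y)); apply: (vgeB uE) => //.
  by apply: vge_trans (GP _ _ ny); clear; lia.
by have := iter_raises 2 Gn.
Qed.

Section FixedUniformizer.
Variables (z : E) (z0 : z != 0) (sz : sigma z = z) (tz : tau z = - z).
Hypothesis z_min : forall y, sigma y = y -> y != 0 -> 0 < v y -> v z <= v y.
Hypothesis z_gt0 : 0 < v z.

Lemma norm_sigma x : sigma (\prod_(i < p) iter i sigma x) = \prod_(i < p) iter i sigma x.
Proof.
rewrite rmorph_prod /= -(prednK p_gt0) big_ord_recr [RHS]big_ord_recl /=.
by rewrite -iterS prednK // sigma_p mulrC.
Qed.

Lemma norm_val x : x != 0 -> \prod_(i < p) iter i sigma x != 0 /\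
  v (\prod_(i < p) iter i sigma x) = p%:Z * v x.
Proof.
move=> x0; have s0 i : iter i sigma x != 0 by elim: i => //= i; rewrite fmorph_eq0.
split; first exact/prodf_neq0.
rewrite (nval_prod hv) //; under eq_bigr => i _ do rewrite val_iter_sigma.
by rewrite sumr_const card_ord -mulr_natl natz.
Qed.

(** The norm of [Pi] to the fixed field of [sigma] has valuation [p], and all valuations there are
    multiples of [p]. *)
Lemma val_z : v z = p%:Z.
Proof.
have [N0 vN] := norm_val Pi0; rewrite vPi mulr1 in vN.
have := z_min (norm_sigma Pi) N0; rewrite vN => /(_ p_gt0) le.
have /dvdzP[k kE] := dvd_val_fixed z0 sz.
move: z_gt0 le; rewrite kE; have := p_gt0; clear => *; have : k = 1 by nia.
by move=> ->; rewrite mul1r.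
Qed.

Lemma z_square : exists2 k : K, z ^+ 2 = k%:A & vK k = 1.
Proof.
have [||k kE] := @K_fixed (z ^+ 2); first by rewrite rmorphXn /= sz.
  by rewrite rmorphXn /= tz sqrrN.
exists k => //; have k0 : k != 0.
  by apply: contraNneq (expf_neq0 2 z0) => k0; rewrite kE k0 scale0r.
have : v (z ^+ 2) = v k%:A by rewrite kE.
rewrite (nvalX hv) // val_z ram //; have := p_gt0; move: (vK k); clear => m p0 H.
have : (m - 1) * p%:Z = 0 by lia.
by move=> /eqP; rewrite mulf_eq0 => /orP[/eqP|/eqP]; lia.
Qed.

Lemma sigma_iter_tau i x : iter i sigma (tau (iter i sigma x)) = tau x.
Proof. by elim: i => // i IHi; rewrite iterSr [iter i.+1 _ x]iterS sigma_tau IHi. Qed.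

Lemma tau_iter i x : (i <= p)%N -> tau x = x -> tau (iter i sigma x) = iter (p - i) sigma x.
Proof.
by move=> ip tx; rewrite -{2}tx -(sigma_iter_tau i x) -iterD subnK.
Qed.

(** The product of the [sigma]-conjugates is also fixed by [tau], which permutes its factors; being
    in [K], it makes [p * v x] a multiple of [2 * p]. *)
Lemma val_even x : x != 0 -> tau x = x -> (2%:Z %| v x)%Z.
Proof.
move=> x0 tx; have [N0 vN] := norm_val x0.
have [||k kE] := @K_fixed (\prod_(i < p) iter i sigma x); first exact: norm_sigma.
  rewrite -[RHS]norm_sigma !rmorph_prod /= [RHS](reindex_inj rev_ord_inj) /=.
  apply: eq_bigr => i _; rewrite tau_iter // ?(ltnW (ltn_ord i)) // -iterS.
  by rewrite subnSK.
have k0 : k != 0 by apply: contraNneq N0 => k0; rewrite kE k0 scale0r.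
have : v (\prod_(i < p) iter i sigma x) = v k%:A by rewrite kE.
rewrite vN ram // => H; apply/dvdzP; exists (vK k).
have p0 : p%:Z != 0 by have := p_gt0; clear; lia.
by apply: (mulfI p0); rewrite H; clear; lia.
Qed.

Definition wop y := z * udiff y.

Lemma wop_tau x : tau x = x -> tau (wop x) = wop x.
Proof.
move=> tx; rewrite /wop rmorphM /= tz /udiff rmorphB /= /sinv tau_iter ?leq_pred //.
rewrite -[sigma x]/(iter 1 sigma x) tau_iter // subn1 mulNr -mulrN opprB; congr (_ * (_ - _)).
by rewrite (_ : p - p.-1 = 1)%N //; have := p_gt0; clear; lia.
Qed.

Lemma wop_ge n y : vge v n y -> vge v (n + (p + t)%N%:Z) (wop y).
Proof.
move=> ny; rewrite PoszD addrCA; apply: (vgeM hv); last exact: udiff_ge.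
by rewrite vge_leq ?val_z.
Qed.

Lemma wop_exact y : y != 0 -> ~~ (p%:Z %| v y)%Z ->
  wop y != 0 /\ v (wop y) = v y + (p + t)%N%:Z.
Proof.
move=> y0 py; have [u0 vu] := udiff_exact y0 py; rewrite mulf_neq0 //; split=> //.
by rewrite (valM hv) // val_z vu PoszD addrCA.
Qed.

Lemma udiff_z y : udiff (z * y) = z * udiff y.
Proof.
have iz i : iter i sigma (z * y) = z * iter i sigma y.
  by elim: i => //= i ->; rewrite rmorphM /= sz.
by rewrite /udiff /sinv iz rmorphM /= sz mulrBr.
Qed.

Lemma iter_wop i y : iter i wop y = z ^+ i * iter i udiff y.
Proof.
elim: i => [|i IHi]; first by rewrite mul1r.
rewrite iterS IHi /wop exprS -mulrA; congr (_ * _) => /=.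
by elim: i {IHi} (iter i _ _) => [|i IHi] x; rewrite ?mul1r // exprS -!mulrA udiff_z IHi.
Qed.

Lemma wop_p n y : vge v n y ->
  vge v (n + t%:Z + (2 * p * e)%N%:Z + (p * p)%N%:Z) (iter p wop y).
Proof.
move=> ny; rewrite iter_wop addrC; apply: (vgeM hv); last exact: udiff_p.
by rewrite vge_leq // (nvalX hv) // val_z PoszM.
Qed.

(** [wop] preserves the fixed field of [tau] and sends [Pi * tau Pi], of valuation 2, to valuation
    [2 + p + t], which must be even. *)
Lemma jump_odd : odd t.
Proof.
pose x := Pi * tau Pi; have tP0 : tau Pi != 0 by rewrite fmorph_eq0.
have x0 : x != 0 by rewrite mulf_neq0.
have vx : v x = 2 by rewrite (valM hv) // val_gal vPi.
have tx : tau x = x by rewrite rmorphM /= tau_tau mulrC.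
have p3 : (2 < p)%N by have := prime_gt1 p_prime; case: p p_odd => [|[|[|]]].
have [|w0 vw] := wop_exact x0; first by rewrite vx dvdzE /= gtnNdvd.
have := val_even w0 (wop_tau tx); rewrite vw vx dvdzE /= dvdn_addr // dvdn2 oddD p_odd.
by rewrite negbK.
Qed.

(** * The operator weighted by a multiplicative character *)

Section Weighted.
Variable chi : 'F_p -> K.
Hypotheses (chi0 : chi 0 = 0) (chi1 : chi 1 = 1) (chiM : {morph chi : a b / a * b}).
Hypothesis chi_int : forall a, vge vK 0 (chi a).
Hypothesis chi_inv : forall a : 'F_p, a != 0 -> vge vK 1 (chi a * (a : nat)%:R - 1).

Let p_gt2 : (2 < p)%N.
Proof. by have := prime_gt1 p_prime; case: p p_odd => [|[|[|]]]. Qed.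

Let sg (a : 'F_p) y := iter a sigma y.

Let sum_Fp (V : nmodType) (F : nat -> V) : \sum_(a : 'F_p) F a = \sum_(i < p) F i.
Proof.
by rewrite -(big_mkord xpredT) -[RHS](big_mkord xpredT) (Fp_cast p_prime).
Qed.

Let iter_mod m y : iter (m %% p) sigma y = iter m sigma y.
Proof.
rewrite {2}(divn_eq m p) addnC iterD; congr (iter _ _ _).
by elim: (m %/ p)%N => // k IHk; rewrite mulSn iterD -IHk sigma_p.
Qed.

Let sgD a b y : sg (a + b) y = sg a (sg b y).
Proof.
have H m x : m = p -> iter (x %% m) sigma y = iter x sigma y by move=> ->; apply: iter_mod.
by rewrite /sg -iterD; apply: (H _ _ (Fp_cast p_prime)).
Qed.

Let sg_lin a : linear (sg a).
Proof. by apply: iter_lin => k x y; rewrite linearP. Qed.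

Let op (F : 'F_p -> K) y := \sum_a F a *: sg a y.

Let op_lin F : linear (op F).
Proof.
move=> k x y; rewrite /op scaler_sumr -big_split; apply: eq_bigr => a _ /=.
by rewrite (sg_lin a) scalerDr !scalerA mulrC.
Qed.

(* To first order [weighted] is [- udiff / 2], because [sum_a chi a * a = -1] modulo *)
(* [p]; but as [chi] is multiplicative, its powers are explicit, see [weighted_p].   *)
Definition weighted y := \sum_(a : 'F_p) chi a *: iter a sigma y.

(** Convolution powers of [chi]: the coefficients of the powers of [weighted] in the group algebra
    of ['F_p]. *)
Fixpoint conv (k : nat) : 'F_p -> K :=
  if k is k'.+1 then fun b => \sum_a chi a * conv k' (b - a) else fun b => (b == 0)%:R.

Let opM F y : weighted (op F y) = op (fun b => \sum_a chi a * F (b - a)) y.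
Proof.
transitivity (\sum_a \sum_b (chi a * F b) *: sg (b + a) y).
  apply: eq_bigr => a _; rewrite -/(sg a _) (lin_sum _ _ _ (sg_lin a)) scaler_sumr.
  by apply: eq_bigr => b _; rewrite (linZ (sg_lin a)) scalerA addrC sgD.
under [RHS]eq_bigr => b _ do rewrite scaler_suml.
rewrite [RHS]exchange_big /=; apply: eq_bigr => a _.
by rewrite [RHS](reindex_inj (addIr a)) /=; apply: eq_bigr => b _; rewrite addrK.
Qed.

Let iter_weighted k y : iter k weighted y = op (conv k) y.
Proof.
elim: k => [|k IHk]; last by rewrite iterS IHk opM.
rewrite /op (bigD1 0) //= ?eqxx scale1r big1 ?addr0 // => a /negPf->.
by rewrite scale0r.
Qed.

(** Rescaling the summation index transfers the homogeneity of [chi] to its convolution powers. At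
    [k = p.-1] the factor is trivial, so the coefficients are constant away from 0. *)
Let conv_weight k (a b : 'F_p) : a != 0 -> conv k (a * b) = chi a ^+ k * conv k b.
Proof.
move=> a0; elim: k b => [|k IHk] b /=.
  by rewrite expr0 mul1r mulf_eq0 (negPf a0).
rewrite mulr_sumr (reindex_inj (mulfI a0)) /=; apply: eq_bigr => c _.
by rewrite -mulrBr IHk chiM exprS; ring.
Qed.

Let Fp2_neq0 : (2%:R : 'F_p) != 0.
Proof.
by apply/eqP => /(congr1 (@nat_of_ord _)); rewrite (val_Fp_nat p_prime) modn_small.
Qed.

(** Multiplication by 2 permutes ['F_p], and [chi 2] is not 1, being residually inverse to 2. *)
Let chi_sum : \sum_a chi a = 0.
Proof.
have sumE : \sum_a chi a = chi 2%:R * \sum_a chi a.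
  rewrite mulr_sumr {1}(reindex_inj (mulfI Fp2_neq0)) /=.
  by apply: eq_bigr => a _; rewrite chiM.
have n1 : chi 2%:R - 1 != 0.
  apply/negP; rewrite subr_eq0 => /eqP c2; have := chi_inv Fp2_neq0.
  rewrite c2 mul1r (val_Fp_nat p_prime) modn_small // (_ : 2%:R - 1 = 1); last by ring.
  by rewrite vgeE ?oner_neq0 // (nval1 hK).
by apply: (mulfI n1); rewrite mulrBl mul1r -sumE subrr mulr0.
Qed.

Let chi_N1 : chi (-1) = -1.
Proof.
have N1 : (-1 : 'F_p) != 0 by rewrite oppr_eq0 oner_neq0.
have : chi (-1) ^+ 2 = 1 by rewrite expr2 -chiM mulrNN mulr1.
move/eqP; rewrite -subr_eq0 subr_sqr_1 mulf_eq0 subr_eq0 addr_eq0.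
case/orP => /eqP // c1; have := chi_inv N1; rewrite c1 mul1r.
have vN1 : nat_of_ord (-1 : 'F_p) = p.-1.
  have -> : (-1 : 'F_p) = p.-1%:R.
    by apply/eqP; rewrite eq_sym -addr_eq0 natr1 prednK // (pchar_Fp_0 p_prime).
  by rewrite (val_Fp_nat p_prime) modn_small // prednK.
rewrite vN1.
have -> : p.-1%:R - 1 = (p.-1 - 1)%N%:R :> K by rewrite natrB //; move: p_gt2; clear; lia.
have [|m0 vm] := @int_unitK (p.-1 - 1)%N.
  by rewrite dvdzE /= gtnNdvd //; move: p_gt2; clear; lia.
by rewrite pmulrn vgeE // vm.
Qed.

Let chi_opp a : chi (- a) = - chi a.
Proof. by rewrite -mulN1r chiM chi_N1 mulN1r. Qed.

(** The first-order factor is the sum of [chi a * a], each of whose [p.-1] nonzero terms is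
    residually 1. *)
Lemma weighted_graded y : y != 0 ->
  vge v (v y + t.+1%:Z) (weighted y + (v y)%:~R * theta * y).
Proof.
move=> y0; have [th0 vth] := theta_val.
have -> : weighted y + (v y)%:~R * theta * y =
  (\sum_(a : 'F_p) chi a *: (sg a y - y - ((nat_of_ord a)%:Z * v y)%:~R * theta * y)) +
  ((\sum_(a : 'F_p) chi a * (a : nat)%:R) + 1)%:A * ((v y)%:~R * theta * y).
  have -> : weighted y = \sum_(a : 'F_p) chi a *: (sg a y - y).
    under [RHS]eq_bigr => a _ do rewrite scalerBr.
    by rewrite sumrB -scaler_suml chi_sum scale0r subr0.
  rewrite scalerDl scale1r mulrDl mul1r addrA; congr (_ + _).
  rewrite scaler_suml mulr_suml -big_split; apply: eq_bigr => a _ /=.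
  rewrite [in RHS]scalerBr intrM -scalerA scaler_nat.
  rewrite -[chi a *: (_%:R) * _]scalerAl -[LHS]addr0 -addrA; congr (_ + _).
  by rewrite -scalerN -scalerDr -pmulrn !mulrA addNr scaler0.
apply: (vgeD uE).
  apply: (vge_sum uE) => a _; apply: (vgeZ0 (ramified_space hv d_gt0 ram)) => //.
  exact: (iter_derivation a).
have S1 : vge vK 1 ((\sum_(a : 'F_p) chi a * (a : nat)%:R) + 1).
  rewrite (bigD1 0) //= mulr0 add0r.
  have -> : \sum_(a : 'F_p | a != 0) chi a * (a : nat)%:R + 1 =
      \sum_(a : 'F_p | a != 0) (chi a * (a : nat)%:R - 1) + p%:R.
    rewrite sumrB (_ : \sum_(a : 'F_p | a != 0) 1 = p.-1%:R); last first.
      by rewrite sumr_const cardC1 (card_Fp p_prime).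
    by rewrite -[in p%:R](prednK p_gt0) -natr1 addrA subrK.
  apply: (vgeD uK); first by apply: (vge_sum uK) => a a0; apply: chi_inv.
  apply: vge_trans (int_nonunitK (m := p) _); last by rewrite dvdzz.
  by move: e_gt0; clear; lia.
rewrite -scale_alg.
have := vgeZ (ramified_space hv d_gt0 ram) S1 (vgeM hv (vgeM hv (vge_int hv (v y)) (vge_leq (lexx (v theta)))) (vge_leq (lexx (v y)))).
by rewrite vth; apply: vge_trans; have := p_gt0; clear; lia.
Qed.

Let weighted_lin : linear weighted.
Proof. exact: (op_lin chi). Qed.

Lemma weighted_ge n y : vge v n y -> vge v (n + t%:Z) (weighted y).
Proof.
have [->|y0] := eqVneq y 0; first by rewrite (lin0 weighted_lin) !vge0.
have [th0 vth] := theta_val; rewrite vgeE // => ny.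
rewrite -[weighted y](addrK ((v y)%:~R * theta * y)); apply: (vgeB uE).
  by apply: vge_trans (weighted_graded y0); move: ny; clear; lia.
have := vgeM hv (vgeM hv (vge_int hv (v y)) (vge_leq (lexx (v theta)))) (vge_leq (lexx (v y))).
by apply: vge_trans; rewrite vth; move: ny; clear; lia.
Qed.

Lemma weighted_exact y : y != 0 -> ~~ (p%:Z %| v y)%Z ->
  weighted y != 0 /\ v (weighted y) = v y + t%:Z.
Proof.
move=> y0 py; have [th0 vth] := theta_val; have [m0 vm] := int_unitE py.
have nz0 : - ((v y)%:~R * theta * y) != 0 by rewrite oppr_eq0 !mulf_neq0.
have vz : v (- ((v y)%:~R * theta * y)) = v y + t%:Z.
  by rewrite (ultraN uE) !(valM hv) ?mulf_neq0 // vm vth add0r addrC.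
rewrite -vz; apply: (val_sub_dom uE nz0); rewrite vz opprK.
by apply: vge_trans (weighted_graded y0); clear; lia.
Qed.

Let conv_int k b : vge vK 0 (conv k b).
Proof.
elim: k b => [|k IHk] b /=; first exact: vge_nat.
by apply: (vge_sum uK) => a _; rewrite -[0]addr0; apply: (vgeM hK).
Qed.

Let conv_sum k : \sum_b conv k.+1 b = 0.
Proof.
rewrite /= exchange_big /=.
under eq_bigr => a _ do rewrite -mulr_sumr (reindex_inj (addIr a)) /=.
under eq_bigr => a _ do under eq_bigr => b _ do rewrite addrK.
by rewrite -mulr_suml chi_sum mul0r.
Qed.

Let B := conv p.-1 1.

Let chi_pow a : a != 0 -> chi a ^+ p.-1 = 1.
Proof.
move=> a0; have chiX n : chi (a ^+ n) = chi a ^+ n.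
  by elim: n => [|n IHn]; rewrite ?expr0 // !exprS chiM IHn.
rewrite -chiX; suff -> : a ^+ p.-1 = 1 by [].
by apply: (mulfI a0); rewrite -exprS prednK // mulr1 -{2}(expf_card a) (card_Fp p_prime).
Qed.

Let conv_const b : b != 0 -> conv p.-1 b = B.
Proof. by move=> b0; rewrite -[b]mulr1 conv_weight // chi_pow // mul1r. Qed.

Let conv_zero : conv p.-1 0 = B - p%:R * B.
Proof.
have p1 : p.-1 = p.-2.+1 by move: p_gt2; clear; lia.
have := conv_sum p.-2; rewrite -p1 (bigD1 0) //= (eq_bigr _ conv_const).
rewrite sumr_const cardC1 (card_Fp p_prime) => /eqP; rewrite addr_eq0 => /eqP->.
by rewrite -[p in p%:R](prednK p_gt0) -natr1 mulrDl mul1r opprD addrCA subrr addr0 mulr_natl.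
Qed.

Let Tr_Fp y : Tr sigma y = \sum_(a : 'F_p) sg a y.
Proof. by rewrite /Tr -(sum_Fp (fun a => iter a sigma y)). Qed.

(** The coefficients are constant off 0 and sum to 0, which leaves a multiple of the trace minus
    [p]. As [weighted] kills traces, one more application gives [weighted_p]. *)
Let weighted_pow y : iter p.-1 weighted y = B *: (Tr sigma y - p%:R *: y).
Proof.
rewrite iter_weighted /op Tr_Fp (bigD1 0) //= conv_zero [in RHS](bigD1 0) //=.
rewrite (eq_bigr (fun a => B *: sg a y)); last by move=> a a0; rewrite conv_const.
rewrite -scaler_sumr scalerBl [RHS]scalerBr scalerDr scalerA [B * _]mulrC.
by rewrite -addrA [- _ + _]addrC addrA.
Qed.

Lemma weighted_fixed y : sigma y = y -> weighted y = 0.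
Proof.
move=> sy; rewrite /weighted (eq_bigr (fun a => chi a *: y)).
  by rewrite -scaler_suml chi_sum scale0r.
by move=> a _; congr (_ *: _); elim: (nat_of_ord a) => //= n ->.
Qed.

Lemma weighted_p y : iter p weighted y = (- (p%:R * B)) *: weighted y.
Proof.
rewrite -(prednK p_gt0) iterS weighted_pow (linZ weighted_lin) (linB weighted_lin).
rewrite weighted_fixed ?(Tr_fixed _ sigma_p) // (linZ weighted_lin) sub0r scalerN scalerA.
by rewrite prednK // scaleNr mulrC.
Qed.

(* Compare valuations in [weighted ^ (p-1) y = B (Tr y - p y)]. *)
Lemma B_unit : ~~ (p %| t)%N -> B != 0 /\ vK B = 0.
Proof.
move=> pt; suff N : ~~ vge vK 1 B.
  have [B0 lt] := vge_nearby N; split=> //.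
  by have := conv_int p.-1 1; rewrite -/B vgeE //; move: lt; clear; lia.
apply/negP => B1; have [y y0 vy] := val_onto hv t%:Z.
have H k : (k < p)%N -> iter k weighted y != 0 /\ v (iter k weighted y) = (k.+1 * t)%N%:Z.
  elim: k => [|k IHk] kp; first by rewrite mul1n.
  have [w0 vw] := IHk (ltnW kp); have [|w1 vw1] := weighted_exact w0.
    by rewrite vw dvdzE /= Euclid_dvdM // (negPf pt) orbF gtnNdvd.
  by split=> //; rewrite iterS vw1 vw [(k.+2 * t)%N]mulSn; clear; lia.
have [|w0 vw] := H p.-1; first by rewrite prednK.
have [G GE GP] := trace_split iter_raises.
have jb := jump_bound.
have py : vge v (p * t)%N%:Z (p%:R *: y).
  rewrite scaler_nat -mulr_natl; apply: vge_trans (vgeM hv p_ge (vge_leq (lexx (v y)))).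
  by rewrite vy -(prednK p_gt0) mulSn prednK //; move: jb; clear; lia.
have Try : vge v (p * t)%N%:Z (Tr sigma y).
  have -> : Tr sigma y = iter p.-1 (fun x => sigma x - x) y - p%:R * G y by rewrite GE addrK.
  have [G0 vG] := G_val GP y0.
  apply: (vgeB uE).
    apply: vge_trans (iter_dlt_ge p.-1 (vge_leq (lexx (v y)))).
    by rewrite vy -{1}(prednK p_gt0) mulSn; clear; lia.
  apply: vge_trans (vgeM hv p_ge (vge_leq (lexx (v (G y))))).
  by rewrite vG vy -{1}(prednK p_gt0) mulSn; move: jb; clear; lia.
have := vgeZ (ramified_space hv d_gt0 ram) B1 (vgeB uE Try py).
rewrite -weighted_pow vgeE // vw prednK //; have := p_gt0; clear; lia.
Qed.

Definition Wop y := z * weighted y.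

Lemma Wop_lin : linear Wop.
Proof. by move=> k x y; rewrite /Wop weighted_lin mulrDr scalerAr. Qed.

Lemma Wop_ge n y : vge v n y -> vge v (n + (p + t)%N%:Z) (Wop y).
Proof.
move=> ny; rewrite PoszD addrCA; apply: (vgeM hv); last exact: weighted_ge.
by rewrite vge_leq ?val_z.
Qed.

Lemma Wop_exact y : y != 0 -> ~~ (p%:Z %| v y)%Z ->
  Wop y != 0 /\ v (Wop y) = v y + (p + t)%N%:Z.
Proof.
move=> y0 py; have [u0 vu] := weighted_exact y0 py; rewrite mulf_neq0 //; split=> //.
by rewrite (valM hv) // val_z vu PoszD addrCA.
Qed.

Let iter_z i y : iter i sigma (z * y) = z * iter i sigma y.
Proof. by elim: i => //= i ->; rewrite rmorphM /= sz. Qed.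

Let weighted_z y : weighted (z * y) = z * weighted y.
Proof.
rewrite /weighted mulr_sumr; apply: eq_bigr => a _.
by rewrite iter_z scalerAr.
Qed.

Let iter_Wop i y : iter i Wop y = z ^+ i * iter i weighted y.
Proof.
elim: i => [|i IHi]; first by rewrite mul1r.
rewrite iterS IHi /Wop exprS -mulrA; congr (_ * _) => /=.
by elim: i {IHi} (iter i _ _) => [|i IHi] x; rewrite ?mul1r // exprS -!mulrA weighted_z IHi.
Qed.

Lemma Wop_p : ~~ (p %| t)%N -> exists C : K, [/\ C != 0, vK C = (e + p.-1./2)%N%:Z &
  forall y, iter p Wop y = C *: Wop y].
Proof.
move=> pt; have [B0 vB] := B_unit pt; have [k kE vk] := z_square.
have [p0 vp] := nat_val p_gt0.
have k0 : k != 0.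
  by apply: contraNneq (expf_neq0 2 z0) => k0; rewrite kE k0 scale0r.
exists (- (p%:R * B) * k ^+ p.-1./2); split.
- by rewrite mulf_neq0 ?expf_neq0 // oppr_eq0 mulf_neq0.
- rewrite (valM hK) ?expf_neq0 // ?oppr_eq0 ?mulf_neq0 // (nvalN hK) (valM hK) // vB vp.
  by rewrite (nvalX hK) // vk lognE p_prime p_gt0 dvdnn divnn p_gt0 logn1 muln1 addr0 mulr1 PoszD.
move=> y; rewrite iter_Wop weighted_p /Wop -scalerAr.
have -> : z ^+ p = k ^+ p.-1./2 *: z.
  have pE : p = (2 * p.-1./2).+1.
    have o : odd p.-1 = false by rewrite -subn1 oddB // p_odd.
    by have := odd_double_half p.-1; rewrite o mul2n add0n => ->; rewrite prednK.
  by rewrite {1}pE exprS exprM kE exprZn expr1n -scalerAr mulr1.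
by rewrite -scalerAl scalerA.
Qed.

Let sgN (a : 'F_p) x : iter (p - a) sigma x = sg (- a) x.
Proof.
have ap : (a <= p)%N by rewrite ltnW // -[X in (_ < X)%N](Fp_cast p_prime) ltn_ord.
have xE : x = sg a (sg (- a) x) by rewrite -sgD subrr.
by rewrite {1}xE /sg -iterD subnK // sigma_p.
Qed.

Lemma Wop_tau x : tau x = x -> tau (Wop x) = Wop x.
Proof.
move=> tx; rewrite /Wop rmorphM /= tz; suff -> : tau (weighted x) = - weighted x.
  by rewrite mulrNN.
rewrite /weighted raddf_sum /= -sumrN [RHS](reindex_inj (@oppr_inj _)) /=.
apply: eq_bigr => a _; rewrite linearZ /= tau_iter //; last first.
  by rewrite ltnW // -[X in (_ < X)%N](Fp_cast p_prime) ltn_ord.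
by rewrite sgN chi_opp scaleNr opprK.
Qed.

Lemma Wop_wop y : Wop (wop y) = wop (Wop y).
Proof.
have comm i x : weighted (iter i sigma x) = iter i sigma (weighted x).
  elim: i => //= i <-; rewrite /weighted linear_sum; apply: eq_bigr => a _.
  by rewrite linearZ -iterSr.
rewrite /Wop /wop weighted_z udiff_z; congr (_ * (_ * _)).
by rewrite /udiff (linB weighted_lin); congr (_ - _); [apply: (comm 1%N) | apply: comm].
Qed.

End Weighted.

Lemma wop_lin : linear wop.
Proof.
move=> k x y; rewrite /wop /udiff linearP /= /sinv.
have -> : iter p.-1 sigma (k *: x + y) = k *: iter p.-1 sigma x + iter p.-1 sigma y.
  by apply: iter_lin => c u u'; rewrite linearP.
by rewrite opprD addrACA -scalerBr mulrDr scalerAr.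
Qed.

End FixedUniformizer.

End Dihedral.

(** * Teichmueller representatives *)

Section Teichmuller.
Variables (p : nat) (p_prime : prime p) (Q : fieldType) (vp : Q -> int).
Hypothesis padic : padic_field p vp.
Let hQ := padic_val padic.
Let uQ := nval_ultra hQ.
Let p_gt0 := prime_gt0 p_prime.

Lemma padic_dvd k m : (p ^ k %| m)%N -> vge vp k m%:R.
Proof.
have [->|m0] := posnP m; first by rewrite vge0.
by have [n0 vm] := padic_nat padic m0; rewrite pfactor_dvdn // vgeE // vm lez_nat.
Qed.

Lemma root_integral x : x ^+ p = x -> vge vp 0 x.
Proof.
have [->|x0] := eqVneq x 0; first by rewrite vge0.
move=> E; rewrite vge_leq //; have : vp (x ^+ p) = vp x by rewrite E.
rewrite (nvalX hQ) //; have := prime_gt1 p_prime; move: (vp x); clear => m p1 H.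
have : m * (p%:Z - 1) = 0 by lia.
by move=> /eqP; rewrite mulf_eq0 => /orP[/eqP|/eqP]; lia.
Qed.

(** If [x] and [y] differ, dividing x^p - y^p = x - y by x - y writes 1 as the sum of the x^(p-1-i)
    y^i, which is congruent to p x^(p-1) and so not a unit. *)
Lemma teichmuller_uniq x y : x ^+ p = x -> y ^+ p = y -> vge vp 1 (x - y) -> x = y.
Proof.
move=> xp yp xy; have x_int := root_integral xp; have y_int := root_integral yp.
apply/eqP; rewrite -subr_eq0; apply/contraT => xy0.
have E : x - y = (x - y) * \sum_(i < p) x ^+ (p.-1 - i) * y ^+ i.
  by rewrite -{1}xp -{1}yp -{1 2}(prednK p_gt0) subrXX (prednK p_gt0).
have S1 : \sum_(i < p) x ^+ (p.-1 - i) * y ^+ i = 1.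
  by apply: (mulfI xy0); rewrite -E mulr1.
have : vge vp 1 (1 : Q); last by rewrite vgeE ?oner_neq0 // (nval1 hQ).
rewrite -S1 (eq_bigr (fun i : 'I_p => x ^+ p.-1 - x ^+ (p.-1 - i) * (x ^+ i - y ^+ i))).
  rewrite sumrB; apply: (vgeB uQ).
    rewrite sumr_const card_ord -mulr_natl -[1]addr0; apply: (vgeM hQ); last exact: vgeX.
    by apply: padic_dvd; rewrite expn1.
  apply: (vge_sum uQ) => i _; rewrite -[1]add0r; apply: (vgeM hQ); first exact: vgeX.
  case: (nat_of_ord i) => [|m]; first by rewrite !expr0 subrr vge0.
  rewrite subrXX -[1]addr0; apply: (vgeM hQ) => //; apply: (vge_sum uQ) => j _.
  by rewrite -[0]addr0; apply: (vgeM hQ); apply: vgeX.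
move=> i _; rewrite mulrBr opprB addrCA -exprD subnK ?subrr ?addr0 //.
by rewrite -ltnS prednK.
Qed.

(** The limit of the c^(p^n), a Cauchy sequence by Euler's theorem modulo powers of [p]. *)
Lemma teichmuller_lift (c : nat) : exists x, x ^+ p = x /\ vge vp 1 (x - c%:R).
Proof.
have [pc|pc] := boolP (p %| c)%N.
  exists 0; rewrite expr0n eqn0Ngt p_gt0; split=> //.
  by rewrite sub0r (vgeN uQ); apply: padic_dvd; rewrite expn1.
have c0 : (0 < c)%N by case: c pc => //; rewrite dvdn0.
pose u n : Q := (c ^ p ^ n)%N%:R.
have u_succ n : vge vp n.+1 (u n.+1 - u n).
  have E : (c ^ p ^ n.+1 = c ^ p ^ n * c ^ totient (p ^ n.+1))%N.
    rewrite -expnD totient_pfactor //; congr (c ^ _)%N.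
    by rewrite expnS -{1}(prednK p_gt0) mulSn.
  have le : (c ^ p ^ n <= c ^ p ^ n.+1)%N by rewrite E leq_pmulr // expn_gt0 c0.
  rewrite /u -natrB //; apply: padic_dvd.
  rewrite -eqn_mod_dvd // E -[X in _ == X %[mod _]]muln1 -modnMmr Euler_exp_totient ?modnMmr //.
  by rewrite coprime_sym coprimeXl // prime_coprime.
have u_int n : vge vp 0 (u n) by apply: vge_nat.
have u_diff i k : vge vp i.+1 (u (i + k)%N - u i).
  elim: k => [|k IHk]; first by rewrite addn0 subrr vge0.
  rewrite addnS -[u (i + k).+1](subrK (u (i + k)%N)) -addrA; apply: (vgeD uQ) => //.
  by apply: vge_trans (u_succ _); clear; lia.
have [|x xP] := padic_complete padic (u := u).
  move=> n; exists `|n|%N => i j ni nj.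
  have H k : (`|n| <= k)%N -> vge vp n (u k - u `|n|%N).
    by move=> nk; rewrite -(subnKC nk); apply: vge_trans (u_diff _ _); clear; lia.
  have -> : u i - u j = (u i - u `|n|%N) - (u j - u `|n|%N) by rewrite opprB addrA subrK.
  by apply: (vgeB uQ); apply: H.
have {}xP n : exists N, forall i, (N <= i)%N -> vge vp n (u i - x) by exact: xP.
have x_int : vge vp 0 x.
  have [N /(_ N (leqnn N)) H] := xP 0.
  by rewrite -[x](subKr (u N)); apply: (vgeB uQ).
exists x; split.
  apply/eqP; rewrite -subr_eq0; apply/eqP/(vge_all (v := vp)) => n.
  have [N NP] := xP n; have H1 := NP N (leqnn N); have H2 := NP N.+1 (leqnSn N).
  have uE : u N.+1 = u N ^+ p by rewrite /u expnSr expnM natrX.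
  have -> : x ^+ p - x = (u N.+1 - x) - (u N ^+ p - x ^+ p).
    by rewrite uE opprB [RHS]addrC addrA subrK.
  apply: (vgeB uQ) => //; rewrite -(prednK p_gt0) subrXX -[n]addr0; apply: (vgeM hQ) => //.
  by apply: (vge_sum uQ) => j _; rewrite -[0]addr0; apply: (vgeM hQ); apply: vgeX.
have [N NP] := xP 1.
have -> : x - c%:R = (u N - u 0%N) - (u N - x).
  by rewrite [u 0%N]/u expn0 expn1 opprB [RHS]addrC addrA subrK.
by apply: (vgeB uQ); [rewrite -[N]add0n; apply: (u_diff 0%N) | apply: NP].
Qed.

Let valM_Fp (a b : 'F_p) : ((a * b)%R : nat) = (a * b)%N %[mod p].
Proof.
have H m x : m = p -> x %% m = x %[mod p] by move=> ->; rewrite modn_mod.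
exact: (H _ _ (Fp_cast p_prime)).
Qed.

Lemma teichmuller_character : exists chi : 'F_p -> Q,
  [/\ chi 0 = 0, chi 1 = 1, {morph chi : a b / a * b}, forall a, vge vp 0 (chi a)
    & forall a, a != 0 -> vge vp 1 (chi a * (a : nat)%:R - 1)].
Proof.
have [T TP] := choice (fun a : 'F_p => teichmuller_lift a).
have T_cong a : vge vp 1 (T a - (a : nat)%:R) by case: (TP a).
have Tp a : T a ^+ p = T a by case: (TP a).
have T_int a := root_integral (Tp a).
have TM : {morph T : a b / a * b}.
  move=> a b; apply: teichmuller_uniq; rewrite ?exprMn ?Tp //.
  have -> : T (a * b) - T a * T b = (T (a * b) - ((a * b)%R : nat)%:R) +
      (((a * b)%R : nat)%:R - (a * b)%N%:R) - T a * (T b - (b : nat)%:R)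
      - (T a - (a : nat)%:R) * (b : nat)%:R.
    by rewrite natrM; ring.
  have ab : vge vp 1 (((a * b)%R : nat)%:R - (a * b)%N%:R).
    have le : (((a * b)%R : nat) <= a * b)%N by rewrite /= leq_mod.
    rewrite -opprB (vgeN uQ) -natrB //; apply: padic_dvd.
    by rewrite expn1 -eqn_mod_dvd // eq_sym; apply/eqP/valM_Fp.
  apply: (vgeB uQ); first apply: (vgeB uQ); first exact: (vgeD uQ).
    by rewrite -[1]add0r; apply: (vgeM hQ).
  by rewrite -[1]addr0; apply: (vgeM hQ) => //; apply: vge_nat.
have T1 : T 1 = 1 by apply: teichmuller_uniq; rewrite ?expr1n ?Tp //; apply: (T_cong 1).
have T0 : T 0 = 0.
  by apply: teichmuller_uniq; rewrite ?Tp ?expr0n ?eqn0Ngt ?p_gt0 //; apply: (T_cong 0).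
(* The inverse of the Teichmueller character is wanted, so that [chi a * a] is residually 1. *)
exists (fun a => T a^-1); rewrite invr0 invr1; split=> // [a b|a a0].
  by rewrite invfM TM.
have -> : T a^-1 * (a : nat)%:R - 1 = - (T a^-1 * (T a - (a : nat)%:R)).
  by rewrite mulrBr -TM mulVf // T1 opprB.
by rewrite (vgeN uQ) -[1]add0r; apply: (vgeM hQ).
Qed.

End Teichmuller.

Lemma iter_gal (K : fieldType) (E : splittingFieldType K) (g : gal_of {:E}) n y :
  iter n g y = (g ^+ n)%g y.
Proof.
elim: n y => [|n IHn] y; first by rewrite expg0 gal_id.
by rewrite iterSr IHn expgS galM ?memvf.
Qed.

(** * The Hopf algebra H, its action on [L] and the associated order *)

Section HopfAlgebra.
Variables (K : fieldType) (vK : K -> int) (hK : normalized_valuation vK).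
Variables (E : splittingFieldType K) (v : E -> int).
Local Notation gT := (gal_of {:E}).
Local Notation G := ('Gal({:E} / 1%AS))%g.
Variables (p : nat) (p_odd : odd p).
Variables sigma tau : gT.
Hypotheses (G_gen : <<[set sigma; tau]>>%g = G) (sigma_order : #[sigma]%g = p)
  (tau_order : #[tau]%g = 2%N) (tau_sigma : (tau * sigma = sigma^-1 * tau)%g).
Variables (z : E) (z0 : z != 0) (sz : sigma z = z) (tz : tau z = - z).
Hypothesis two_neq0 : (2%:R : E) != 0.
Local Notation lambda := (left_translation <[tau]>%G).
Local Notation S := <[sigma]>%g.
Local Notation N := <[lambda sigma]>%g.
Local Notation H := (dihedral_H sigma tau).
Local Notation w := (dihedral_w sigma tau z).
Local Notation act := (dihedral_act tau).

Let tau_tau : (tau * tau = 1)%g.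
Proof. by have := expg_order tau; rewrite tau_order expgS expg1. Qed.

Let tauV : (tau^-1 = tau)%g.
Proof. by apply: (mulgI tau); rewrite mulgV tau_tau. Qed.

Let S_conj_tau g : g \in S -> (g ^ tau = g^-1)%g.
Proof.
case/cycleP => n ->; rewrite conjXg; have -> : (sigma ^ tau = sigma^-1)%g.
  by rewrite conjgE tauV mulgA tau_sigma -mulgA tau_tau mulg1.
by rewrite expgVn.
Qed.

Lemma lambdaX n : lambda (sigma ^+ n)%g = (lambda sigma ^+ n)%g.
Proof.
elim: n => [|n IHn]; first by rewrite !expg0 left_translation1.
by rewrite !expgS left_translationM IHn.
Qed.

Lemma lambda_in g : g \in S -> lambda g \in N.
Proof. by case/cycleP => n ->; rewrite lambdaX mem_cycle. Qed.

Lemma sigma_notin_tau g : g \in S -> g \in <[tau]>%g -> g = 1%g.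
Proof.
move=> gS gT'; have co : coprime #|S| #|<[tau]>%g|.
  by rewrite -!orderE sigma_order tau_order coprimen2.
by apply/set1gP; rewrite -(coprime_TIg co) inE gS.
Qed.

Lemma lambda_inj : {in S &, injective (fun g => lambda g)}.
Proof.
move=> g h gS hS /= E1.
have : lambda g (<[tau]> :* 1)%g = lambda h (<[tau]> :* 1)%g by rewrite E1.
rewrite !left_translationE !mul1g => /rcoset_eqP; rewrite mem_rcoset => gh.
apply/eqP; rewrite eq_mulgV1; apply/eqP/sigma_notin_tau => //.
by rewrite groupM ?groupV.
Qed.

Lemma lambda_S : N = [set lambda g | g in S].
Proof.
apply/setP => u; apply/idP/imsetP => [/cycleP[n ->]|[g gS ->]]; last exact: lambda_in.
by exists (sigma ^+ n)%g; rewrite ?mem_cycle ?lambdaX.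
Qed.

(* The coefficient of [g] in the action of [h]; the inverse is that of [hopf_act]. *)
Definition hcoef (h : permalg E {set gT}) (g : gT) : E := h (lambda g^-1)%g.

Lemma tau_fixes x g : tau x = x -> (repr (<[tau]> :* g)%g : gT) x = g x.
Proof.
move=> tx; have /rcosetP[t /cycleP[n ->] ->] := mem_repr_rcoset <[tau]>%G g.
rewrite galM ?memvf // -iter_gal; congr (g _).
by elim: n => //= n ->.
Qed.

Lemma hopf_actE h x : H h -> tau x = x -> act h x = \sum_(g in S) hcoef h g * g x.
Proof.
move=> [hN _] tx; rewrite /dihedral_act /hopf_act.
rewrite (bigID (fun u => u \in N)) /= [X in _ + X]big1 ?addr0; last first.
  by move=> u uN; rewrite hN // mul0r.
rewrite lambda_S big_imset /=; last exact: lambda_inj.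
rewrite (reindex_inj invg_inj) /=; apply: eq_big => [g|g gS]; first by rewrite groupV.
rewrite -left_translationV invgK -[X in lambda g X]rcoset1 left_translationE mul1g.
by rewrite tau_fixes.
Qed.

(** Conjugation by the translation of [k] is trivial on the abelian group of translations by powers
    of [sigma], so the descent condition puts the coefficients in the quadratic subfield. *)
Lemma hcoef_fixed h g k : H h -> g \in S -> k \in S -> k (hcoef h g) = hcoef h g.
Proof.
move=> [_ hG] gS kS; rewrite /hcoef -hG ?galT //; last by rewrite lambda_in ?groupV.
rewrite conjgE -left_translationV -!left_translationM mulgA.
have /cycleP[m ->] := gS; have /cycleP[n ->] := kS.
have C : commute (sigma ^+ m)^-1 (sigma ^+ n).
  by apply/commute_sym/commuteV/commuteX2.
by rewrite -mulgA C mulKg.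
Qed.

Lemma S_commute g h : g \in S -> h \in S -> (g * h = h * g)%g.
Proof. by move=> /cycleP[m ->] /cycleP[n ->]; rewrite -!expgD addnC. Qed.

Lemma gal_swap g k x : g \in S -> k \in S -> g (k x) = k (g x).
Proof. by move=> gS kS; rewrite -!galM ?memvf // S_commute. Qed.

Lemma z_fixed g : g \in S -> g z = z.
Proof. by case/cycleP => n ->; rewrite -iter_gal; elim: n => //= n ->. Qed.

Lemma act_additive h x y : act h (x + y) = act h x + act h y.
Proof.
by rewrite /dihedral_act /hopf_act -big_split; apply: eq_bigr => u _; rewrite rmorphD mulrDr.
Qed.

Lemma act_scale h (k : K) x : act h (k *: x) = k *: act h x.
Proof.
rewrite /dihedral_act /hopf_act scaler_sumr; apply: eq_bigr => u _.
by rewrite linearZ /= scalerAr.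
Qed.

Lemma act_addl f h x : act (f + h) x = act f x + act h x.
Proof.
by rewrite /dihedral_act /hopf_act -big_split; apply: eq_bigr => u _; rewrite !ffunE mulrDl.
Qed.

Lemma act_scalel h (k : K) x : act (k *: h) x = k *: act h x.
Proof.
rewrite /dihedral_act /hopf_act scaler_sumr; apply: eq_bigr => u _.
by rewrite !ffunE scalerAl.
Qed.

Lemma act_0l x : act 0 x = 0.
Proof. by rewrite -(scale0r (0 : permalg E _)) act_scalel scale0r. Qed.

Lemma act_suml (I : Type) (r : seq I) (P : pred I) F x :
  act (\sum_(i <- r | P i) F i) x = \sum_(i <- r | P i) act (F i) x.
Proof. by rewrite (big_morph (fun h => act h x) (fun f h => act_addl f h x) (act_0l x)). Qed.

Definition wact (x : E) : E := z * (sigma x - (sigma^-1)%g x).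

Lemma act_wact h x : H h -> tau x = x -> tau (wact x) = wact x ->
  act h (wact x) = wact (act h x).
Proof.
move=> hH tx twx; rewrite !hopf_actE // /wact !raddf_sum /= -big_split /= mulr_sumr.
apply: eq_bigr => g gS; rewrite rmorphM rmorphB /= z_fixed //.
have sS : sigma \in S by apply: cycle_id.
have sVS : (sigma^-1)%g \in S by rewrite groupV.
rewrite !(rmorphM _ (hcoef _ _)) /= !hcoef_fixed // !(gal_swap _ gS) // -mulrBr.
by rewrite mulrCA.
Qed.

Lemma act_tau h x : H h -> tau x = x -> tau (act h x) = act h x.
Proof.
move=> hH tx; rewrite !hopf_actE // raddf_sum /= [RHS](reindex_inj invg_inj) /=.
apply: eq_big => [g|g gS]; first by rewrite groupV.
have gt : (g * tau = tau * g^-1)%g by rewrite conjgC S_conj_tau.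
rewrite rmorphM /= -galM ?memvf // gt galM ?memvf // tx; congr (_ * _).
have [_ hG] := hH; rewrite /hcoef -hG ?galT ?lambda_in ?groupV //.
rewrite conjgE -left_translationV -!left_translationM invgK tauV; congr (h (lambda _)).
by rewrite ?mulgA -gt -mulgA tau_tau mulg1.
Qed.

Lemma gen_group (P : gT -> Prop) : P 1%g -> (forall g h, P g -> P h -> P (g * h)%g) ->
  P sigma -> P tau -> forall g, P g.
Proof.
move=> P1 PM Ps Pt g; pose Q := [set g : gT | `[< P g >]].
have gQ : group_set Q.
  apply/group_setP; split; first by rewrite inE; apply/asboolP.
  by move=> a b; rewrite !inE => /asboolP Pa /asboolP Pb; apply/asboolP/PM.
suff sGQ : G \subset Group gQ.
  by have /(subsetP sGQ) := galT g; rewrite inE => /asboolP.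
by rewrite -G_gen gen_subG subUset !sub1set !inE; apply/andP; split; apply/asboolP.
Qed.

Lemma N_conj g u : (u ^ lambda g \in N)%g = (u \in N).
Proof.
have half h q : q \in N -> (q ^ lambda h \in N)%g.
  move: h q; apply: gen_group => [q|g' h' IHg IHh q qN|q qN|q qN].
  - by rewrite left_translation1 conjg1.
  - by rewrite left_translationM conjgM IHh // IHg.
  - by rewrite groupJ // cycle_id.
  have /cycleP[n ->] := qN; rewrite conjXg groupX //.
  have -> : (lambda sigma ^ lambda tau = (lambda sigma)^-1)%g.
    rewrite conjgE -!left_translationV -!left_translationM; congr (lambda _).
      by rewrite tauV mulgA tau_sigma -mulgA tau_tau mulg1.
  by rewrite groupV cycle_id.
apply/idP/idP; last exact: half.
by move=> /(half g^-1%g); rewrite left_translationV conjgK.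
Qed.

Lemma dihedral_H_mul f h : H f -> H h -> H (f * h).
Proof.
move=> [fN fG] [hN hG]; split=> [u uN|g gG u uN].
  rewrite ffunE big1 // => k _; have [kN|kN] := boolP (k \in N); last by rewrite fN // mul0r.
  by rewrite hN ?mulr0 // groupMr ?groupV.
rewrite !ffunE rmorph_sum (reindex_inj (conjg_inj (lambda g))) /=; apply: eq_bigr => k _.
rewrite rmorphM; have [kN|kN] := boolP (k \in N); last first.
  by rewrite !fN ?N_conj // rmorph0 !mul0r.
by rewrite fG // -conjVg -conjMg hG // groupMr ?groupV.
Qed.

Lemma dihedral_H_add f h : H f -> H h -> H (f + h).
Proof.
move=> [fN fG] [hN hG]; split=> [u uN|g gG u uN]; first by rewrite ffunE fN ?hN ?addr0.
by rewrite !ffunE rmorphD fG ?hG.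
Qed.

Lemma dihedral_H_scale (k : K) h : H h -> H (k *: h).
Proof.
move=> [hN hG]; split=> [u uN|g gG u uN]; first by rewrite ffunE hN ?scaler0.
by rewrite !ffunE linearZ hG.
Qed.

Lemma dihedral_H_1 : H 1.
Proof.
split=> [u uN|g gG u uN]; rewrite !ffunE.
  by case: eqP => // u1; rewrite u1 group1 in uN.
by rewrite rmorph_nat; congr (_%:R); rewrite -{1}[1%g](conj1g (lambda g)) (inj_eq (conjg_inj _)).
Qed.

Lemma dihedral_H_w : H w.
Proof. exact: dihedral_w_in. Qed.

Lemma dihedral_H_X i : H (w ^+ i).
Proof.
elim: i => [|i IHi]; first exact: dihedral_H_1.
by rewrite exprS; apply: dihedral_H_mul => //; apply: dihedral_H_w.
Qed.

Lemma act_1 x : tau x = x -> act 1 x = x.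
Proof.
move=> tx; rewrite (hopf_actE dihedral_H_1) // (bigD1 1%g) ?group1 //= big1 => [|g /andP[gS g1]].
  by rewrite /hcoef ffunE invg1 left_translation1 eqxx mul1r gal_id addr0.
rewrite /hcoef ffunE; case: eqP => [E1|]; last by rewrite mul0r.
case/eqP: g1; apply: lambda_inj => //.
by apply: (mulgI (lambda g^-1%g)); rewrite -left_translationM mulVg left_translation1 E1 mul1g.
Qed.

Lemma w_mulE h u : (w * h) u = z * (h (u * lambda sigma)%g - h (u * (lambda sigma)^-1)%g).
Proof.
have E2 (k : {perm {set gT}}) : \sum_q z * (q == k)%:R * h (u * q^-1)%g = z * h (u * k^-1)%g.
  rewrite (bigD1 k) //= eqxx mulr1 big1 ?addr0 // => q /negPf->.
  by rewrite mulr0 mul0r.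
rewrite ffunE; under eq_bigr => q _ do rewrite !ffunE mulrBr mulrBl.
by rewrite sumrB !E2 invgK mulrBr.
Qed.

(** From this case multiplicativity extends to polynomials in [w] as left factors ([actL_mul]),
    hence to all of H by [dihedral_H_wpoly]. *)
Lemma act_w_mul h x : H h -> tau x = x -> act (w * h) x = wact (act h x).
Proof.
move=> hH tx; have whH := dihedral_H_mul dihedral_H_w hH; rewrite !hopf_actE // /wact !raddf_sum /=.
have sS : sigma \in S by apply: cycle_id.
have sVS : (sigma^-1)%g \in S by rewrite groupV.
have shift k : k \in S -> \sum_(g in S) hcoef h (k * g)%g * g x =
    \sum_(g in S) (k^-1)%g (hcoef h g * g x).
  move=> kS; rewrite [RHS](reindex_inj (mulgI k)) /=.
  apply: eq_big => [g|g gS]; first by rewrite groupMl.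
  rewrite rmorphM /= hcoef_fixed ?groupM ?groupV //; congr (_ * _).
  by rewrite S_commute // galM ?memvf // -[RHS]galM ?memvf // mulgV gal_id.
have -> : \sum_(g in S) sigma (hcoef h g * g x) = \sum_(g in S) hcoef h (sigma^-1 * g)%g * g x.
  by rewrite (shift sigma^-1%g) // invgK.
rewrite sumrN -(shift sigma) // -sumrB mulr_sumr; apply: eq_bigr => g gS.
rewrite /hcoef w_mulE -left_translationV -!left_translationM !invMg !invgK.
by rewrite -mulrBl mulrA.
Qed.

Lemma act_X i x : tau x = x -> act (w ^+ i) x = iter i wact x.
Proof.
move=> tx; elim: i => [|i IHi]; first exact: act_1.
by rewrite exprS act_w_mul ?IHi //; apply: dihedral_H_X.
Qed.

(* E = L + z L, so by independence of characters H acts faithfully on L. *)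
Lemma act_faithful h : H h -> (forall x, tau x = x -> act h x = 0) -> h = 0.
Proof.
move=> hH h0; have hc0 x : \sum_(g in S) hcoef h g * g x = 0.
  have tt y : tau (tau y) = y by rewrite -galM ?memvf // tau_tau gal_id.
  have A : \sum_(g in S) hcoef h g * g (x + tau x) = 0.
    by rewrite -hopf_actE ?h0 //; rewrite rmorphD /= tt addrC.
  have B : \sum_(g in S) hcoef h g * g (z * (x - tau x)) = 0.
    by rewrite -hopf_actE ?h0 //; rewrite rmorphM rmorphB /= tt tz mulNr -mulrN opprB.
  have {}B : \sum_(g in S) hcoef h g * g (x - tau x) = 0.
    apply: (mulfI z0); rewrite mulr0 -[RHS]B mulr_sumr; apply: eq_bigr => g gS.
    by rewrite rmorphM /= z_fixed // mulrCA.
  apply: (mulfI two_neq0); rewrite mulr0 mulr_sumr.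
  have := congr2 +%R A B; rewrite addr0 -big_split /=; apply: etrans.
  apply: eq_bigr => g gS /=.
  by rewrite -mulrDr -rmorphD addrACA subrr addr0 /= -mulr2n rmorphMn mulrnAr mulr_natl.
have hc := gal_independent (fun x _ => hc0 x).
apply/ffunP => u; rewrite ffunE; have [uN|uN] := boolP (u \in N); last by case: hH => ->.
have := uN; rewrite lambda_S => /imsetP[g gS ->].
by have := hc g^-1%g; rewrite /hcoef groupV invgK; apply.
Qed.

Variables (L : {subfield E}) (memL : forall x, (x \in L) = (tau x == x)).
Local Notation V := (subvs_of L).
Local Notation OL := (integers v (mem L)).
Local Notation A := (associated_order sigma tau OL).

Lemma fixL (x : V) : tau (vsval x) = vsval x.
Proof. by apply/eqP; rewrite -memL subvsP. Qed.

Definition onL (f : E -> E) (x : V) : V := vsproj L (f (vsval x)).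

Lemma onLE f x : (forall y, tau y = y -> tau (f y) = f y) -> vsval (onL f x) = f (vsval x).
Proof. by move=> hf; rewrite vsprojK // memL hf ?fixL. Qed.

Lemma iter_onL f i x : (forall y, tau y = y -> tau (f y) = f y) ->
  vsval (iter i (onL f) x) = iter i f (vsval x).
Proof. by move=> hf; elim: i => //= i IHi; rewrite onLE // IHi. Qed.

Lemma onL_lin f : linear f -> linear (onL f).
Proof. by move=> hf k x y; rewrite /onL linearP /= hf linearP. Qed.

Definition actL h := onL (act h).

Lemma actLE h x : H h -> vsval (actL h x) = act h (vsval x).
Proof. by move=> hH; rewrite onLE // => y; apply: act_tau. Qed.

Lemma actL_lin h : linear (actL h).
Proof. by apply: onL_lin => k x y; rewrite act_additive act_scale. Qed.

Definition wL := onL wact.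

Lemma wact_tau y : tau y = y -> tau (wact y) = wact y.
Proof.
by move=> ty; rewrite /wact -(dihedral_w_act sigma z ty); apply: act_tau => //; apply: dihedral_H_w.
Qed.

Lemma wLE x : vsval (wL x) = wact (vsval x).
Proof. by rewrite onLE // => y; apply: wact_tau. Qed.

Lemma wL_lin : linear wL.
Proof.
apply: onL_lin => k x y; rewrite /wact !linearP /=.
by rewrite addrACA -scalerDr mulrDr scalerAr.
Qed.

Lemma actL_wL h x : H h -> actL h (wL x) = wL (actL h x).
Proof.
move=> hH; apply: val_inj => /=; rewrite actLE // !wLE actLE //.
by rewrite act_wact ?fixL // wact_tau ?fixL.
Qed.

Lemma actL_X i x : actL (w ^+ i) x = iter i wL x.
Proof.
apply: val_inj => /=; rewrite actLE ?iter_onL; last exact: dihedral_H_X.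
  by rewrite act_X ?fixL.
by move=> y; apply: wact_tau.
Qed.

Definition wpoly (c : 'I_p -> K) := \sum_i c i *: w ^+ i.

Lemma wpoly_H c : H (wpoly c).
Proof.
rewrite /wpoly; elim/big_ind: _ => [|f g|i _]; last by apply/dihedral_H_scale/dihedral_H_X.
  by rewrite -(scale0r (1 : permalg E _)); apply/dihedral_H_scale/dihedral_H_1.
exact: dihedral_H_add.
Qed.

Lemma actL_add f h x : actL (f + h) x = actL f x + actL h x.
Proof. by rewrite /actL /onL act_addl linearD. Qed.

Lemma actL_scale k h x : actL (k *: h) x = k *: actL h x.
Proof. by rewrite /actL /onL act_scalel linearZ. Qed.

Lemma actL_wpoly c x : actL (wpoly c) x = pw wL c x.
Proof.
rewrite /actL /onL act_suml linear_sum /=; apply: eq_bigr => i _.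
by rewrite act_scalel linearZ /= -actL_X.
Qed.

Lemma actL_faithful h : H h -> (forall x, actL h x = 0) -> h = 0.
Proof.
move=> hH h0; apply: act_faithful => // x tx.
have xL : x \in L by rewrite memL tx.
by have := congr1 vsval (h0 (vsproj L x)); rewrite actLE // vsprojK // linear0.
Qed.

Lemma actL_mul f h x : H f -> H h -> (exists c, f = wpoly c) ->
  actL (f * h) x = actL f (actL h x).
Proof.
move=> fH hH [c fE]; apply: val_inj => /=; rewrite actLE; last exact: dihedral_H_mul.
rewrite fE actL_wpoly /pw linear_sum /wpoly mulr_suml act_suml; apply: eq_bigr => i _.
rewrite -scalerAl act_scalel linearZ /= iter_onL; last by move=> y; apply: wact_tau.
rewrite actLE //; congr (_ *: _); elim: (i : nat) => [|k IHk].
  by rewrite expr0 mul1r.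
by rewrite exprS -mulrA act_w_mul // ?IHk ?fixL //; apply: dihedral_H_mul => //; apply: dihedral_H_X.
Qed.

Section CyclicVector.
Variables (x0 : V) (cyc : forall y, exists c : 'I_p -> K, y = pw wL c x0).

(** The action of [h] commutes with that of [w], so it is the action of a polynomial in [w];
    faithfulness turns this into an equality in H. *)
Lemma dihedral_H_wpoly h : H h -> exists c, h = wpoly c.
Proof.
move=> hH; have [||c hc] := @commutant _ _ p _ wL_lin x0 (actL h) cyc.
- exact: actL_lin.
- by move=> y; apply: actL_wL.
exists c; apply/eqP; rewrite -subr_eq0; apply/eqP/actL_faithful => [|x].
  by rewrite -scaleN1r; apply: dihedral_H_add => //; apply: dihedral_H_scale (wpoly_H c).
by rewrite -scaleN1r actL_add actL_scale scaleN1r actL_wpoly hc subrr.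
Qed.

Lemma actL_comm f h x : H f -> H h -> actL f (actL h x) = actL h (actL f x).
Proof.
move=> fH hH; have [c ->] := dihedral_H_wpoly fH; rewrite !actL_wpoly.
by apply/esym/pw_comm => [|y]; [apply: actL_lin | apply: actL_wL].
Qed.

Variable vL : V -> int.
Variables (hV : valued_space vK vL p) (int_vL : forall y, vge vL 0 y = vge v 0 (vsval y)).
Hypothesis wL_int : forall y, vge vL 0 y -> vge vL 0 (wL y).
Variables (pi : K) (pi0 : pi != 0) (vpi : vK pi = 1).

Lemma OLE x : OL x <-> exists2 y : V, x = vsval y & vge vL 0 y.
Proof.
split=> [/andP[xL x_int]|[y -> y_int]]; last first.
  by rewrite int_vL in y_int; apply/andP; split; [apply: subvsP | exact: y_int].
by exists (vsproj L x); rewrite ?int_vL vsprojK.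
Qed.

Lemma associated_orderE h :
  A h <-> H h /\ forall y, vge vL 0 y -> vge vL 0 (actL h y).
Proof.
split=> [[hH hO]|[hH hO]]; split=> // x.
  move=> x_int; have /OLE[y yE y_int] : OL (act h (vsval x)).
    by apply: hO; apply/OLE; exists x.
  by rewrite int_vL actLE // yE -int_vL.
by case/OLE => y -> y_int; apply/OLE; exists (actL h y); rewrite ?actLE //; apply: hO.
Qed.

Lemma associated_wpoly c :
  A (wpoly c) <-> forall y, vge vL 0 y -> vge vL 0 (pw wL c y).
Proof.
split=> [/associated_orderE[_ hO] y /hO|hO]; first by rewrite actL_wpoly.
by apply/associated_orderE; split=> [|y /hO]; [apply: wpoly_H | rewrite actL_wpoly].
Qed.

Lemma associated_one : A 1.
Proof.
apply/associated_orderE; split=> [|y]; first exact: dihedral_H_1.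
by rewrite -(expr0 w) actL_X.
Qed.

Lemma associated_mul f h : A f -> A h -> A (f * h).
Proof.
move=> /associated_orderE[fH fO] /associated_orderE[hH hO]; apply/associated_orderE.
split=> [|y y_int]; first exact: dihedral_H_mul.
by rewrite actL_mul //; [apply/fO/hO | apply: dihedral_H_wpoly].
Qed.

Lemma associatedD f h : A f -> A h -> A (f + h).
Proof.
move=> /associated_orderE[fH fO] /associated_orderE[hH hO]; apply/associated_orderE.
split=> [|y y_int]; first exact: dihedral_H_add.
by rewrite actL_add (vgeD (valued_ultra hV)) ?fO ?hO.
Qed.

Lemma associatedZ (k : K) h : vge vK 0 k -> A h -> A (k *: h).
Proof.
move=> k_int /associated_orderE[hH hO]; apply/associated_orderE.
split=> [|y y_int]; first exact: dihedral_H_scale.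
by rewrite actL_scale (vgeZ0 hV) ?hO.
Qed.

Lemma associated0 : A 0.
Proof. by rewrite -(scale0r 1); apply/associatedZ/associated_one/vge0. Qed.

Lemma scale_integral (n : nat) (c : 'I_n -> K) :
  exists k : nat, forall i, vge vK 0 (pi ^+ k * c i).
Proof.
pose k := \max_i `|vK (c i)|%N; exists k => i.
have [->|ci] := eqVneq (c i) 0; first by rewrite mulr0 vge0.
rewrite vge_leq // (valM hK) ?expf_neq0 // (nvalX hK) // vpi mulr1.
have : (`|vK (c i)| <= k)%N by apply: (leq_bigmax (F := fun i => `|vK (c i)|%N)).
by move: (vK (c i)) k => a b; clear; lia.
Qed.

Lemma associated_scale h : H h -> exists k : nat, A (pi ^+ k *: h).
Proof.
move=> hH; have [c ->] := dihedral_H_wpoly hH; have [k hk] := scale_integral c.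
exists k; apply/associated_orderE; split=> [|y y_int]; first exact/dihedral_H_scale/wpoly_H.
rewrite actL_scale actL_wpoly scaler_sumr; apply: vge_sum (valued_ultra hV) _ _ _ _ _ _ => i _.
rewrite scalerA; apply: (vgeZ0 hV) => //.
by elim: (i : nat) => //= j; apply: wL_int.
Qed.

Lemma integral_multiple (y : V) : exists k : nat, vge vL 0 (pi ^+ k *: y).
Proof.
have [->|y0] := eqVneq y 0; first by exists 0%N; rewrite scaler0 vge0.
exists `|vL y|%N; rewrite vge_leq // (valuedZ hV) ?expf_neq0 // (nvalX hK) // vpi mulr1.
by move: (valued_pos hV) (vL y); clear; nia.
Qed.

(* Two vectors [y0 = f x0] and [y1 = g x0] of a basis would satisfy the relation *)
(* [g y0 = f y1], as [H] is commutative; so a basis has one element.              *)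
Lemma principal_free : principal vL wL <->  is_free A act OL.
Proof.
split=> [[x x_int x_gen]|[n [b [bO b_gen b_free]]]].
  exists 1%N, (fun=> vsval x); split=> [i|y /OLE[y' -> y_int]|c cA].
  - by apply/OLE; exists x.
  - have [h [h_lin h_comm h_int] ->] := x_gen _ y_int.
    have [c hc] := commutant wL_lin cyc h_lin h_comm.
    exists (fun=> wpoly c) => [_|]; first by apply/associated_wpoly => u /h_int; rewrite hc.
    by rewrite big_ord1 -actLE ?actL_wpoly ?hc //; apply: wpoly_H.
  rewrite big_ord1 => cx i; rewrite ord1; have [cH _] := cA ord0.
  apply: actL_faithful => // y; have {}cx : actL (c ord0) x = 0.
    by apply: val_inj; rewrite /= actLE // cx linear0.
  have [k y_int] := integral_multiple y.
  have [h [h_lin h_comm _] yE] := x_gen _ y_int.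
  have [d hd] := commutant wL_lin cyc h_lin h_comm.
  have dH := wpoly_H d; have := actL_comm x cH dH.
  rewrite cx [RHS](lin0 (actL_lin _)) actL_wpoly -hd -yE (linZ (actL_lin _)) => /eqP.
  by rewrite scaler_eq0 expf_eq0 (negPf pi0) andbF /= => /eqP.
have fixb i : tau (b i) = b i by have /OLE[y -> _] := bO i; apply: fixL.
have b_neq0 i : b i != 0.
  apply/eqP => bi; pose c j : permalg E {set gT} := if j == i then 1 else 0.
  have cA j : A (c j) by rewrite /c; case: ifP => _; [apply: associated_one|apply: associated0].
  have /(b_free _ cA)/(_ i)/eqP : \sum_j act (c j) (b j) = 0.
    by rewrite /c big1 // => j _; case: eqP => [->|_]; rewrite ?act_0l // act_1.
  by rewrite /c eqxx oner_eq0.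
case: n b bO b_gen b_free fixb b_neq0 => [|[|n]] b bO b_gen b_free fixb b_neq0.
- have [k y_int] := integral_multiple (vsproj L 1).
  have /b_gen[c _] : OL (vsval (pi ^+ k *: vsproj L 1)) by apply/OLE; eexists.
  rewrite big_ord0 linearZ /= vsprojK ?mem1v // => /eqP.
  by rewrite scaler_eq0 expf_eq0 (negPf pi0) andbF oner_eq0.
- have /OLE[x xE x_int] := bO ord0; exists x => // y y_int.
  have /b_gen[c cA] : OL (vsval y) by apply/OLE; exists y.
  rewrite big_ord1 xE; have /associated_orderE[cH cO] := cA ord0.
  rewrite -actLE // => /val_inj->; exists (actL (c ord0)) => //.
  by split=> // [|u]; [apply: actL_lin | apply: actL_wL].
exfalso; pose i1 : 'I_n.+2 := lift ord0 ord0.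
have /OLE[y0 y0E _] := bO ord0; have /OLE[y1 y1E _] := bO i1.
have [f fE] := cyc y0; have [g gE] := cyc y1.
have [k kA] := associated_scale (wpoly_H f); have [m mA] := associated_scale (wpoly_H g).
have pi_int j : vge vK 0 (pi ^+ j) by rewrite (vgeX hK) // vge_leq // vpi.
pose c (j : 'I_n.+2) : permalg E {set gT} := if j == ord0 then pi ^+ k *: (pi ^+ m *: wpoly g)
  else if j == i1 then (- pi ^+ m) *: (pi ^+ k *: wpoly f) else 0.
have cA j : A (c j).
  rewrite /c; case: ifP => _; first exact: associatedZ.
  case: ifP => _; last exact: associated0.
  by apply: associatedZ; rewrite ?(vgeN (nval_ultra hK)).
have : \sum_j act (c j) (b j) = 0.
  rewrite big_ord_recl big_ord_recl big1 => [|j _] /=; last by rewrite act_0l.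
  rewrite addr0 y0E y1E -!actLE; do ?[exact: wpoly_H|apply: dihedral_H_scale].
  rewrite !actL_scale fE gE -!actL_wpoly (actL_comm _ (wpoly_H f) (wpoly_H g)).
  by rewrite !linearZ /= scaleNr !scalerA mulrC subrr.
move=> /(b_free _ cA)/(_ i1)/eqP; rewrite /c /= scalerA scaler_eq0 mulf_eq0 oppr_eq0.
rewrite !expf_eq0 (negPf pi0) !andbF /= => /eqP f0.
have := b_neq0 ord0; rewrite y0E fE -actL_wpoly f0.
by rewrite /actL /onL act_0l !linear0 eqxx.
Qed.

Lemma associated_sum n (c : 'I_n -> K) (b : 'I_n -> permalg E {set gT}) :
  (forall i, vge vK 0 (c i)) -> (forall i, A (b i)) -> A (\sum_i c i *: b i).
Proof.
move=> c_int bA; elim/big_ind: _ => [|f g|i _]; first exact: associated0.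
  exact: associatedD.
exact: associatedZ.
Qed.

Section Coefficients.
Variable n : 'I_p -> nat.
Hypothesis coefE : forall c, (forall y, vge vL 0 y -> vge vL 0 (pw wL c y)) <->
  (forall i, vge vK (- (n i)%:Z) (c i)).

Lemma associated_basis : is_basis (integers vK predT) *:%R A (fun i => pi ^- n i *: w ^+ i).
Proof.
have vpiV i : vK (pi ^- n i) = - (n i)%:Z by rewrite (nvalXV hK) // vpi mulr1.
have piV0 i : pi ^- n i != 0 by rewrite invr_eq0 expf_neq0.
have sumE c : \sum_i c i *: (pi ^- n i *: w ^+ i) = wpoly (fun i => c i * pi ^- n i).
  by apply: eq_bigr => i _; rewrite scalerA.
split=> [i|h hA|c _].
- have -> : pi ^- n i *: w ^+ i = wpoly (fun j => if j == i then pi ^- n i else 0).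
    rewrite /wpoly (bigD1 i) //= eqxx big1 ?addr0 // => j /negPf->.
    by rewrite scale0r.
  apply/associated_wpoly/coefE => j; case: eqP => [->|_]; rewrite ?(vge0 vK) //.
  by rewrite vge_leq // vpiV.
- have [hH _] := hA; have [c hE] := dihedral_H_wpoly hH; exists (fun i => c i * pi ^+ n i).
    move=> i; apply/andP; split=> //; move: hA; rewrite hE => /associated_wpoly/coefE/(_ i) ci.
    rewrite -(addNr (n i)%:Z); apply: (vgeM hK) => //.
    by rewrite vge_leq // (nvalX hK) // vpi mulr1.
  rewrite sumE hE; apply: eq_bigr => i _; congr (_ *: _).
  by rewrite -mulrA mulfV ?mulr1 // expf_neq0.
(* A relation equal to 0 stays integral after division by any power of [pi], so each [c i] is
   divisible by all of them. *)
rewrite sumE => c0 i; have c_ge k : vge vK (- (n i)%:Z) (pi ^- k * (c i * pi ^- n i)).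
  move: i; apply/coefE => y _; rewrite pwZ -actL_wpoly c0 /actL /onL act_0l linear0 scaler0.
  exact: vge0.
apply/eqP; apply: contraT => ci0; have := c_ge (`|vK (c i)|.+1)%N.
rewrite vgeE ?mulf_neq0 ?invr_eq0 ?expf_neq0 // !(valM hK) ?mulf_neq0 ?invr_eq0 ?expf_neq0 //.
rewrite !(nvalXV hK) // vpi; move: (vK (c i)) (n i); clear; lia.
Qed.

Lemma associated_is_order : is_order (integers vK predT) H A.
Proof.
have [bA b_gen _] := associated_basis; split.
- by move=> h [].
- exact: associated_one.
- exact: associated_mul.
- exists p, (fun i => pi ^- n i *: w ^+ i) => h; split=> [/b_gen//|[c c_int ->]].
  by apply: associated_sum => // i; have /andP[] := c_int i.
- move=> h hH; have [k hA] := associated_scale hH.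
  exists 1%N, (fun=> pi ^- k), (fun=> pi ^+ k *: h); split=> //.
  by rewrite big_ord1 scalerA mulVf ?scale1r // expf_neq0.
Qed.

Lemma actL_exp h k x : H h -> H (h ^+ k) /\ actL (h ^+ k) x = iter k (actL h) x.
Proof.
move=> hH; elim: k => [|k [IHH IH]].
  by rewrite expr0 -[X in actL X](expr0 w) actL_X; split=> //; apply: dihedral_H_1.
rewrite exprS; split; first exact: dihedral_H_mul.
by rewrite actL_mul ?IH //; apply: dihedral_H_wpoly.
Qed.

(* The powers of an element of an order stay in a finitely generated module. *)
Lemma associated_maximal :
  (forall h, H h -> ~ A h -> exists y, forall k : nat, exists m,
    ~~ vge vL (- k%:Z) (iter m (actL h) y)) ->
  is_the_maximal_order (integers vK predT) H A.
Proof.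
move=> unbounded; have AO := associated_is_order.
have sub C : is_order (integers vK predT) H C -> forall h, C h -> A h.
  move=> CO h hC; have hH := order_sub CO hC; apply: contrapT => /(unbounded _ hH)[y y_unb].
  have [r [b bE]] := order_fg CO; pose B := \max_i `|vL (actL (b i) y)|%N.
  have [m] := y_unb B; apply/negP/negPn; have [hmH <-] := actL_exp m y hH.
  have /bE[c c_int ->] : C (h ^+ m).
    elim: m {hmH} => [|m IHm]; first by rewrite expr0; apply: order_one CO.
    by rewrite exprS; apply: (order_mul CO).
  rewrite /actL /onL act_suml linear_sum /=; apply: (vge_sum (valued_ultra hV)) => i _.
  rewrite act_scalel linearZ /= -/(onL _ _) -/(actL _ _); apply: (vgeZ0 hV).
    by have /andP[] := c_int i.
  apply: vge_leq; have := leq_bigmax (F := fun i => `|vL (actL (b i) y)|%N) i.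
  by rewrite -/B; move: (vL _) B => a B; clear; lia.
split; first by split=> // C CO _; apply: sub.
move=> C [CO Cmax] h; split; first exact: sub.
by apply: Cmax => //; apply: sub.
Qed.
End Coefficients.
End CyclicVector.

End HopfAlgebra.

(** With a cyclic vector for [w], the operator [w'] is a polynomial in [w], so whatever commutes
    with [w] commutes with [w']. This permits exchanging the two operators. *)
Lemma preserving_commuting (K : fieldType) (V : lmodType K) (v : V -> int) (p : nat)
    (w w' : V -> V) (x : V) : linear w -> linear w' -> (forall y, w' (w y) = w (w' y)) ->
  (forall y, exists c : 'I_p -> K, y = pw w c x) ->
  forall h, preserving v w h -> preserving v w' h.
Proof.
move=> w_lin w'_lin ww' cyc h [h_lin hw h_int]; split=> // y.
have [c w'E] := commutant w_lin cyc w'_lin ww'.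
by rewrite !w'E; apply: pw_comm.
Qed.

Lemma principal_commuting (K : fieldType) (V : lmodType K) (v : V -> int) (p : nat)
    (w w' : V -> V) (x : V) : linear w -> linear w' -> (forall y, w' (w y) = w (w' y)) ->
  (forall y, exists c : 'I_p -> K, y = pw w c x) ->
  principal v w -> principal v w'.
Proof.
move=> w_lin w'_lin ww' cyc [y y_int y_gen]; exists y => // u /y_gen[h hP ->].
by exists h => //; apply: preserving_commuting cyc _ hP.
Qed.

(** * Restriction to the fixed field of [tau] *)

Section DihedralFixedField.
Variables (K : fieldType) (vK : K -> int) (hK : normalized_valuation vK).
Variables (E : splittingFieldType K) (v : E -> int) (hv : normalized_valuation v).
Variables (p : nat) (p_prime : prime p) (p_odd : odd p).
Hypothesis dimE : \dim {:E} = (2 * p)%N.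
Hypothesis ram : forall c : K, c != 0 -> v c%:A = (2 * p)%N%:Z * vK c.
Variables (e : nat) (e_gt0 : (0 < e)%N).
Hypothesis nat_val : forall n, (0 < n)%N -> n%:R != 0 :> K /\ vK n%:R = (e * logn p n)%N%:Z.
Variables (Pi : E) (Pi0 : Pi != 0) (vPi : v Pi = 1).
Local Notation gT := (gal_of {:E}).
Variables sigma tau : gT.
Hypotheses (G_gen : <<[set sigma; tau]>>%g = ('Gal({:E} / 1%AS))%g)
  (sigma_order : #[sigma]%g = p) (tau_order : #[tau]%g = 2%N)
  (tau_sigma : (tau * sigma = sigma^-1 * tau)%g).
Hypothesis K_fixed : forall y, sigma y = y -> tau y = y -> exists k : K, y = k%:A.
Variables (t : nat) (t_gt0 : (0 < t)%N).
Hypothesis sigma_jump : forall y, vge v 0 y -> vge v t.+1%:Z (sigma y - y).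
Hypothesis sigma_jump_max : exists2 y, vge v 0 y & ~~ vge v t.+2%:Z (sigma y - y).
Variables (z : E) (z0 : z != 0) (sz : sigma z = z) (tz : tau z = - z).
Hypothesis z_min : forall y, sigma y = y -> y != 0 -> 0 < v y -> v z <= v y.
Hypothesis z_gt0 : 0 < v z.
Variables (L : {subfield E}) (memL : forall x, (x \in L) = (tau x == x)).
Hypothesis dimL : \dim L = p.
Variables (pi : K) (pi0 : pi != 0) (vpi : vK pi = 1).
Local Notation V := (subvs_of L).
Local Notation H := (dihedral_H sigma tau).
Local Notation w := (dihedral_w sigma tau z).
Local Notation act := (dihedral_act tau).
Local Notation OL := (integers v (mem L)).
Local Notation A := (associated_order sigma tau OL).
Local Notation wV := (@wL _ _ sigma z L).

Let p_gt0 := prime_gt0 p_prime.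
Let d_gt0 : (0 < 2 * p)%N. Proof. by rewrite muln_gt0. Qed.
Let uE := nval_ultra hv.

Lemma sigma_p y : iter p sigma y = y.
Proof. by rewrite iter_gal -sigma_order expg_order gal_id. Qed.

Lemma tau_tau y : tau (tau y) = y.
Proof.
by rewrite -galM ?memvf // (_ : tau * tau = 1)%g ?gal_id // -(expg_order tau) tau_order expgS expg1.
Qed.

Lemma sigma_tau y : sigma (tau (sigma y)) = tau y.
Proof. by rewrite -!galM ?memvf // ?mulgA -?mulgA tau_sigma mulKVg. Qed.

Lemma wact_wop y : wact sigma z y = wop p sigma z y.
Proof.
rewrite /wact /wop /udiff iter_gal; congr (_ * (_ - (_ : gT) y)).
by apply: (mulgI sigma); rewrite mulgV -expgS prednK // -sigma_order expg_order.
Qed.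

Let two_neq0 : (2%:R : E) != 0.
Proof.
have p2 : ~~ (p%:Z %| 2)%Z by rewrite dvdzE /= gtnNdvd ?odd_prime_gt2.
by have [] := int_unitE hK ram nat_val p2.
Qed.

(** The normalized valuation of [L]; the division is exact on nonzero elements by [val_even]. *)
Definition vL (y : V) : int := (v (vsval y) %/ 2)%Z.

Lemma vL_neq0 (y : V) : (y != 0) = (vsval y != 0).
Proof. by rewrite -(inj_eq val_inj) linear0. Qed.

Lemma val_L y : y != 0 -> v (vsval y) = 2 * vL y.
Proof.
move=> y0; have /dvdzP[k vk] : (2%:Z %| v (vsval y))%Z.
  apply: (val_even hK hv p_prime dimE ram Pi0 vPi sigma_p sigma_tau K_fixed).
    by rewrite -vL_neq0.
  exact: fixL.
by rewrite /vL vk mulzK // mulrC.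
Qed.

Lemma vge_L n y : vge vL n y = vge v (2 * n) (vsval y).
Proof.
have [->|y0] := eqVneq y 0; first by rewrite linear0 !vge0.
have y0' : vsval y != 0 by rewrite -vL_neq0.
by rewrite !vgeE // (val_L y0) ler_pM2l.
Qed.

Lemma vge_L_odd n y : vge v (2 * n + 1) (vsval y) -> vge vL (n + 1) y.
Proof.
have [->|y0] := eqVneq y 0; first by move=> _; apply: vge0.
have y0' : vsval y != 0 by rewrite -vL_neq0.
by rewrite !vgeE // (val_L y0); move: (vL y) => k; clear; lia.
Qed.

Lemma val_vL y m : vsval y != 0 -> v (vsval y) = 2 * m -> y != 0 /\ vL y = m.
Proof.
move=> y0 vy; have y0' : y != 0 by rewrite vL_neq0.
by split=> //; move: (val_L y0'); rewrite vy; clear; lia.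
Qed.

Lemma L_space : valued_space vK vL p.
Proof.
split=> //.
- split=> [x y x0 y0 xy0|y].
    have [x0' y0' xy0'] : [/\ vsval x != 0, vsval y != 0 & vsval (x + y) != 0].
      by rewrite -!vL_neq0.
    have := ultraD uE x0' y0' xy0'; rewrite -[vsval x + vsval y]/(vsval (x + y)).
    by rewrite !val_L // !ge_min !ler_pM2l.
  by rewrite /vL linearN /= (ultraN uE).
move=> c y c0 y0; apply: (@mulfI _ (2 : int)) => //; rewrite -val_L ?scaler_eq0 ?negb_or ?c0 //.
rewrite linearZ /= (valuedZ (ramified_space hv d_gt0 ram)) -?vL_neq0 //.
by rewrite val_L //; move: (vK c) (vL y) => a b; clear; lia.
Qed.

Lemma vL_onto m : exists2 y, y != 0 & vL y = m.
Proof.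
pose N := Pi * tau Pi.
have vtau : v (tau Pi) = 1 by rewrite (val_gal hK hv d_gt0 dimE ram Pi0 vPi).
have t0 : tau Pi != 0 by rewrite fmorph_eq0.
have N0 : N != 0 by rewrite mulf_neq0.
have vN : v N = 2 by rewrite (valM hv) // vPi vtau.
have tN : tau N = N by rewrite rmorphM /= tau_tau mulrC.
have NL y : tau y = y -> y != 0 -> v y = 2 * m -> exists2 y, y != 0 & vL y = m.
  move=> ty y0 vy; have yL : y \in L by rewrite memL ty.
  by have [] := @val_vL (vsproj L y) m; rewrite ?vsprojK //; exists (vsproj L y).
case: m NL => n NL.
  apply: (NL (N ^+ n)); rewrite ?expf_neq0 ?rmorphXn /= ?tN //.
  by rewrite (nvalX hv) // vN mulrC.
apply: (NL (N ^- n.+1)); rewrite ?invr_eq0 ?expf_neq0 ?fmorphV ?rmorphXn /= ?tN //.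
by rewrite (nvalXV hv) // vN NegzE mulrN mulrC.
Qed.

Local Notation l := ((p + t) %/ 2)%N.

Lemma double_l : (2 * l = p + t)%N.
Proof.
have t_odd := jump_odd hK hv p_prime p_odd dimE ram e_gt0 nat_val Pi0 vPi sigma_p tau_tau
  sigma_tau K_fixed t_gt0 sigma_jump sigma_jump_max z0 sz tz z_min z_gt0.
by move: p_odd t_odd; clear; lia.
Qed.

Lemma onL_raises f : linear f -> (forall y, tau y = y -> tau (f y) = f y) ->
  (forall n y, vge v n y -> vge v (n + (p + t)%N%:Z) (f y)) ->
  (forall y, y != 0 -> ~~ (p%:Z %| v y)%Z -> f y != 0 /\ v (f y) = v y + (p + t)%N%:Z) ->
  raises vL p l (onL (L := L) f).
Proof.
move=> f_lin f_tau f_ge f_eq; split; first exact: onL_lin.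
  move=> n y; rewrite !vge_L (onLE memL) // => /f_ge.
  by rewrite mulrDr -PoszM double_l.
move=> y y0 pvy; have [||fy0 vfy] := f_eq (vsval y); first by rewrite -vL_neq0.
  rewrite val_L // Gauss_dvdzr // coprimezE /= coprimen2 //.
by apply: val_vL; rewrite (onLE memL) // vfy val_L // mulrDr -PoszM double_l.
Qed.

Let wopE : wact sigma z = wop p sigma z.
Proof. by apply/funext => y; apply: wact_wop. Qed.

Let wop_tau y : tau y = y -> tau (wop p sigma z y) = wop p sigma z y.
Proof. exact: (wop_tau p_prime sigma_p sigma_tau tz). Qed.

Lemma wL_raises : raises vL p l wV.
Proof.
rewrite /wL wopE; apply: onL_raises => [|y|n y|y].
- exact: wop_lin.
- exact: wop_tau.
- exact: (wop_ge hK hv p_prime dimE ram Pi0 vPi sigma_p tau_tau sigma_tau K_fixed t_gt0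
    sigma_jump z0 sz z_min z_gt0).
exact: (wop_exact hK hv p_prime p_odd dimE ram e_gt0 nat_val Pi0 vPi sigma_p tau_tau
  sigma_tau K_fixed t_gt0 sigma_jump sigma_jump_max z0 sz z_min z_gt0).
Qed.

Lemma wL_p n m y : (2 * m <= 2 * n + t + 2 * p * e + p * p)%N -> vge vL n%:Z y ->
  vge vL m%:Z (iter p wV y).
Proof.
move=> le_mn; rewrite !vge_L (iter_onL memL); last by move=> u; rewrite wopE; apply: wop_tau.
rewrite wopE => /(wop_p hK hv p_prime p_odd dimE ram nat_val Pi0 vPi sigma_p tau_tau
  sigma_tau K_fixed t_gt0 sigma_jump z0 sz z_min z_gt0); apply: vge_trans.
by move: le_mn; clear; lia.
Qed.

Section Character.
Variable chi : 'F_p -> K.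
Hypotheses (chi0 : chi 0 = 0) (chi1 : chi 1 = 1) (chiM : {morph chi : a b / a * b}).
Hypothesis chi_int : forall a, vge vK 0 (chi a).
Hypothesis chi_inv : forall a : 'F_p, a != 0 -> vge vK 1 (chi a * (a : nat)%:R - 1).

Definition WV := onL (L := L) (@Wop _ _ p sigma z chi).

Let Wop_tau y : tau y = y -> tau (Wop sigma z chi y) = Wop sigma z chi y.
Proof. exact: (Wop_tau hK p_prime p_odd nat_val sigma_p sigma_tau tz chi1 chiM chi_inv). Qed.

Lemma WV_raises : raises vL p l WV.
Proof.
apply: onL_raises => [|y|n y|y].
- exact: Wop_lin.
- exact: Wop_tau.
- exact: (Wop_ge hK hv p_prime p_odd dimE ram e_gt0 nat_val Pi0 vPi sigma_p tau_tau
    sigma_tau K_fixed t_gt0 sigma_jump sigma_jump_max z0 sz z_min z_gt0 chiM chi_int chi_inv).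
exact: (Wop_exact hK hv p_prime p_odd dimE ram e_gt0 nat_val Pi0 vPi sigma_p tau_tau
  sigma_tau K_fixed t_gt0 sigma_jump sigma_jump_max z0 sz z_min z_gt0 chiM chi_int chi_inv).
Qed.

Lemma WV_wV y : WV (wV y) = wV (WV y).
Proof.
have wact_tau u : tau u = u -> tau (wact sigma z u) = wact sigma z u.
  by rewrite wopE; apply: wop_tau.
apply: val_inj; rewrite /= !(onLE memL) // wopE.
by rewrite Wop_wop.
Qed.

Lemma WV_1 : WV (vsproj L 1) = 0.
Proof.
apply: val_inj; rewrite /= (onLE memL) // vsprojK ?mem1v // /Wop.
rewrite (weighted_fixed hK p_prime p_odd chiM chi_inv) ?mulr0 ?linear0 //.
exact: rmorph1.
Qed.

Lemma WV_p : ~~ (p %| t)%N -> exists C : K, [/\ C != 0, vK C = (e + p.-1./2)%N%:Z &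
  forall y, iter p WV y = C *: WV y].
Proof.
move=> pt; have [C [C0 vC CE]] := Wop_p hK hv p_prime p_odd dimE ram e_gt0 nat_val Pi0 vPi
  sigma_p tau_tau sigma_tau K_fixed t_gt0 sigma_jump sigma_jump_max z0 sz tz z_min z_gt0
  chi1 chiM chi_int chi_inv pt.
exists C; split=> // y; apply: val_inj.
by rewrite /WV /= (iter_onL memL) // (onLE memL).
Qed.
End Character.

Lemma vL_1 : vL (vsproj L 1) = 0.
Proof. by rewrite /vL vsprojK ?mem1v // (nval1 hv) div0z. Qed.

Local Notation a := (l %% p)%N.

Section NonzeroResidue.
Hypothesis a_gt0 : (0 < a)%N.

(* When [0 < a], [X = 0] is the case [2pe / (p-1) - 2 <= t]. *)
Lemma jump_excess : exists2 X : nat, (2 * p * e = p.-1 * t + 2 * a + 2 * p * X)%N &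
  X = 0%N -> (e + p.-1./2)%N = nu p l a p.-1.
Proof.
have le := jump_bound hK hv p_prime p_odd dimE ram nat_val Pi0 vPi sigma_p tau_tau
  sigma_tau K_fixed t_gt0 sigma_jump.
have [r pE] : exists r, p = (2 * r).+1 by exists p./2; move: p_odd; clear; lia.
have lE := divn_eq l p; have a_lt := ltn_pmod l p_gt0.
have := double_l; rewrite /nu; move: (l) lE a_lt => L'; move: (L' %% p)%N (L' %/ p)%N => b q lE.
rewrite {1}lE => b_lt tE; have rE : (p.-1 = 2 * r)%N by rewrite pE.
have halfE : (p.-1./2 = r)%N by rewrite rE; clear; lia.
rewrite halfE rE in le *.
(* Substituting [2 * l = p + t] and [p = 2 * r + 1], one finds 2pe - (p-1)t - 2b = 2p(e + r - 2rq -
   b). By [jump_bound] this is at least -2b > -2p, so the last factor is nonnegative. *)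
have key : (2 * r * q + b <= e + r)%N.
  rewrite leqNgt; apply/negP => lt.
  have h1 : (2 * p * (e + r).+1 <= 2 * p * (2 * r * q + b))%N by rewrite leq_mul2l lt orbT.
  have h2 : (2 * r * (2 * (q * p + b)) = 2 * r * (p + t))%N by rewrite tE.
  have h3 : (p * b = (2 * r).+1 * b)%N by rewrite {1}pE.
  by move: le h1 h2 h3 b_lt; clear; nia.
exists (e + r - (2 * r * q + b))%N => [|X0].
  have h2 : (2 * r * (2 * (q * p + b)) = 2 * r * (p + t))%N by rewrite tE.
  have h3 : (p * b = (2 * r).+1 * b)%N by rewrite {1}pE.
  have h4 := congr1 (muln (2 * p)) (subnK key).
  by move: h2 h3 h4; clear; nia.
have -> : (b + 2 * r * L' = (b + 2 * r * q) * p)%N.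
  have h3 : (b * p = b * (2 * r).+1)%N by rewrite {1}pE.
  by rewrite lE; move: h3; clear; nia.
by rewrite mulnK //; move: X0 key; clear; lia.
Qed.
End NonzeroResidue.

Lemma dimV : \dim {:V} = p.
Proof. by rewrite dimvf. Qed.

Lemma vge0_L y : vge vL 0 y = vge v 0 (vsval y).
Proof. by rewrite vge_L mulr0. Qed.

Lemma wL_integral y : vge vL 0 y -> vge vL 0 (wV y).
Proof. by move=> /(raise_ge wL_raises); apply: vge_trans; rewrite add0r. Qed.

Local Notation O_L_free := (is_free A act OL).

Lemma free_principal (x : V) : (forall y, exists c : 'I_p -> K, y = pw wV c x) ->
  principal vL wV <-> O_L_free.
Proof.
move=> cyc; exact: (principal_free hK p_odd G_gen sigma_order tau_order tau_sigma z0 sz tz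
  two_neq0 memL cyc L_space vge0_L wL_integral pi0 vpi).
Qed.

Section NonzeroResidue.
Hypothesis a_gt0 : (0 < a)%N.

Section ResidueVector.
Variables (x : V) (x0 : x != 0) (vx : vL x = a%:Z).

Let cyc y : exists c : 'I_p -> K, y = pw wV c x :=
  pw_cyclic hK p_prime L_space dimV pi0 vpi wL_raises a_gt0 x0 vx y.

Let wrap_ge s : (p.-1 * t + 2 * a + 2 * s <= 2 * p * e)%N ->
  vge vL (2 * a + p * l + s)%N%:Z (iter p wV x).
Proof.
move=> le; apply: (@wL_p a); last by rewrite vge_leq // vx.
have pE : (p.-1 * t + t = p * t)%N by rewrite -mulSnr prednK.
have lE : (p * (2 * l) = p * p + p * t)%N by rewrite double_l mulnDr.
by move: le pE lE; move: (a) (l) (p.-1 * t)%N (p * t)%N; clear; nia.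
Qed.

Let wrap : vge vL (2 * a + p * l)%N%:Z (iter p wV x).
Proof.
have [X eq _] := jump_excess.
by rewrite -[(_ + p * l)%N]addn0; apply: wrap_ge; rewrite muln0 addn0 eq leq_addr.
Qed.

Let coefE := preserve_coef hK p_prime L_space dimV pi0 vpi wL_raises a_gt0 x0 vx wrap.

Lemma residue_basis : is_basis (integers vK predT) *:%R A
  (fun i : 'I_p => pi ^- w_exponent p l a i *: w ^+ i).
Proof.
exact: (associated_basis hK p_odd G_gen sigma_order tau_order tau_sigma z0 sz tz two_neq0 memL
  cyc vge0_L pi0 vpi coefE).
Qed.

Lemma free_if_dvd : (a %| p.-1)%N -> O_L_free.
Proof.
move=> dv; apply/(free_principal cyc).
apply: (principal_if hK p_prime L_space dimV pi0 vpi wL_raises a_gt0 x0 vx wrap).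
exact/(w_exponent_eq_nu p_prime a_gt0).
Qed.

Lemma dvd_if_free : (p.-1 * (t + 2) < 2 * p * e)%N -> O_L_free -> (a %| p.-1)%N.
Proof.
move=> lt /(free_principal cyc) prin; apply/(w_exponent_eq_nu p_prime a_gt0) => i i_lt.
apply: (principal_only_if hK p_prime L_space dimV pi0 vpi wL_raises a_gt0 x0 vx wrap) => //.
(* Here [X] is positive, as [X = 0] would give [a > p.-1]; a single unit of [X] is the surplus [p]
   that is required. *)
apply: wrap_ge; have [X eq _] := jump_excess; rewrite eq leq_add2l -mulnA leq_mul2l /=.
case: X eq => [|X] eq; last by rewrite mulnS leq_addr.
have a_lt := ltn_pmod l p_gt0; have pE := prednK p_gt0.
by move: lt; rewrite eq muln0 addn0 mulnDr ltn_add2l; move: a_lt; move: (a); clear -pE; lia.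
Qed.

Section Extremal.
Hypothesis t_large : (2 * p * e <= p.-1 * (t + 2))%N.
Variable chi : 'F_p -> K.
Hypotheses (chi0 : chi 0 = 0) (chi1 : chi 1 = 1) (chiM : {morph chi : a b / a * b}).
Hypothesis chi_int : forall a, vge vK 0 (chi a).
Hypothesis chi_inv : forall a : 'F_p, a != 0 -> vge vK 1 (chi a * (a : nat)%:R - 1).
Local Notation WV := (WV chi).

Let pt : ~~ (p %| t)%N.
Proof.
apply: contraTN a_gt0 => pt; rewrite -eqn0Ngt -/(dvdn p l).
by rewrite -(Gauss_dvdr _ (_ : coprime p 2)) ?coprimen2 // double_l dvdn_add.
Qed.

Let W_raises := WV_raises chi1 chiM chi_int chi_inv.

(** The threshold on [t] forces [X = 0] in [jump_excess], so [C] has valuation [nu p.-1], an exact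
    quotient because [p] divides [a + p.-1 * l]. Hence [C *: WV x] reaches [2 * a + p * l]. *)
Let W_wrap : vge vL (2 * a + p * l)%N%:Z (iter p WV x) /\ exists C : K,
  [/\ C != 0, vK C = (nu p l a p.-1)%:Z & forall y, iter p WV y = C *: WV y].
Proof.
have [C [C0 vC CE]] := WV_p chi1 chiM chi_int chi_inv pt.
have [X eq XE] := jump_excess; have a_lt := ltn_pmod l p_gt0; have pE := prednK p_gt0.
have X0 : X = 0%N.
  move: t_large; rewrite eq mulnDr -addnA leq_add2l; case: (X) => // Y.
  by rewrite mulnS; move: a_gt0 (2 * p * Y)%N => + Y'; move: (a); clear -pE; lia.
rewrite (XE X0) in vC; split; last by exists C.
rewrite CE; have := raise_ge W_raises (vge_leq (lexx (vL x))).
move=> /(vgeZ L_space (vge_leq (lexx (vK C)))); apply: vge_trans.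
rewrite vC vx /nu.
have dv : (p %| a + p.-1 * l)%N.
  by rewrite /dvdn -modnDmr -modnMmr modnDmr -mulSn pE modnMr.
have := divnK dv; move: (_ %/ p)%N => N NE.
rewrite -!PoszM -!PoszD lez_nat [(p * N)%N]mulnC NE.
have : (p.-1 * l + l = p * l)%N by rewrite -mulSnr pE.
by move: (p.-1 * l)%N (p * l)%N (a) (l); clear; lia.
Qed.

(** [WV] commutes with [wV] and both have [x] as a cyclic vector, so either may define the order;
    for [WV] the monomial criterion applies with [o = 1], a start [j] corresponding to [j.+1] in
    [start_good]. *)
Lemma free_extremal : O_L_free <->
  (a %| p.-1)%N \/ exists2 x, (0 < x < p)%N & good_start p l x.
Proof.
have [Wwrap [C [C0 vC CE]]] := W_wrap.
have W_cyc y : exists c : 'I_p -> K, y = pw WV c x :=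
  pw_cyclic hK p_prime L_space dimV pi0 vpi W_raises a_gt0 x0 vx y.
have o0 : vsproj L 1 != 0 by rewrite vL_neq0 vsprojK ?mem1v ?oner_eq0.
have comm := WV_wV chi1 chiM chi_inv.
have prinE : principal vL wV <-> principal vL WV.
  split; apply: principal_commuting; try exact: cyc; try exact: W_cyc.
  - exact: raise_lin wL_raises.
  - exact: raise_lin W_raises.
  - exact: comm.
  - exact: raise_lin W_raises.
  - exact: raise_lin wL_raises.
  - by move=> y; rewrite comm.
split=> [/(free_principal cyc)/prinE prin|].
  right; have [j jN jE] := monomial_only_if hK p_prime L_space dimV pi0 vpi W_raises a_gt0 x0 vx
    Wwrap C0 vC CE o0 vL_1 (WV_1 chi1 chiM chi_inv) prin.
  have jp : (0 < j.+1 < p)%N by rewrite /= -(prednK p_gt0).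
  by exists j.+1 => //; apply/(start_good p_prime a_gt0 jp).
case=> [/free_if_dvd//|[j /andP[j0 jp] /(start_good p_prime a_gt0 _) jE]].
apply/(free_principal cyc)/prinE.
apply: (monomial_if hK p_prime L_space dimV pi0 vpi W_raises a_gt0 x0 vx
    Wwrap C0 vC CE o0 vL_1 (WV_1 chi1 chiM chi_inv) (j := j.-1)).
  by rewrite -ltnS !prednK.
by apply: jE; rewrite j0.
Qed.
End Extremal.
End ResidueVector.
End NonzeroResidue.

Section ZeroResidue.
Hypothesis pl : (p %| l)%N.

Lemma dvd_jump : (p %| t)%N.
Proof. by have := dvdn_mull 2 pl; rewrite double_l dvdn_addr. Qed.

Let m := (l %/ p)%N.
Definition wG (y : V) : V := pi ^- m *: wV y.

Let wG_lin : linear wG.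
Proof.
move=> k x y; rewrite /wG (raise_lin wL_raises) scalerDr !scalerA; congr (_ *: _ + _).
by rewrite mulrC.
Qed.

Let iter_wG (i : nat) (y : V) : iter i wG y = pi ^- (m * i) *: iter i wV y.
Proof.
elim: i => [|i IHi]; first by rewrite muln0 expr0 invr1 scale1r.
rewrite !iterS IHi /wG (linZ (raise_lin wL_raises)) scalerA mulnS exprD invfM.
by congr (_ *: _); rewrite mulrC.
Qed.

Let pw_wG (c : 'I_p -> K) y : pw wV c y = pw wG (fun i => c i * pi ^+ (m * i)) y.
Proof.
apply: eq_bigr => i _; rewrite iter_wG scalerA -mulrA mulfV ?mulr1 //.
by rewrite expf_neq0.
Qed.

Let pw_wV (d : 'I_p -> K) y : pw wG d y = pw wV (fun i => d i * pi ^- (m * i)) y.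
Proof. by apply: eq_bigr => i _; rewrite iter_wG scalerA. Qed.

Let int_unit (n : int) : ~~ (p%:Z %| n)%Z -> n%:~R != 0 :> K /\ vK n%:~R = 0.
Proof. exact: (int_unitK hK nat_val). Qed.

Let int_nonunit (n : int) : (p%:Z %| n)%Z -> vge vK 1 n%:~R.
Proof. by move=> /(int_nonunitK hK p_prime nat_val); apply: vge_trans; rewrite lez_nat. Qed.

(** To first order [w] multiplies y by 2 v(y) [theta z], and v is twice [vL]. So [4 theta z pi ^- m]
    appears, of valuation t + p - 2l = 0, and total ramification replaces it by a residually equal
    element of [K]. *)
Lemma wG_graded : exists c : K, [/\ c != 0, vK c = 0 & forall y, y != 0 ->
  vge vL (vL y + 1) (wG y - ((vL y)%:~R * c) *: y)].
Proof.
have [th0 vth] := theta_val hK hv d_gt0 dimE ram Pi0 vPi t_gt0 sigma_jump sigma_jump_max.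
have vz := val_z hK hv p_prime dimE ram Pi0 vPi sigma_p tau_tau sigma_tau K_fixed z0 sz
  z_min z_gt0.
have n4 : ~~ (p%:Z %| 4)%Z.
  by rewrite dvdzE /= -[4%N]/(2 ^ 2)%N Euclid_dvdX // negb_and gtnNdvd ?odd_prime_gt2.
have [f0 v4] := int_unitE hK ram nat_val n4.
have pm0 : (pi ^- m)%:A != 0 :> E by rewrite (alg_neq0 E) // invr_eq0 expf_neq0.
have vpm : v (pi ^- m)%:A = - (p + t)%N%:Z.
  rewrite ram ?invr_eq0 ?expf_neq0 // (nvalXV hK) // vpi mulr1 mulrN.
  by rewrite -double_l -(divnK pl) -/m; congr (- _); rewrite -PoszM -mulnA [(p * m)%N]mulnC.
pose th := theta Pi sigma; pose u : E := 4%:~R * th * z * (pi ^- m)%:A.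
have u0 : u != 0 by rewrite !mulf_neq0.
have vu : v u = 0.
  by rewrite !(valM hv) ?mulf_neq0 // v4 vth vz vpm PoszD; ring.
have [k kP] := residue_field hv d_gt0 dimE ram Pi0 vPi (vge_leq (eq_ind_r (fun x => 0 <= x) (lexx 0) vu)).
have [k0 vk] : k%:A != 0 :> E /\ v k%:A = 0.
  rewrite -vu; apply: (val_sub_dom uE u0); rewrite vu add0r -(vgeN uE) opprB //.
have {}k0 : k != 0 by apply: contraNneq k0 => ->; rewrite scale0r.
exists k; split=> //.
  by move: vk; rewrite ram // => /eqP; rewrite mulf_eq0 => /orP[/eqP|/eqP//]; move: p_gt0; clear; lia.
move=> y y0; apply: vge_L_odd.
have Y0 : vsval y != 0 by rewrite -vL_neq0.
have := udiff_graded hK hv p_prime dimE ram e_gt0 nat_val Pi0 vPi t_gt0 sigma_jump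
  sigma_jump_max Y0.
rewrite -/th; set D := (_ - _) => Dge.
have -> : vsval (wG y - ((vL y)%:~R * k) *: y) =
    ((pi ^- m)%:A * z) * D + (vL y)%:~R * vsval y * (u - k%:A).
  have -> : vsval (wG y - ((vL y)%:~R * k) *: y) =
      (pi ^- m)%:A * (z * udiff p sigma (vsval y)) - ((vL y)%:~R * k)%:A * vsval y.
    by rewrite /wG linearB !linearZ /= (onLE memL) ?wopE // /wop scalerN !mulr_algl.
  have -> : ((vL y)%:~R * k)%:A = (vL y)%:~R * k%:A :> E.
    by rewrite (int_algE E) -scalerAl mul1r scalerA.
  by rewrite /D /u val_L // mulrA !intrM; ring.
apply: (vgeD uE).
  have := vgeM hv (vge_leq (lexx (v ((pi ^- m)%:A * z)))) Dge; apply: vge_trans.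
  rewrite (valM hv) // vpm vz val_L //; move: (vL y) (t) (p); clear; lia.
have := vgeM hv (vge_leq (lexx (v (vsval y)))) kP.
rewrite val_L // => h1; rewrite -mulrA; have := vgeM hv (vge_int hv (vL y)) h1.
by rewrite add0r.
Qed.

Lemma zero_maximal_free : is_the_maximal_order (integers vK predT) H A /\ O_L_free.
Proof.
have [c [c0 vc cP]] := wG_graded.
have pres := graded_preserve hK p_prime L_space vL_onto int_unit int_nonunit wG_lin c0 vc cP.
have [x x_int x_gen] := graded_cyclic hK p_prime L_space dimV vL_onto int_unit wG_lin c0 vc cP.
have cyc y : exists c : 'I_p -> K, y = pw wV c x.
  by have [d -> _] := x_gen y; exists (fun i => d i * pi ^- (m * i)); apply: pw_wV.
have coefE (d : 'I_p -> K) : (forall y, vge vL 0 y -> vge vL 0 (pw wV d y)) <->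
    (forall i : 'I_p, vge vK (- (m * i)%N%:Z) (d i)).
  have -> : (forall y, vge vL 0 y -> vge vL 0 (pw wV d y)) <->
    (forall y, vge vL 0 y -> vge vL 0 (pw wG (fun i => d i * pi ^+ (m * i)) y)).
    by split=> hy y y_int; [rewrite -pw_wG | rewrite pw_wG]; apply: hy.
  rewrite pres; split=> di i; have := di i.
    have vp : vge vK (- (m * i)%N%:Z) (pi ^- (m * i)).
      by rewrite vge_leq // (nvalXV hK) // vpi mulr1.
    move=> /(vgeM hK)/(_ vp); rewrite add0r -mulrA mulfV ?mulr1 // expf_neq0 //.
  have vp : vge vK (m * i)%N%:Z (pi ^+ (m * i)) by rewrite vge_leq // (nvalX hK) // vpi mulr1.
  by move=> /(vgeM hK)/(_ vp); rewrite addNr.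
split.
  apply: (associated_maximal hK p_odd G_gen sigma_order tau_order tau_sigma z0 sz tz two_neq0
    memL cyc L_space vge0_L wL_integral pi0 vpi coefE) => h hH hA.
  have [d hE] := dihedral_H_wpoly p_odd G_gen sigma_order tau_order tau_sigma z0 sz tz two_neq0
    memL cyc hH.
  have actE (y : V) : actL tau h y = pw wG (fun i => d i * pi ^+ (m * i)) y.
    by rewrite hE (actL_wpoly p_odd G_gen sigma_order tau_order tau_sigma sz tz memL) pw_wG.
  have : ~ forall i : 'I_p, vge vK 0 (d i * pi ^+ (m * i)).
    move=> /pres d_int; apply: hA; rewrite hE.
    apply/(associated_wpoly p_odd G_gen sigma_order tau_order tau_sigma sz tz memL vge0_L) => y.
    by rewrite pw_wG; apply: d_int.
  move=> /existsNP[i /negP di].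
  have [y _ y_unb] := graded_unbounded hK p_prime L_space vL_onto int_unit int_nonunit wG_lin c0
    vc cP (d := fun i => d i * pi ^+ (m * i)) di.
  exists y => k; have [k' kP] := y_unb k; exists k'.
  by rewrite (eq_iter actE).
apply/(free_principal cyc); exists x => // y y_int; have [d yE /(_ y_int) d_int] := x_gen y.
exists (pw wG d); rewrite // (funext (pw_wV d)); split.
- exact/pw_lin/(raise_lin wL_raises).
- by move=> u; rewrite pw_w //; apply: raise_lin wL_raises.
by move=> u; rewrite -pw_wV; move: u; apply/pres.
Qed.
End ZeroResidue.

Lemma dihedral_freeness : (exists chi : 'F_p -> K, [/\ chi 1 = 1, {morph chi : a b / a * b},
    forall a, vge vK 0 (chi a) &
    forall a : 'F_p, a != 0 -> vge vK 1 (chi a * (a : nat)%:R - 1)]) ->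
  [/\ a = 0%N -> is_the_maximal_order (integers vK predT) H A /\ O_L_free,
      a <> 0%N -> is_basis (integers vK predT) *:%R A
          (fun i : 'I_p => pi ^- w_exponent p l a i *: w ^+ i),
      ((a %| p.-1)%N -> O_L_free) /\
      ((p.-1 * (t + 2) < 2 * p * e)%N -> O_L_free -> (a %| p.-1)%N)
    & (2 * p * e <= p.-1 * (t + 2))%N -> O_L_free <-> euclid_within 4 l p].
Proof.
move=> [chi [chi1 chiM chi_int chi_inv]]; have [x x0 vx] := vL_onto a.
have N_gt0 : (0 < p.-1)%N by rewrite -ltnS prednK ?prime_gt1.
have [a0|a_gt0] := posnP a.
  (* Now [p] divides [t], so the jump is maximal by [jump_max] and contradicts the hypothesis of the
     converse; and Euclid's algorithm on [l] and [p] stops at once. *)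
  have pl : (p %| l)%N by rewrite /dvdn a0.
  have [Amax Afree] := zero_maximal_free pl; split=> //.
    split=> // lt; have := jump_max hK hv p_prime p_odd dimE ram nat_val Pi0 vPi sigma_p
      tau_tau sigma_tau K_fixed t_gt0 sigma_jump sigma_jump_max (dvd_jump pl).
    by move: lt; rewrite mulnDr => + tE; rewrite tE ltnNge leq_addr.
  by move=> _; rewrite /= pl.
split=> [a0|_||t_large].
- by rewrite a0 in a_gt0.
- exact: (residue_basis a_gt0 x0 vx).
- split; first exact: (free_if_dvd a_gt0 x0 vx).
  exact: (dvd_if_free a_gt0 x0 vx).
rewrite (free_extremal a_gt0 x0 vx t_large chi1 chiM chi_int chi_inv).
by split=> /(euclid_within_start p_prime a_gt0).
Qed.

End DihedralFixedField.

(** * From ramification groups to the hypotheses of the dihedral analysis *)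

Lemma vge_alg (F : fieldType) (E : fieldExtType F) (vF : F -> int) (vE : E -> int) (e : nat) :
  ramification_index vF vE e -> forall n c, vge vF n c -> vge vE (e%:Z * n) c%:A.
Proof.
move=> [e_gt0 ram] n c; have [->|c0] := eqVneq c 0; first by rewrite scale0r !vge0.
by rewrite vgeE // => nc; rewrite vge_leq // ram // ler_pM2l ?ltz_nat.
Qed.

Section RamificationGroups.
Variables (K : fieldType) (vK : K -> int) (hK : normalized_valuation vK).
Variables (E : splittingFieldType K) (v : E -> int) (hv : normalized_valuation v).
Variables (d : nat) (d_gt0 : (0 < d)%N) (dimE : \dim {:E} = d).
Hypothesis ram : forall c : K, c != 0 -> v c%:A = d%:Z * vK c.
Variables (Pi : E) (Pi0 : Pi != 0) (vPi : v Pi = 1).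
Local Notation G_ := (ramification_group v).
Let uE := nval_ultra hv.

Lemma mem_ramification i (g : gal_of {:E}) :
  g \in G_ i <-> forall x, vge v 0 x -> vge v i.+1%:Z (g x - x).
Proof.
rewrite inE galT /=; split=> [/asboolP gi x x_int|gi]; first by apply: gi; apply/andP.
by apply/asboolP => x /andP[_]; apply: gi.
Qed.

Lemma ramification_group_set i : group_set (G_ i).
Proof.
apply/group_setP; split=> [|g h /mem_ramification gi /mem_ramification hi].
  by apply/mem_ramification => x _; rewrite gal_id subrr vge0.
apply/mem_ramification => x x_int; rewrite galM ?memvf //.
rewrite -(subrKA (g x)); apply: (vgeD uE); last exact: gi.
by apply: hi; rewrite (vge_gal hK hv d_gt0 dimE ram Pi0 vPi).
Qed.

Lemma inertia_full : G_ 0 = [set: gal_of {:E}].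
Proof.
apply/setP => g; rewrite in_setT; apply/mem_ramification => x x_int.
have [k xk] := residue_field hv d_gt0 dimE ram Pi0 vPi x_int.
have -> : g x - x = g (x - k%:A) - (x - k%:A) by rewrite rmorphB /= gal_alg; ring.
by rewrite (vgeB uE) // (vge_gal hK hv d_gt0 dimE ram Pi0 vPi).
Qed.

End RamificationGroups.

(** Two different subgroups of order [p] meet trivially, so their product would have [p * p]
    elements. This identifies the group generated by [sigma] with the ramification group at the
    jump. *)
Lemma subset_prime_order (gT : finGroupType) (p : nat) (A B : {group gT}) : prime p ->
  (#|[set: gT]| < p * p)%N -> #|A| = p -> #|B| = p -> A \subset B.
Proof.
move=> p_prime small Ap Bp; have [//|AB] := boolP (A \subset B).
have tri : A :&: B = 1%g by apply: prime_TIg; rewrite ?Ap.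
by move: small; rewrite ltnNge -{1}Ap -Bp -(TI_cardMg tri) subset_leq_card ?subsetT.
Qed.
Theorem theorem1p2
  (p : nat) (p_prime : prime p) (p_odd : odd p)
  (Qp : fieldType) (vp : Qp -> int) (Qp_padic : padic_field p vp)
  (K : fieldExtType Qp) (vK : K -> int) (vK_val : normalized_valuation vK)
  (e : nat) (K_ram : ramification_index vp vK e)
  (Lt : splittingFieldType K) (v : Lt -> int) (v_val : normalized_valuation v)
  (Lt_totram : ramification_index vK v (\dim {:Lt}))
  (L : {subfield Lt}) (L_deg : \dim L = p) (L_closure : normal_closure L)
  (G_dihedral : ('Gal({:Lt} / 1%AS) \isog 'D_(2 * p))%g)
  (sigma tau : gal_of {:Lt})
  (G_gen : <<[set sigma; tau]>>%g = ('Gal({:Lt} / 1%AS))%g)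
  (sigma_order : #[sigma]%g = p) (tau_order : #[tau]%g = 2%N)
  (tau_sigma : (tau * sigma = sigma^-1 * tau)%g)
  (L_fixed : (L : {vspace Lt}) = fixedField <[tau]>%g)
  (z : Lt) (z_unif : uniformizer v (mem (fixedField <[sigma]>%g)) z)
  (tau_z : tau z = - z)
  (piK : K) (piK_unif : uniformizer vK predT piK)
  (t : nat) (t_jump : ramification_jump v p t) :
  let l := ((p + t) %/ 2)%N in
  let a := (l %% p)%N in
  let OK := integers vK predT in
  let OL := integers v (mem L) in
  let H := dihedral_H sigma tau in
  let w := dihedral_w sigma tau z in
  let A := associated_order sigma tau OL in
  let OL_free := is_free A (dihedral_act tau) OL in
  let bound : rat := (2 * p * e)%:R / (p.-1)%:R - 2 in
  [/\ a = 0%N -> is_the_maximal_order OK H A /\ OL_free,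
      a <> 0%N ->
        is_basis OK *:%R A
          (fun i : 'I_p => piK ^- w_exponent p l a i *: w ^+ i),
      ((a %| p.-1)%N -> OL_free) /\
      (t%:R < bound -> OL_free -> (a %| p.-1)%N)
    & bound <= t%:R ->
        forall (a0 : int) (s : seq int),
          cfrac_expansion (l%:R / p%:R) a0 s ->
          (OL_free <-> (size s <= 4)%N)].
Proof.
move=> l a OK OL H w A OL_free bound.
have p_gt0 := prime_gt0 p_prime; have p_gt2 : (2 < p)%N by apply: odd_prime_gt2.
have fixedP (g : gal_of {:Lt}) x : reflect (g x = x) (x \in fixedField <[g]>%g).
  apply: (iffP (fixedFieldP _)); rewrite ?memvf //; first by apply; apply: cycle_id.
  by move=> gx h /cycleP[n ->]; rewrite -iter_gal; elim: n => //= n ->.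
have memL x : (x \in L) = (tau x == x).
  by rewrite [x \in _](_ : _ = (x \in (L : {vspace Lt}))) // L_fixed; apply/fixedP/eqP.
have dimE : \dim {:Lt} = (2 * p)%N.
  have := dim_fixedField <[tau]>%G; rewrite -orderE tau_order -L_fixed L_deg => ->.
  by rewrite divnK // -L_deg field_dimS ?subvf.
rewrite dimE in Lt_totram; have [d_gt0 ram] := Lt_totram.
have G2p : #|[set: gal_of {:Lt}]| = (2 * p)%N.
  have -> : [set: gal_of {:Lt}] = 'Gal({:Lt} / 1%AS)%g by apply/setP => g; rewrite in_setT galT.
  by rewrite (card_isog G_dihedral) mul2n card_dihedral ?prime_gt1.
have [Pi Pi0 vPi] := val_onto v_val 1.
have K_fixed y : sigma y = y -> tau y = y -> exists k : K, y = k%:A.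
  move=> sy ty; pose F := fixedField 'Gal({:Lt} / 1%AS)%g.
  have yF : y \in F.
    apply/fixedFieldP; first exact: memvf.
    move=> g _; move: g; apply: (gen_group G_gen) => //; first exact: gal_id.
    by move=> g h gy hy; rewrite galM ?memvf // gy.
  have F1 : \dim F = 1%N.
    have := dim_fixedField 'Gal({:Lt} / 1%AS)%G; rewrite -/F.
    have -> : 'Gal({:Lt} / 1%AS)%G = [set: gal_of {:Lt}]%G by apply/group_inj/setP => g; rewrite in_setT galT.
    have := field_dimS (subvf F); rewrite dimE G2p => dv; have := divnK dv => + E1.
    by rewrite -E1 => /eqP; rewrite -{2}[(2 * p)%N]muln1 eqn_pmul2l ?muln_gt0 // => /eqP.
  have /vlineP[k ->] : y \in <[1 : Lt]>%VS.
    suff -> : <[1 : Lt]>%VS = F by [].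
    by apply/eqP; rewrite eqEdim F1 -memvE mem1v dim_vline oner_eq0.
  by exists k.
have e_gt0 := proj1 K_ram.
have nat_val n : (0 < n)%N -> n%:R != 0 :> K /\ vK n%:R = (e * logn p n)%N%:Z.
  move=> n_gt0; have [n0 vn] := padic_nat Qp_padic n_gt0.
  have -> : n%:R = (n%:R)%:A :> K by rewrite scaler_nat.
  by rewrite scaler_eq0 oner_eq0 orbF n0 (proj2 K_ram) // vn.
have [Gt Gt1] := t_jump.
have small : (#|[set: gal_of {:Lt}]| < p * p)%N by rewrite G2p ltn_pmul2r.
have sigma_in : sigma \in ramification_group v t.
  have := @subset_prime_order _ p <[sigma]>%G
    (Group (ramification_group_set vK_val v_val d_gt0 dimE ram Pi0 vPi t)) p_prime small
    sigma_order Gt.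
  by move=> /subsetP; apply; apply: cycle_id.
have sigma_jump := (mem_ramification v t sigma).1 sigma_in.
have sigma_jump_max : exists2 y, vge v 0 y & ~~ vge v t.+2%:Z (sigma y - y).
  have : sigma \notin ramification_group v t.+1.
    rewrite Gt1 inE; apply: contraTneq p_gt2 => s1.
    by rewrite -sigma_order s1 order1.
  move=> /negP; apply: contra_notP => none; apply/mem_ramification => y y_int.
  by apply/negPn/negP => yN; apply: none; exists y.
(* At [t = 0] the ramification group is the whole Galois group, of order [2 * p] instead of [p]. *)
have t_gt0 : (0 < t)%N.
  rewrite lt0n; apply/eqP => t0; move: Gt; rewrite t0.
  rewrite (inertia_full vK_val v_val d_gt0 dimE ram Pi0 vPi) G2p; move: p_gt0; clear; lia.
have [z_in z0 z_gt0 z_min] := z_unif.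
have sz : sigma z = z by apply/fixedP.
have [_ piK0 piK_gt0 piK_min] := piK_unif.
have vpiK : vK piK = 1.
  have [u u0 vu] := val_onto vK_val 1; have := piK_min u isT u0; rewrite vu.
  by move=> /(_ isT); move: piK_gt0; clear; lia.
have [chi [_ chi1 chiM chi_int chi_inv]] := teichmuller_character p_prime Qp_padic.
have algK : exists chi : 'F_p -> K, [/\ chi 1 = 1, {morph chi : a b / a * b},
    forall a, vge vK 0 (chi a) &
    forall a : 'F_p, a != 0 -> vge vK 1 (chi a * (a : nat)%:R - 1)].
  exists (fun i => (chi i)%:A); split=> [|i j|i|i i0].
  - by rewrite chi1 scale1r.
  - by rewrite chiM -scalerAl mul1r scalerA.
  - by have := vge_alg K_ram (chi_int i); rewrite mulr0.
  have -> : (chi i)%:A * i%:R - 1 = (chi i * i%:R - 1)%:A :> K.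
    by rewrite scalerBl scale1r mulr_natr -scaler_nat scalerA mulrC.
  apply: vge_trans (vge_alg K_ram (chi_inv _ i0)).
  by rewrite mulr1 lez_nat.
have z_min' y : sigma y = y -> y != 0 -> 0 < v y -> v z <= v y.
  by move=> /fixedP; apply: z_min.
have [max basis [free_if only_if] extremal] := dihedral_freeness vK_val v_val p_prime p_odd dimE
  ram e_gt0 nat_val Pi0 vPi G_gen sigma_order tau_order tau_sigma K_fixed t_gt0 sigma_jump
  sigma_jump_max z0 sz tau_z z_min' z_gt0 memL L_deg piK0 vpiK algK.
have boundE : (bound <= t%:R) = (2 * p * e <= p.-1 * (t + 2))%N.
  have N_gt0 : 0 < p.-1%:R :> rat by rewrite ltr0n -ltnS prednK ?prime_gt1.
  by rewrite lerBlDr ler_pdivrMr // -[2]/(2%:R) -natrD -natrM ler_nat [(p.-1 * _)%N]mulnC.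
split=> //.
  by split=> // lt; apply: only_if; rewrite ltnNge -boundE -ltNge.
rewrite boundE => /extremal free_E a0 s cf.
by rewrite (cfrac_size 4 p_gt0 cf).
Qed.
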